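(* For any helper rates $R_e\ge R_d\ge0$, $\mathcal R_g^O(R_e,R_d,D)=\mathcal R(R_d,D)$.
   Context: Let $\mathcal X,\mathcal Y,\mathcal Z,\hat{\mathcal X}$ be finite alphabets, $d:\mathcal X\times\hat{\mathcal X}\to[0,\infty)$, and $(X_i,Y_i,Z_i)$ i.i.d. $\sim p(x,y)p(z|x)$ (Markov chain $Y-X-Z$). An $(n,M,M_e,M_d,D)$ code with different helper messages consists of helper encoders $f_e:\mathcal Y^n\to\{1,\dots,M_e\}$ (message to the source encoder) and $f_d:\mathcal Y^n\to\{1,\dots,M_d\}$ (message to the decoder), a source encoder $f:\mathcal X^n\times\{1,\dots,M_e\}\to\{1,\dots,M\}$, and a decoder that, using $f(X^n,f_e(Y^n))$, $f_d(Y^n)$ and the side information $Z^n$, outputs $\hat X^n$, with $\mathbb E[\frac1n\sum_i d(X_i,\hat X_i)]\le D$. $(R,R_e,R_d)$ is achievable if for every $\delta>0$ and large $n$ there exists an $(n,2^{n(R+\delta)},2^{n(R_e+\delta)},2^{n(R_d+\delta)},D+\delta)$ code; $\mathcal R_g^O(D)$ is the closure of the set of achievable triples, and $\mathcal R_g^O(R_e,R_d,D)=\{R:(R,R_e,R_d)\in\mathcal R_g^O(D)\}$. Further, $\mathcal R_{Y-X-Z}(D)$ is the set of pairs $(R,R_1)$ with $R_1\ge I(U;Y|Z)$ and $R\ge I(X;W|U,Z)$ for some finite-alphabet $U,W$ with joint distribution $p(x,y)p(z|x)p(u|y)p(w|x,u)$ and a function $\hat X(U,W,Z)$ with $\mathbb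 E\, d(X,\hat X(U,W,Z))\le D$, and $\mathcal R(R_1,D)=\{R:(R,R_1)\in\mathcal R_{Y-X-Z}(D)\}$. *)

(* Defs.v *)
From HB Require Import structures.
From mathcomp Require Import all_boot all_order all_algebra.
From mathcomp Require Import all_classical all_reals all_analysis.
Set Implicit Arguments. Unset Strict Implicit. Unset Printing Implicit Defensive.
Import Order.TTheory GRing.Theory Num.Theory.
Import numFieldNormedType.Exports.
Local Open Scope classical_set_scope.
Local Open Scope ring_scope.

Section Defs.
Variable R : realType.

Definition log2 (x : R) : R := ln x / ln 2.

Definition Pr (O : finType) (P : O -> R) (E : pred O) : R :=
  \sum_(o : O | E o) P o.

(* conditional mutual information I(A;B|C) of random variables A, B, C
   defined on the finite sample space O with pmf P:
   E[ log2 ( P(a,b,c) P(c) / (P(a,c) P(b,c)) ) ]  (terms with P o = 0 vanish) *)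
Definition cmi (O : finType) (P : O -> R) (TA TB TC : eqType)
  (A : O -> TA) (B : O -> TB) (C : O -> TC) : R :=
  \sum_(o : O) P o *
    log2 ((Pr P (fun o' => [&& A o' == A o, B o' == B o & C o' == C o])
           * Pr P (fun o' => C o' == C o))
          / (Pr P (fun o' => (A o' == A o) && (C o' == C o))
             * Pr P (fun o' => (B o' == B o) && (C o' == C o)))).

Variables (X Y Z Xh : finType).
Variable p : X -> Y -> R.
Variable pz : X -> Z -> R.
Variable d : X -> Xh -> R.

Definition source_ok : Prop :=
  (forall x y, 0 <= p x y) /\ \sum_(x : X) \sum_(y : Y) p x y = 1 /\
  (forall x z, 0 <= pz x z) /\ (forall x, \sum_(z : Z) pz x z = 1) /\
  (forall x xh, 0 <= d x xh).

Definition iid_pmf (n : nat) (xs : {ffun 'I_n -> X}) (ys : {ffun 'I_n -> Y})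
  (zs : {ffun 'I_n -> Z}) : R :=
  \prod_(i < n) (p (xs i) (ys i) * pz (xs i) (zs i)).

Definition code_distortion (n M Me Md : nat)
  (fe : {ffun 'I_n -> Y} -> 'I_Me) (fd : {ffun 'I_n -> Y} -> 'I_Md)
  (f : {ffun 'I_n -> X} -> 'I_Me -> 'I_M)
  (g : 'I_M -> 'I_Md -> {ffun 'I_n -> Z} -> {ffun 'I_n -> Xh}) : R :=
  \sum_(xs : {ffun 'I_n -> X}) \sum_(ys : {ffun 'I_n -> Y})
    \sum_(zs : {ffun 'I_n -> Z})
      iid_pmf xs ys zs *
      ((n%:R)^-1 * \sum_(i < n)
          d (xs i) (g (f xs (fe ys)) (fd ys) zs i)).

Definition code_exists (n : nat) (M Me Md D : R) : Prop :=
  exists (m me md : nat)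
    (fe : {ffun 'I_n -> Y} -> 'I_me) (fd : {ffun 'I_n -> Y} -> 'I_md)
    (f : {ffun 'I_n -> X} -> 'I_me -> 'I_m)
    (g : 'I_m -> 'I_md -> {ffun 'I_n -> Z} -> {ffun 'I_n -> Xh}),
    [/\ m%:R <= M, me%:R <= Me, md%:R <= Md &
        code_distortion fe fd f g <= D].

Definition achievable (D : R) (t : R * R * R) : Prop :=
  let: (r, re, rd) := t in
  forall delta : R, 0 < delta ->
    exists N : nat, forall n : nat, (N <= n)%N -> (0 < n)%N ->
      code_exists n (2 `^ (n%:R * (r + delta)))
                    (2 `^ (n%:R * (re + delta)))
                    (2 `^ (n%:R * (rd + delta))) (D + delta).

Definition RgO (D : R) : set (R * R * R) := @closure (R * R * R)%type [set t | achievable D t].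

Definition RgO_sec (Re Rd D : R) : set R := [set r | RgO D (r, Re, Rd)].

Definition R_YXZ (D : R) : set (R * R) :=
  [set rr | exists (U W : finType) (q : Y -> U -> R) (w : X -> U -> W -> R)
      (xhat : U -> W -> Z -> Xh),
     [/\ (forall y u, 0 <= q y u), (forall y, \sum_(u : U) q y u = 1),
         (forall x u w', 0 <= w x u w'), (forall x u, \sum_(w' : W) w x u w' = 1) &
     let J : X * Y * Z * U * W -> R :=
       fun o => let: (x, y, z, u, w') := o in p x y * pz x z * q y u * w x u w' in
     [/\ \sum_(o : X * Y * Z * U * W)
            J o * (let: (x, y, z, u, w') := o in d x (xhat u w' z)) <= D,
         rr.2 >= cmi J (fun o => o.1.2) (fun o => o.1.1.1.2) (fun o => o.1.1.2) &
         rr.1 >= cmi J (fun o => o.1.1.1.1) (fun o => o.2)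
                      (fun o => (o.1.2, o.1.1.2))]]].

Definition R_sec (R1 D : R) : set R := [set r | R_YXZ D (r, R1)].

End Defs.

(* Main.v *)
Require Import Defs.
From HB Require Import structures.
From mathcomp Require Import all_boot all_order all_algebra.
From mathcomp Require Import all_classical all_reals all_analysis.
From mathcomp Require Import ring lra.
Set Implicit Arguments. Unset Strict Implicit. Unset Printing Implicit Defensive.
Import Order.TTheory GRing.Theory Num.Theory.
Import numFieldNormedType.Exports.
Local Open Scope classical_set_scope.
Local Open Scope ring_scope.

(** Achievability: all auxiliary sequences are binned at random (output
    statistics of random binning).  Each U^n is given a pair (message, shared
    index), and so is each W^n.  If the shared indices have rates slightly below
    H(U|Y) and H(W|X,U), they are nearly uniform and independent of the source,
    so they can be drawn first and then frozen, the helper and the encoder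
    drawing U^n and W^n conditionally on them.  The messages of rates
    I(U;Y|Z) = H(U|Z) - H(U|Y) and I(X;W|U,Z) = H(W|U,Z) - H(W|X,U) bring the
    total bin rates above H(U|Z) and H(W|U,Z), so the decoder recovers both
    sequences; since U - Y - X - Z is Markov, H(U|X) <= H(U|Z), so the same
    message also tells the encoder U^n.  Hence one message serves as both helper
    messages, and R_e >= R_d is all that is needed.

    Converse: with U_i = (f_d(Y^n), (X,Y)^(i-1), Z^(n minus i)) and W_i the map
    sending z_i to the i-th reconstruction, the chain rule gives both rate bounds
    whatever the helper tells the encoder.  The sum of the contributions of the
    letters of U is linear, so Caratheodory's theorem bounds the alphabet of U,
    and compactness removes the slack coming from delta and from the closure. *)

(** * Product measures *)

(** Since the shared indices are nearly uniform, drawing them first leaves the law of the block,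
    decoding errors apart, close to the memoryless one; atypical events then belong to one product
    measure, where Chebyshev's inequality controls them. Distortion is linear in every random
    choice, so bins, indices and stochastic encoders can be frozen one after another at a value no
    worse than average.

    The obstacle in the converse is W_i: through [fe] it may depend on Y_i even given (X_i, U_i),
    which breaks the required factorisation. The past inside U_i therefore contains X as well as Y,
    so that entropies of whole letters (X,Y) telescope, and W_i is afterwards replaced by a channel
    from (X_i, U_i) with the same law of (X,W,U,Z). The alphabet so produced grows with the block
    length; it has to be made independent of the slack before a limit can be taken.

    Entropies are in nats, and factors ln 2 convert to bits. *)

Section ProductMeasure.
Variables (R : realType) (I A : finType) (P : A -> R).

Definition prodw (f : {ffun I -> A}) : R := \prod_i P (f i).

Hypothesis P0 : forall a, 0 <= P a.
Hypothesis P1 : \sum_a P a = 1.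

Lemma prodw_ge0 f : 0 <= prodw f.
Proof. by apply: prodr_ge0 => i _. Qed.

Lemma prodw_expect (F : I -> A -> R) :
  \sum_f prodw f * \prod_i F i (f i) = \prod_i \sum_a P a * F i a.
Proof.
rewrite (bigA_distr_bigA (fun i a => P a * F i a)).
by apply: eq_bigr => f _; rewrite -big_split.
Qed.

Lemma prodw_sum1 : \sum_f prodw f = 1.
Proof.
transitivity (\sum_f prodw f * \prod_(i : I) 1).
  by apply: eq_bigr => f _; rewrite big1_eq mulr1.
rewrite (prodw_expect (fun _ _ => 1)); apply: big1 => i _.
by under eq_bigr do rewrite mulr1.
Qed.

Lemma prodw_marg i (G : A -> R) :
  \sum_f prodw f * G (f i) = \sum_a P a * G a.
Proof.
transitivity (\sum_f prodw f * \prod_j (if j == i then G (f j) else 1)).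
  by apply: eq_bigr => f _; rewrite -big_mkcond big_pred1_eq.
rewrite (prodw_expect (fun j a => if j == i then G a else 1)).
rewrite (bigD1 i) //= eqxx [X in _ * X]big1 ?mulr1 // => j /negbTE ->.
by under eq_bigr do rewrite mulr1.
Qed.

Lemma prodw_marg2 i j (G H : A -> R) : i != j ->
  \sum_f prodw f * (G (f i) * H (f j)) =
  (\sum_a P a * G a) * (\sum_a P a * H a).
Proof.
move=> ij.
pose F k a := if k == i then G a else if k == j then H a else 1.
transitivity (\sum_f prodw f * \prod_k F k (f k)).
  apply: eq_bigr => f _; congr (_ * _).
  rewrite (bigD1 i) //= (bigD1 j) ?[j == i]eq_sym //= /F eqxx.
  rewrite [j == i]eq_sym (negbTE ij) eqxx [X in _ * (_ * X)]big1 ?mulr1 //.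
  by move=> k /andP[/negbTE -> /negbTE ->].
rewrite prodw_expect (bigD1 i) //= (bigD1 j) ?[j == i]eq_sym //= /F eqxx.
rewrite [j == i]eq_sym (negbTE ij) eqxx [X in _ * (_ * X)]big1 ?mulr1 //.
move=> k /andP[/negbTE -> /negbTE ->].
by under eq_bigr do rewrite mulr1.
Qed.

(** Coordinates are independent and every [G i] is centred, so the cross terms vanish. *)
Lemma prodw_second_moment (G : I -> A -> R) :
  (forall i, \sum_a P a * G i a = 0) ->
  \sum_f prodw f * (\sum_i G i (f i)) ^+ 2 = \sum_i \sum_a P a * G i a ^+ 2.
Proof.
move=> G0.
transitivity (\sum_i \sum_j \sum_f prodw f * (G i (f i) * G j (f j))).
  under eq_bigr do rewrite expr2 big_distrlr /= mulr_sumr.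
  rewrite exchange_big; apply: eq_bigr => i _.
  under eq_bigr do rewrite mulr_sumr.
  by rewrite exchange_big.
apply: eq_bigr => i _; rewrite (bigD1 i) //= [X in _ + X]big1 ?addr0.
  under eq_bigr do rewrite -expr2.
  by rewrite (prodw_marg i (fun a => G i a ^+ 2)).
by move=> j ji; rewrite prodw_marg2 1?eq_sym // !G0 mulr0.
Qed.

Lemma prodw_chebyshev (g : A -> R) (mu eta : R) :
  mu = \sum_a P a * g a -> 0 < eta -> (0 < #|I|)%N ->
  \sum_(f : {ffun I -> A} | eta * #|I|%:R <= `|\sum_i g (f i) - #|I|%:R * mu|) prodw f <=
  (\sum_a P a * (g a - mu) ^+ 2) / (#|I|%:R * eta ^+ 2).
Proof.
move=> muE eta0 I0.
have c0 : 0 < #|I|%:R * eta by rewrite mulr_gt0 ?ltr0n.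
have := @prodw_second_moment (fun _ a => g a - mu).
have -> : \sum_(i : I) \sum_a P a * (g a - mu) ^+ 2 =
   #|I|%:R * \sum_a P a * (g a - mu) ^+ 2 by rewrite sumr_const mulr_natl.
move=> eqm.
have G0 : \sum_a P a * (g a - mu) = 0.
  under eq_bigr do rewrite mulrBr.
  by rewrite sumrB -mulr_suml P1 mul1r -muE subrr.
have {}eqm := eqm (fun _ => G0).
rewrite ler_pdivlMr ?mulr_gt0 ?exprn_gt0 ?ltr0n //.
rewrite -(ler_pM2l (x := #|I|%:R)) ?ltr0n // -eqm.
have -> : forall (x : R), #|I|%:R * (x * (#|I|%:R * eta ^+ 2)) = x * (#|I|%:R * eta) ^+ 2.
  by move=> x; ring.
rewrite mulr_suml big_mkcond /=; apply: ler_sum => f _.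
case: ifP => [H|_]; last by rewrite mulr_ge0 ?prodw_ge0 ?sqr_ge0.
apply: ler_wpM2l; first exact: prodw_ge0.
rewrite -[leRHS]real_normK ?num_real // lerXn2r ?nnegrE ?normr_ge0 ?(ltW c0) //.
by rewrite sumrB sumr_const mulrC -[X in _ - X]mulr_natl.
Qed.

End ProductMeasure.

(** * Random binning *)

Section Averaging.
Variable R : realType.

Lemma exists_le_average (T : finType) (P F : T -> R) :
  (forall t, 0 <= P t) -> \sum_t P t = 1 ->
  exists t, F t <= \sum_t P t * F t.
Proof.
move=> P0 P1; apply: contrapT => /forallNP H.
have lt t : \sum_t P t * F t < F t by rewrite ltNge; apply/negP/H.
have [t0 Pt0] : exists t, 0 < P t.
  apply: contrapT => /forallNP H0.
  suff : \sum_t P t = 0 by rewrite P1 => /eqP; rewrite oner_eq0.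
  apply: big1 => t _; apply/eqP; rewrite eq_le P0 andbT leNgt.
  by apply/negP/H0.
suff : \sum_t P t * F t < \sum_t P t * F t by rewrite ltxx.
rewrite -[ltLHS]mul1r -P1 mulr_suml.
rewrite (bigD1 t0) //= [ltRHS](bigD1 t0) //=.
apply: ltr_leD; first by rewrite ltr_pM2l.
by apply: ler_sum => t _; apply: ler_wpM2l => //; apply: ltW.
Qed.

(** The objective is linear in each row of the kernel, so every input can be given its own best
    output. This derandomises the helper and the encoder. *)
Lemma exists_deterministic_kernel (I W : finType) (Q H : I -> W -> R) :
  (forall i w, 0 <= Q i w) -> (forall i, \sum_w Q i w = 1) ->
  exists sel : I -> W, \sum_i H i (sel i) <= \sum_i \sum_w Q i w * H i w.
Proof.
move=> Q0 Q1.
have /choice[sel selP] : forall i, exists w, H i w <= \sum_w Q i w * H i w.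
  by move=> i; apply: exists_le_average.
by exists sel; apply: ler_sum => i _; exact: selP.
Qed.

Lemma sumr_cst (T : finType) (c : R) : \sum_(t : T) c = #|T|%:R * c.
Proof. by rewrite sumr_const [RHS]mulr_natl. Qed.

Lemma sum_indicator (T : finType) (a : T) (F : T -> R) :
  \sum_t (t == a)%:R * F t = F a.
Proof.
rewrite (bigD1 a) //= eqxx mul1r big1 ?addr0 // => t /negbTE ->.
by rewrite mul0r.
Qed.

(* Conditioning the pmf q on the value of h, and then drawing that value
   uniformly, perturbs expectations by at most the distance of the law of h
   from uniform. *)
Lemma conditional_kernel (U F : finType) (h : U -> F) (q : U -> R) :
  (forall u, 0 <= q u) -> \sum_u q u = 1 ->
  exists Q : F -> U -> R, [/\ forall f u, 0 <= Q f u, forall f, \sum_u Q f u = 1 &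
    forall (H : F -> U -> R) C, (forall f u, 0 <= H f u) -> (forall f u, H f u <= C) ->
    \sum_f #|F|%:R^-1 * (\sum_u Q f u * H f u) <=
    \sum_u q u * H (h u) u +
    C * \sum_f `|\sum_(u | h u == f) q u - #|F|%:R^-1|].
Proof.
move=> q0 q1.
have [u0 _] := @exists_le_average U q (fun=> 0) q0 q1.
pose qb f := \sum_(u | h u == f) q u.
have qb0 f : 0 <= qb f by apply: sumr_ge0.
(* On a null bin the conditional law is an arbitrary point mass, so that [Q f] is a pmf for every
   [f]. *)
pose Q f u := if qb f == 0 then (u == u0)%:R else (h u == f)%:R * q u / qb f.
have Q0 f u : 0 <= Q f u.
  by rewrite /Q; case: ifP => // _; rewrite divr_ge0 ?mulr_ge0.
have Q1 f : \sum_u Q f u = 1.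
  rewrite /Q; have [_|qf] := eqVneq (qb f) 0.
    by rewrite -[RHS](sum_indicator u0 (fun=> 1)); apply: eq_bigr => u _; rewrite mulr1.
  rewrite -mulr_suml -[X in X / _](_ : qb f = _) ?divff //.
  by rewrite /qb big_mkcond; apply: eq_bigr => u _; case: eqP; rewrite ?mul1r ?mul0r.
(* Valid for null bins too: there [q] vanishes on the whole fibre. *)
have qbQ f u : qb f * Q f u = (h u == f)%:R * q u.
  rewrite /Q; case: ifPn => [/eqP qf|qf]; last by rewrite mulrCA divff ?mulr1.
  rewrite qf mul0r; case: eqP => [hu|_]; last by rewrite mul0r.
  move/eqP: qf; rewrite /qb psumr_eq0 // => /allP /(_ u).
  by rewrite mem_index_enum hu eqxx mul1r => /(_ isT) /eqP ->.
exists Q; split => // H C H0 HC.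
have HQ0 f : 0 <= \sum_u Q f u * H f u by apply: sumr_ge0 => u _; rewrite mulr_ge0.
have HQC f : \sum_u Q f u * H f u <= C.
  rewrite -[leRHS]mul1r -(Q1 f) mulr_suml.
  by apply: ler_sum => u _; apply: ler_wpM2l.
have -> : \sum_u q u * H (h u) u = \sum_f qb f * \sum_u Q f u * H f u.
  under [RHS]eq_bigr do rewrite mulr_sumr.
  rewrite exchange_big /=; apply: eq_bigr => u _.
  under eq_bigr do rewrite mulrA qbQ -mulrA eq_sym.
  by rewrite (sum_indicator (h u) (fun f => q u * H f u)).
rewrite mulr_sumr -big_split; apply: ler_sum => f _ /=.
rewrite -lerBlDl -mulrBl -/(qb f).
apply: (@le_trans _ _ (`|qb f - #|F|%:R^-1| * \sum_u Q f u * H f u)).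
  by apply: ler_wpM2r => //; rewrite distrC ler_norm.
by rewrite mulrC ler_wpM2r.
Qed.

End Averaging.

(** * Bin collisions and uniformity of the bin index *)

Section RandomBinning.
Variables (R : realType) (U K : finType).

Definition unifw : K -> R := fun=> #|K|%:R^-1.

Hypothesis K0 : (0 < #|K|)%N.

Lemma unifw_ge0 k : 0 <= unifw k.
Proof. by rewrite invr_ge0. Qed.

Lemma unifw_sum1 : \sum_k unifw k = 1.
Proof. by rewrite sumr_cst divff // pnatr_eq0 -lt0n. Qed.

Lemma bin_collision (u u' : U) : u != u' ->
  \sum_b prodw unifw b * (b u == b u')%:R = #|K|%:R^-1.
Proof.
move=> uu'.
transitivity (\sum_k \sum_b prodw unifw b * ((b u == k)%:R * (b u' == k)%:R)).
  rewrite exchange_big; apply: eq_bigr => b _ /=.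
  rewrite -mulr_sumr; congr (_ * _).
  under eq_bigr do rewrite eq_sym.
  by rewrite (sum_indicator (b u) (fun k => (b u' == k)%:R)) eq_sym.
under eq_bigr => k _.
  rewrite (prodw_marg2 unifw_sum1 (fun a => (a == k)%:R) (fun a => (a == k)%:R) uu').
  under eq_bigr do rewrite mulrC.
  rewrite (sum_indicator k unifw) -[unifw _ * _]/(#|K|%:R^-1 * #|K|%:R^-1).
  over.
by rewrite sumr_cst mulrA divff ?mul1r // pnatr_eq0 -lt0n.
Qed.

(** The arbitrary choice is harmless: a second listed element in the bin is counted as an error
    anyway. *)
Definition bin_dec (b : {ffun U -> K}) (S : {set U}) (u0 : U) (k : K) : U :=
  odflt u0 [pick u in S | b u == k].

(** Union bound: decoding fails only if the true element is missing from the list or shares its bin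
    with another listed element. *)
Lemma bin_dec_err b S u0 u : (bin_dec b S u0 (b u) != u)%:R <=
  (u \notin S)%:R + \sum_(u' in S | u' != u) (b u == b u')%:R :> R.
Proof.
case: (boolP (u \in S)) => uS /=; last first.
  apply: (@le_trans _ _ 1); first by case: (_ != _).
  by rewrite lerDl sumr_ge0.
rewrite add0r /bin_dec; case: pickP => [u' /andP[u'S /eqP bu']|/(_ u)] /=; last first.
  by rewrite uS eqxx.
case: eqP => [_|/eqP u'u]; first by rewrite sumr_ge0.
rewrite (bigD1 u') /= ?u'S ?u'u // bu' eqxx lerDl sumr_ge0 //.
Qed.

Lemma bin_dec_avg_err S u0 u :
  \sum_b prodw unifw b * (bin_dec b S u0 (b u) != u)%:R <=
  (u \notin S)%:R + #|S|%:R / #|K|%:R.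
Proof.
pose G (b : {ffun U -> K}) : R := \sum_(u' in S | u' != u) (b u == b u')%:R.
apply: (@le_trans _ _ (\sum_b prodw unifw b * ((u \notin S)%:R + G b))).
  apply: ler_sum => b _; apply: ler_wpM2l; first exact/prodw_ge0/unifw_ge0.
  exact: bin_dec_err.
under eq_bigr do rewrite mulrDr.
rewrite big_split /= -mulr_suml prodw_sum1 ?unifw_sum1 // mul1r lerD2l.
under eq_bigr do rewrite mulr_sumr.
rewrite exchange_big /=.
apply: (@le_trans _ _ (\sum_(u' in S | u' != u) #|K|%:R^-1)).
  by apply: ler_sum => u' /andP[_ u'u]; rewrite bin_collision // eq_sym.
rewrite sumr_const -[leLHS]mulr_natl ler_wpM2r ?invr_ge0 // ler_nat.
by apply: subset_leq_card; apply/fintype.subsetP => v /andP[].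
Qed.

Variables (F : finType) (h : K -> F).
Hypothesis h_unif : forall f, \sum_k unifw k * (h k == f)%:R = #|F|%:R^-1.

(** On [T] the pmf is flat, so the mass of a hash value concentrates around its mean: its average
    squared deviation is at most [sigma / L], with [L] the number of hash values. Mass outside [T]
    is counted twice, once in the bin law and once in the uniform one. *)
Lemma leftover_hash (q : U -> R) (T : {set U}) (sigma eps : R) :
  (0 < #|F|)%N -> 0 <= sigma ->
  (forall u, 0 <= q u) -> \sum_u q u = 1 -> (forall u, u \in T -> q u <= sigma) ->
  0 < eps ->
  \sum_b prodw unifw b * (\sum_f `|\sum_(u | h (b u) == f) q u - #|F|%:R^-1|) <=
  sigma * #|F|%:R / (2 * eps) + eps / 2 + 2 * \sum_(u | u \notin T) q u.
Proof.
move=> F0 s0 q0 q1 qT eps0.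
set L : R := #|F|%:R; have L0 : 0 < L by rewrite ltr0n.
have Lneq0 : L != 0 by rewrite gt_eqF.
(* [A] is the centred contribution of the flat part [T]; [B] dominates that of the rest. *)
pose A f (b : {ffun U -> K}) : R :=
  \sum_u (u \in T)%:R * q u * ((h (b u) == f)%:R - L^-1).
pose B f (b : {ffun U -> K}) : R :=
  \sum_(u | u \notin T) q u * ((h (b u) == f)%:R + L^-1).
have AB f (b : {ffun U -> K}) : `|\sum_(u | h (b u) == f) q u - L^-1| <=
    (A f b ^+ 2 * (L / eps) + eps / L) / 2 + B f b.
  have -> : \sum_(u | h (b u) == f) q u - L^-1 =
      A f b + \sum_(u | u \notin T) q u * ((h (b u) == f)%:R - L^-1).
    transitivity (\sum_(u | h (b u) == f) q u - \sum_u q u * L^-1).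
      by rewrite -mulr_suml q1 mul1r.
    rewrite big_mkcond -sumrB /A.
    rewrite [X in _ = _ + X]big_mkcond -big_split; apply: eq_bigr => u _ /=.
    by case: (u \in T); case: eqP => _ /=; ring.
  apply: le_trans (ler_normD _ _) _; apply: lerD.
    (* The arithmetic-geometric inequality with parameter [eps] takes the place of Cauchy-Schwarz,
       so that only second moments have to be averaged. *)
    have sq : 0 <= (`|A f b| * L / eps - 1) ^+ 2 by exact: sqr_ge0.
    rewrite -[A f b ^+ 2]real_normK ?num_real //.
    rewrite -subr_ge0.
    have -> : (`|A f b| ^+ 2 * (L / eps) + eps / L) / 2 - `|A f b| =
      (`|A f b| * L / eps - 1) ^+ 2 * (eps / L / 2).
      by field; rewrite Lneq0 gt_eqF.
    by rewrite mulr_ge0 // divr_ge0 // divr_ge0 // ltW.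
  apply: le_trans (ler_norm_sum _ _ _) _; apply: ler_sum => u _.
  rewrite normrM ger0_norm // ler_wpM2l //.
  apply: le_trans (ler_normB _ _) _.
  by rewrite !ger0_norm ?invr_ge0 // ltW.
have sumB b : \sum_f B f b = 2 * \sum_(u | u \notin T) q u.
  rewrite exchange_big /= mulr_sumr; apply: eq_bigr => u _.
  rewrite -mulr_sumr mulrC; congr (_ * _).
  have -> : 2 = \sum_f (f == h (b u))%:R * 1 + 1 :> R by rewrite sum_indicator.
  rewrite big_split /= sumr_cst divff //; congr (_ + _).
  by apply: eq_bigr => f _; rewrite mulr1 eq_sym.
(* The indicator of a hash value has variance at most [L^-1], and [q u ^+ 2 <= sigma * q u] on
   [T]. *)
have avgA f : \sum_b prodw unifw b * A f b ^+ 2 <= sigma / L.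
  rewrite (@prodw_second_moment _ _ _ _ unifw_sum1
    (fun u k => (u \in T)%:R * q u * ((h k == f)%:R - L^-1))); last first.
    move=> u; under eq_bigr do rewrite mulrCA.
    rewrite -mulr_sumr; under eq_bigr do rewrite mulrBr.
    by rewrite sumrB h_unif -mulr_suml unifw_sum1 mul1r subrr mulr0.
  apply: (@le_trans _ _ (\sum_u q u * (sigma / L))); last first.
    by rewrite -mulr_suml q1 mul1r.
  apply: ler_sum => u _.
  have -> : \sum_a unifw a * ((u \in T)%:R * q u * ((h a == f)%:R - L^-1)) ^+ 2 =
     (u \in T)%:R * q u ^+ 2 * (L^-1 - L^-1 ^+ 2).
    have hf := h_unif f; rewrite -/L in hf.
    have -> : L^-1 - L^-1 ^+ 2 = \sum_a (unifw a * (h a == f)%:R - 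
        2 * L^-1 * (unifw a * (h a == f)%:R) + unifw a * L^-1 ^+ 2).
      rewrite big_split /= sumrB -[X in _ = _ - X + _]mulr_sumr hf -[X in _ = _ + X]mulr_suml unifw_sum1; ring.
    rewrite mulr_sumr; apply: eq_bigr => a _.
    by case: (u \in T); case: eqP => _ /=; ring.
  case: (boolP (u \in T)) => uT; last first.
    by rewrite !mul0r mulr_ge0 // divr_ge0 // ltW.
  rewrite mul1r expr2 -!mulrA ler_wpM2l // ler_pM ?qT //.
    by rewrite subr_ge0 expr2 ler_piMl ?invr_ge0 ?(ltW L0) // invf_le1 // ler1n.
  by rewrite lerBlDr lerDl sqr_ge0.
apply: (@le_trans _ _ (\sum_b prodw unifw b *
   (\sum_f ((A f b ^+ 2 * (L / eps) + eps / L) / 2 + B f b)))).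
  apply: ler_sum => b _; apply: ler_wpM2l; first exact/prodw_ge0/unifw_ge0.
  by apply: ler_sum.
under eq_bigr do rewrite big_split /= sumB mulrDr.
rewrite big_split /= -[X in _ + X]mulr_suml prodw_sum1 ?unifw_sum1 // mul1r lerD2r.
under eq_bigr do rewrite mulr_sumr.
rewrite exchange_big /=.
apply: (@le_trans _ _ (\sum_(f : F) (sigma / L * (L / eps) + eps / L) / 2)).
  apply: ler_sum => f _.
  under eq_bigr do rewrite mulrA mulrDr mulrA.
  rewrite -mulr_suml ler_wpM2r // big_split /= -!mulr_suml.
  rewrite prodw_sum1 ?unifw_sum1 // mul1r lerD2r.
  by rewrite ler_wpM2r // divr_ge0 // ltW.
rewrite sumr_cst -/L le_eqVlt; apply/orP; left; apply/eqP.
by field; rewrite Lneq0 gt_eqF.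
Qed.

End RandomBinning.

(** * One-shot coding *)

Lemma sum_weights (R : realType) (A : finType) (p : A -> R) (c : R) :
  \sum_a p a = 1 -> \sum_a p a * c = c.
Proof. by move=> p1; rewrite -mulr_suml p1 mul1r. Qed.

Section OneShot.
Variables (R : realType) (X Y Z U W Xh : finType).
Variables (P : X -> Y -> Z -> R) (q : Y -> U -> R) (w : X -> U -> W -> R).
Variables (dist : X -> Xh -> R) (dm : R) (xhat : U -> W -> Z -> Xh).
Hypothesis P_ge0 : forall x y z, 0 <= P x y z.
Hypothesis P_sum1 : \sum_x \sum_y \sum_z P x y z = 1.
Hypothesis q_ge0 : forall y u, 0 <= q y u.
Hypothesis q_sum1 : forall y, \sum_u q y u = 1.
Hypothesis w_ge0 : forall x u v, 0 <= w x u v.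
Hypothesis w_sum1 : forall x u, \sum_v w x u v = 1.
Hypothesis dist_ge0 : forall x xh, 0 <= dist x xh.
Hypothesis dist_le : forall x xh, dist x xh <= dm.

Definition expect (F : X -> Y -> Z -> U -> W -> R) : R :=
  \sum_x \sum_y \sum_z P x y z * \sum_u q y u * \sum_v w x u v * F x y z u v.

Lemma expectD F G : expect (fun x y z u v => F x y z u v + G x y z u v) =
  expect F + expect G.
Proof.
rewrite /expect -big_split; apply: eq_bigr => x _ /=.
rewrite -big_split; apply: eq_bigr => y _ /=.
rewrite -big_split; apply: eq_bigr => z _ /=.
rewrite -mulrDr -big_split; congr (_ * _); apply: eq_bigr => u _ /=.
rewrite -mulrDr -big_split; congr (_ * _); apply: eq_bigr => v _ /=.
by rewrite mulrDr.
Qed.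

Lemma expectZ a F : expect (fun x y z u v => a * F x y z u v) = a * expect F.
Proof.
rewrite /expect mulr_sumr; apply: eq_bigr => x _ /=.
rewrite mulr_sumr; apply: eq_bigr => y _ /=.
rewrite mulr_sumr; apply: eq_bigr => z _ /=.
rewrite [RHS]mulrCA; congr (_ * _); rewrite mulr_sumr; apply: eq_bigr => u _ /=.
rewrite [RHS]mulrCA; congr (_ * _); rewrite mulr_sumr; apply: eq_bigr => v _ /=.
by rewrite [RHS]mulrCA.
Qed.

Lemma expect_sum (I : finType) (F : I -> X -> Y -> Z -> U -> W -> R) :
  expect (fun x y z u v => \sum_i F i x y z u v) = \sum_i expect (F i).
Proof.
rewrite /expect [RHS]exchange_big; apply: eq_bigr => x _ /=.
rewrite [RHS]exchange_big; apply: eq_bigr => y _ /=.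
rewrite [RHS]exchange_big; apply: eq_bigr => z _ /=.
rewrite -mulr_sumr [X in _ = _ * X]exchange_big; congr (_ * _); apply: eq_bigr => u _ /=.
rewrite -mulr_sumr [X in _ = _ * X]exchange_big; congr (_ * _); apply: eq_bigr => v _ /=.
by rewrite mulr_sumr.
Qed.

Lemma expect_cst c : expect (fun _ _ _ _ _ => c) = c.
Proof.
rewrite /expect -[RHS]mul1r -P_sum1 mulr_suml; apply: eq_bigr => x _ /=.
rewrite mulr_suml; apply: eq_bigr => y _ /=.
rewrite mulr_suml; apply: eq_bigr => z _ /=; congr (_ * _).
under eq_bigr do rewrite -mulr_suml w_sum1 mul1r.
by rewrite -mulr_suml q_sum1 mul1r.
Qed.

Lemma ler_expect F G : (forall x y z u v, F x y z u v <= G x y z u v) ->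
  expect F <= expect G.
Proof.
move=> FG; rewrite /expect; apply: ler_sum => x _; apply: ler_sum => y _.
apply: ler_sum => z _; apply: ler_wpM2l => //; apply: ler_sum => u _.
by apply: ler_wpM2l => //; apply: ler_sum => v _; apply: ler_wpM2l.
Qed.

Variables (M1 L1 M2 L2 : nat).
Hypotheses (M1_gt0 : (0 < M1)%N) (L1_gt0 : (0 < L1)%N).
Hypotheses (M2_gt0 : (0 < M2)%N) (L2_gt0 : (0 < L2)%N).

(** For a pmf [p], twice the total variation distance between the uniform law and the law of the
    shared index, the second component of a bin label. *)
Definition nonunif (A : finType) (M L : nat) (b : {ffun A -> 'I_M * 'I_L})
  (p : A -> R) : R :=
  \sum_f `|\sum_(a | (b a).2 == f) p a - #|'I_L|%:R^-1|.

Lemma nonunif_le2 (A : finType) (M L : nat) (b : {ffun A -> 'I_M * 'I_L}) (p : A -> R) :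
  (0 < L)%N -> (forall a, 0 <= p a) -> \sum_a p a = 1 -> nonunif b p <= 2.
Proof.
move=> L0 p0 p1.
apply: (@le_trans _ _ (\sum_(f : 'I_L) (\sum_(a | (b a).2 == f) p a + #|'I_L|%:R^-1))).
  apply: ler_sum => f _; apply: le_trans (ler_normB _ _) _.
  by rewrite !ger0_norm ?invr_ge0 ?sumr_ge0.
rewrite big_split /= sumr_cst divff ?pnatr_eq0 ?card_ord -?lt0n //.
have -> // : \sum_(f : 'I_L) \sum_(a | (b a).2 == f) p a = 1.
by rewrite -p1 [RHS](partition_big (fun a => (b a).2) xpredT).
Qed.

Variables (SZ : Z -> {set U}) (SX : X -> {set U}) (SW : U -> Z -> {set W}).
Variables (u0 : U) (w0 : W).

Section FixedBins.
Variables (b1 : {ffun U -> 'I_M1 * 'I_L1}) (b2 : {ffun W -> 'I_M2 * 'I_L2}).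

Let decZ z := bin_dec b1 (SZ z) u0.
Let decX x := bin_dec b1 (SX x) u0.
Let decW u z := bin_dec b2 (SW u z) w0.

(** Each decoding error is charged [dm], a bound on the distortion. The labels [k1], [k2] are
    arguments because they carry frozen shared indices before the change of measure and are [b1 u],
    [b2 v] after it. *)
Let cost x z u v k1 k2 : R := dist x (xhat u v z) +
  dm * ((decX x k1 != u)%:R + (decZ z k1 != u)%:R + (decW u z k2 != v)%:R).

Let dm_ge0 x xh : 0 <= dm := le_trans (dist_ge0 x xh) (dist_le x xh).

(** Replacing the true shared indices by uniform ones changes the expected cost by at most its bound
    times [nonunif]. For W this bound is [4 * dm], one distortion and three errors; for U it is
    [12 * dm], since the inner estimate adds [4 * dm] times a [nonunif] of at most 2. *)
Lemma fixed_bins_code :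
  exists (fe : Y -> 'I_M1) (f : X -> 'I_M1 -> 'I_M2) (g : 'I_M2 -> 'I_M1 -> Z -> Xh),
  \sum_x \sum_y \sum_z P x y z * dist x (g (f x (fe y)) (fe y) z) <=
  expect (fun x y z u v => dist x (xhat u v z) +
    dm * ((decX x (b1 u) != u)%:R + (decZ z (b1 u) != u)%:R + (decW u z (b2 v) != v)%:R)
    + 4 * dm * nonunif b2 (w x u) + 12 * dm * nonunif b1 (q y)).
Proof.
have [x0 [y0 [z0 _]]] : exists x, exists y, exists z, P x y z != 0.
  apply: contrapT => H.
  suff : \sum_x \sum_y \sum_z P x y z = 0 by rewrite P_sum1 => /eqP; rewrite oner_eq0.
  apply: big1 => x _; apply: big1 => y _; apply: big1 => z _.
  by apply: contrapT => /eqP Pxyz; apply: H; exists x, y, z.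
have dm0 : 0 <= dm := dm_ge0 x0 (xhat u0 w0 z0).
have cost_ge0 x z u v k1 k2 : 0 <= cost x z u v k1 k2.
  by rewrite addr_ge0 // mulr_ge0 // !addr_ge0.
have cost_le x z u v k1 k2 : cost x z u v k1 k2 <= 4 * dm.
  rewrite (_ : 4 * dm = dm + dm * (1 + 1 + 1)); last by ring.
  apply: lerD => //; apply: ler_wpM2l => //.
  by rewrite !lerD //; case: (_ != _).
have /choice[Q1 Q1P] := fun y => conditional_kernel (fun u => (b1 u).2) (q_ge0 y) (q_sum1 y).
have /choice[Q2 Q2P] : forall xu : X * U, exists Q : 'I_L2 -> W -> R,
  [/\ forall f v, 0 <= Q f v, forall f, \sum_v Q f v = 1 &
    forall (H : 'I_L2 -> W -> R) C, (forall f u, 0 <= H f u) -> (forall f u, H f u <= C) ->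
    \sum_f #|'I_L2|%:R^-1 * (\sum_v Q f v * H f v) <=
    \sum_v w xu.1 xu.2 v * H (b2 v).2 v + C * nonunif b2 (w xu.1 xu.2)].
  move=> [x u]; exact: (conditional_kernel (fun v => (b2 v).2) (w_ge0 x u) (w_sum1 x u)).
pose g (f1 : 'I_L1) (f2 : 'I_L2) k2 k1 z :=
  let u := decZ z (k1, f1) in xhat u (decW u z (k2, f2)) z.
(* The encoder does not see [u]: it draws W conditionally on its own estimate [decX]. *)
pose Dreal f1 f2 := \sum_x \sum_y \sum_z P x y z * \sum_u Q1 y f1 u *
  \sum_v Q2 (x, decX x ((b1 u).1, f1)) f2 v * dist x (g f1 f2 (b2 v).1 (b1 u).1 z).
set B := expect _.
have avg : \sum_f1 #|'I_L1|%:R^-1 * \sum_f2 #|'I_L2|%:R^-1 * Dreal f1 f2 <= B.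
  have -> : \sum_f1 #|'I_L1|%:R^-1 * \sum_f2 #|'I_L2|%:R^-1 * Dreal f1 f2 =
    \sum_x \sum_y \sum_z P x y z * \sum_f1 #|'I_L1|%:R^-1 * \sum_u Q1 y f1 u *
     \sum_f2 #|'I_L2|%:R^-1 *
    \sum_v Q2 (x, decX x ((b1 u).1, f1)) f2 v * dist x (g f1 f2 (b2 v).1 (b1 u).1 z).
    transitivity (\sum_f1 \sum_x \sum_y \sum_z P x y z * (#|'I_L1|%:R^-1 * \sum_u Q1 y f1 u *
     \sum_f2 #|'I_L2|%:R^-1 *
    \sum_v Q2 (x, decX x ((b1 u).1, f1)) f2 v * dist x (g f1 f2 (b2 v).1 (b1 u).1 z))).
      apply: eq_bigr => f1 _.
      transitivity (#|'I_L1|%:R^-1 * \sum_x \sum_y \sum_z P x y z * (\sum_u Q1 y f1 u *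
     \sum_f2 #|'I_L2|%:R^-1 *
    \sum_v Q2 (x, decX x ((b1 u).1, f1)) f2 v * dist x (g f1 f2 (b2 v).1 (b1 u).1 z))).
        congr (_ * _); rewrite /Dreal.
        under eq_bigr do rewrite mulr_sumr.
        rewrite exchange_big; apply: eq_bigr => x _ /=.
        under eq_bigr do rewrite mulr_sumr.
        rewrite exchange_big; apply: eq_bigr => y _ /=.
        under eq_bigr do rewrite mulr_sumr.
        rewrite exchange_big; apply: eq_bigr => z _ /=.
        under eq_bigr do rewrite mulrCA mulr_sumr.
        rewrite -mulr_sumr exchange_big; congr (_ * _); apply: eq_bigr => u _ /=.
        by rewrite mulr_sumr; apply: eq_bigr => f2 _; rewrite mulrCA.
      rewrite mulr_sumr; apply: eq_bigr => x _.
      rewrite mulr_sumr; apply: eq_bigr => y _.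
      by rewrite mulr_sumr; apply: eq_bigr => z _; rewrite mulrCA.
    rewrite exchange_big; apply: eq_bigr => x _ /=.
    rewrite exchange_big; apply: eq_bigr => y _ /=.
    rewrite exchange_big; apply: eq_bigr => z _ /=.
    by rewrite mulr_sumr.
  rewrite /B /expect; apply: ler_sum => x _; apply: ler_sum => y _.
  apply: ler_sum => z _; apply: ler_wpM2l => //.
  have [Q1_0 Q1_1 Q1_le] := Q1P y.
  pose H1 f1 u : R := \sum_v w x u v * cost x z u v ((b1 u).1, f1) (b2 v)
    + 4 * dm * nonunif b2 (w x u).
  have nu0 (A : finType) M L (b : {ffun A -> 'I_M * 'I_L}) p : 0 <= nonunif b p.
    exact: sumr_ge0.
  have step2 f1 u : \sum_f2 #|'I_L2|%:R^-1 * (\sum_v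
      Q2 (x, decX x ((b1 u).1, f1)) f2 v * dist x (g f1 f2 (b2 v).1 (b1 u).1 z)) <= H1 f1 u.
    have [Q2_0 Q2_1 Q2_le] := Q2P (x, u).
    have H := Q2_le (fun f2 v => cost x z u v ((b1 u).1, f1) ((b2 v).1, f2)) (4 * dm)
      (fun _ _ => cost_ge0 _ _ _ _ _ _) (fun _ _ => cost_le _ _ _ _ _ _).
    apply: le_trans (le_trans H _); last first.
      rewrite /H1 lerD2r; apply: ler_sum => v _ /=.
      by rewrite -surjective_pairing.
    apply: ler_sum => f2 _; rewrite ler_wpM2l ?invr_ge0 //.
    (* A wrong estimate makes the encoder use the wrong conditional law, but [cost] then already
       contains a full [dm]. *)
    have [E|E] := eqVneq (decX x ((b1 u).1, f1)) u; last first.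
      have [Q2_0' Q2_1' _] := Q2P (x, decX x ((b1 u).1, f1)).
      apply: (@le_trans _ _ dm).
        rewrite -[leRHS]mul1r -(Q2_1' f2) mulr_suml.
        by apply: ler_sum => v _; apply: ler_wpM2l.
      rewrite -[leLHS]mul1r -(Q2_1 f2) mulr_suml.
      apply: ler_sum => v _; apply: ler_wpM2l => //.
      rewrite /cost E -[leLHS]add0r lerD // ler_peMr // -addrA lerDl addr_ge0 //.
    rewrite E; apply: ler_sum => v _; apply: ler_wpM2l => //.
    rewrite /cost E eqxx add0r /g.
    have [E2|E2] := eqVneq (decZ z ((b1 u).1, f1)) u; last first.
      apply: le_trans (dist_le _ _) _.
      by rewrite -[leLHS]add0r lerD // ler_peMr // lerDl.
    rewrite E2 add0r.
    have [->|E3] := eqVneq (decW u z ((b2 v).1, f2)) v; first by rewrite mulr0 addr0.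
    by rewrite mulr1 -[leLHS]add0r lerD.
  apply: (@le_trans _ _ (\sum_f1 #|'I_L1|%:R^-1 * \sum_u Q1 y f1 u * H1 f1 u)).
    apply: ler_sum => f1 _; rewrite ler_wpM2l ?invr_ge0 //.
    by apply: ler_sum => u _; rewrite ler_wpM2l // step2.
  apply: le_trans (Q1_le H1 (12 * dm) _ _) _.
  - move=> f1 u; rewrite addr_ge0 ?mulr_ge0 // sumr_ge0 // => v _.
    by rewrite mulr_ge0.
  - move=> f1 u; rewrite (_ : 12 * dm = 4 * dm + 4 * dm * 2); last by ring.
    apply: lerD; last by rewrite ler_wpM2l ?mulr_ge0 ?nonunif_le2.
    rewrite -[leRHS](sum_weights _ (w_sum1 x u)).
    by apply: ler_sum => v _; apply: ler_wpM2l.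
  rewrite -/(nonunif b1 (q y)) -[X in _ + X](sum_weights _ (q_sum1 y)) -big_split.
  apply: ler_sum => u _ /=; rewrite -mulrDr ler_wpM2l //.
  rewrite /H1 -surjective_pairing -addrA -[X in _ + X](sum_weights _ (w_sum1 x u)).
  rewrite -big_split; apply: ler_sum => v _ /=.
  by rewrite -mulrDr ler_wpM2l // /cost !addrA.
have unif0 L : (0 < L)%N -> \sum_(f : 'I_L) #|'I_L|%:R^-1 = 1 :> R.
  by move=> L0; rewrite sumr_cst divff // pnatr_eq0 card_ord -lt0n.
have inv0 L : 0 <= #|'I_L|%:R^-1 :> R by rewrite invr_ge0.
have [f1 Hf1] := exists_le_average (fun f1 => \sum_f2 #|'I_L2|%:R^-1 * Dreal f1 f2)
  (fun=> inv0 L1) (unif0 _ L1_gt0).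
have [f2 Hf2] := exists_le_average (fun f2 => Dreal f1 f2) (fun=> inv0 L2) (unif0 _ L2_gt0).
have {Hf1 Hf2 avg} DB : Dreal f1 f2 <= B := le_trans Hf2 (le_trans Hf1 avg).
pose G (x : X) (b : 'I_M1) z v := dist x (g f1 f2 (b2 v).1 b z).
(* The helper is fixed first, because the objective of the encoder depends on which [y] produce each
   message. *)
have [usel uP] := @exists_deterministic_kernel R Y U (fun y => Q1 y f1)
  (fun y u => \sum_x \sum_z P x y z *
     \sum_v Q2 (x, decX x ((b1 u).1, f1)) f2 v * G x (b1 u).1 z v)
  (fun y u => let: And3 H _ _ := Q1P y in H f1 u)
  (fun y => let: And3 _ H _ := Q1P y in H f1).
pose fe y := (b1 (usel y)).1.
(* The encoder knows only [x] and the message, so its objective sums over all [y] mapped to that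
   message. *)
have [wsel wP] := @exists_deterministic_kernel R (X * 'I_M1)%type W
  (fun xb => Q2 (xb.1, decX xb.1 (xb.2, f1)) f2)
  (fun xb v => \sum_(y | fe y == xb.2) \sum_z P xb.1 y z * G xb.1 xb.2 z v)
  (fun xb v => let: And3 H _ _ := Q2P (xb.1, decX xb.1 (xb.2, f1)) in H f2 v)
  (fun xb => let: And3 _ H _ := Q2P (xb.1, decX xb.1 (xb.2, f1)) in H f2).
exists fe, (fun x b => (b2 (wsel (x, b))).1), (g f1 f2).
apply: le_trans DB; apply: le_trans (le_trans uP _); last first.
  rewrite /Dreal le_eqVlt; apply/orP; left; apply/eqP.
  under eq_bigr do under eq_bigr do rewrite mulr_sumr.
  rewrite [RHS]exchange_big; apply: eq_bigr => y _ /=.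
  rewrite exchange_big; apply: eq_bigr => x _ /=.
  under eq_bigr do rewrite mulr_sumr.
  rewrite exchange_big; apply: eq_bigr => z _ /=.
  by rewrite mulr_sumr; apply: eq_bigr => u _; rewrite mulrCA.
apply: le_trans (le_trans wP _); last first.
  rewrite le_eqVlt; apply/orP; left; apply/eqP.
  rewrite -(pair_bigA _ (fun x b => \sum_v Q2 (x, decX x (b, f1)) f2 v *
    \sum_(y | fe y == b) \sum_z P x y z * G x b z v)) /=.
  rewrite [RHS]exchange_big; apply: eq_bigr => x _ /=.
  rewrite [RHS](partition_big fe xpredT) //=; apply: eq_bigr => b _.
  under eq_bigr do rewrite mulr_sumr.
  rewrite exchange_big; apply: eq_bigr => y /eqP yb /=.
  under eq_bigr do rewrite mulr_sumr.
  rewrite exchange_big; apply: eq_bigr => z _ /=.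
  by rewrite mulr_sumr -yb; apply: eq_bigr => v _; rewrite mulrCA.
rewrite le_eqVlt; apply/orP; left; apply/eqP.
transitivity (\sum_(i : X * 'I_M1) \sum_(y | fe y == i.2) \sum_z
    P i.1 y z * G i.1 i.2 z (wsel (i.1, i.2))); last by apply: eq_bigr => -[].
rewrite -(pair_bigA _ (fun x b => \sum_(y | fe y == b) \sum_z P x y z * G x b z (wsel (x, b)))) /=.
apply: eq_bigr => x _ /=.
rewrite (partition_big fe xpredT) //=; apply: eq_bigr => b _.
by apply: eq_bigr => y /eqP yb /=; apply: eq_bigr => z _; rewrite /G yb.
Qed.

End FixedBins.

Variables (tau1 : Y -> R) (tau2 : X -> U -> R) (N1 N2 : R).
Hypothesis tau1P : forall y,
  \sum_(b : {ffun U -> 'I_M1 * 'I_L1}) prodw (@unifw R ('I_M1 * 'I_L1)%type) b * nonunif b (q y) <= tau1 y.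
Hypothesis tau2P : forall x u,
  \sum_(b : {ffun W -> 'I_M2 * 'I_L2}) prodw (@unifw R ('I_M2 * 'I_L2)%type) b * nonunif b (w x u) <= tau2 x u.
Hypothesis SZ_card : forall z, #|SZ z|%:R <= N1.
Hypothesis SX_card : forall x, #|SX x|%:R <= N1.
Hypothesis SW_card : forall u z, #|SW u z|%:R <= N2.
Hypothesis dm_ge0 : 0 <= dm.

(** The bound for fixed bins splits into a part depending on [b1] and a part depending on [b2], so
    each binning can be chosen no worse than its own average. The factor 2 on [N1] arises because
    encoder and decoder both recover U from the same bins. *)
Theorem one_shot_code :
  exists (fe : Y -> 'I_M1) (f : X -> 'I_M1 -> 'I_M2) (g : 'I_M2 -> 'I_M1 -> Z -> Xh),
  \sum_x \sum_y \sum_z P x y z * dist x (g (f x (fe y)) (fe y) z) <=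
  expect (fun x y z u v => dist x (xhat u v z))
  + dm * (expect (fun x y z u v => (u \notin SX x)%:R)
        + expect (fun x y z u v => (u \notin SZ z)%:R) + 2 * (N1 / (M1 * L1)%:R)
        + expect (fun x y z u v => (v \notin SW u z)%:R) + N2 / (M2 * L2)%:R)
  + 12 * dm * expect (fun x y z u v => tau1 y)
  + 4 * dm * expect (fun x y z u v => tau2 x u).
Proof.
pose F1 (b : {ffun U -> 'I_M1 * 'I_L1}) x (y : Y) z u (v : W) : R :=
  dm * ((bin_dec b (SX x) u0 (b u) != u)%:R + (bin_dec b (SZ z) u0 (b u) != u)%:R)
   + 12 * dm * nonunif b (q y).
pose F2 (b : {ffun W -> 'I_M2 * 'I_L2}) x (y : Y) z u (v : W) : R :=
  dm * (bin_dec b (SW u z) w0 (b v) != v)%:R + 4 * dm * nonunif b (w x u).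
have K1 : (0 < #|{: 'I_M1 * 'I_L1}|)%N by rewrite card_prod !card_ord muln_gt0 M1_gt0.
have K2 : (0 < #|{: 'I_M2 * 'I_L2}|)%N by rewrite card_prod !card_ord muln_gt0 M2_gt0.
have [b1 Hb1] := exists_le_average (fun b => expect (F1 b))
  (prodw_ge0 (unifw_ge0 R (K := ('I_M1 * 'I_L1)%type)))
  (prodw_sum1 U (unifw_sum1 R K1)).
have [b2 Hb2] := exists_le_average (fun b => expect (F2 b))
  (prodw_ge0 (unifw_ge0 R (K := ('I_M2 * 'I_L2)%type)))
  (prodw_sum1 W (unifw_sum1 R K2)).
have [fe [f [g H]]] := fixed_bins_code b1 b2.
exists fe, f, g; apply: le_trans H _.
have -> : forall a b c d : R, a + b + c + d = a + (b + (c + d)) by move=> *; ring.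
set E0 := expect (fun x y z u v => dist x (xhat u v z)).
set E1 := expect (fun x y z u v => (u \notin SX x)%:R).
set E2 := expect (fun x y z u v => (u \notin SZ z)%:R).
apply: (@le_trans _ _ (E0 + (expect (F1 b1) + expect (F2 b2)))).
  rewrite -!expectD; apply: ler_expect => x y z u v.
  by rewrite /F1 /F2 le_eqVlt; apply/orP; left; apply/eqP; ring.
rewrite lerD2l.
have cardK M L : #|{: 'I_M * 'I_L}|%:R = (M * L)%:R :> R by rewrite card_prod !card_ord.
have B1 : expect (F1 b1) <= dm * (E1 + E2 + 2 * (N1 / (M1 * L1)%:R)) +
    12 * dm * expect (fun x y z u v => tau1 y).
  apply: le_trans Hb1 _.
  under eq_bigr do rewrite -expectZ.
  rewrite -(expect_sum (fun b x y z u v => prodw (@unifw R ('I_M1 * 'I_L1)%type) b * F1 b x y z u v)).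
  rewrite -(expect_cst (2 * (N1 / (M1 * L1)%:R))) -!expectD -!expectZ -expectD.
  apply: ler_expect => x y z u v; rewrite /F1.
  under eq_bigr do rewrite mulrDr mulrCA mulrDr [X in _ + X]mulrCA.
  rewrite big_split /= -!mulr_sumr big_split /=.
  apply: lerD; last by rewrite ler_wpM2l // mulr_ge0.
  rewrite ler_wpM2l //.
  rewrite (_ : forall a b c : R, a + b + 2 * c = (a + c) + (b + c)); last by move=> *; ring.
  apply: lerD.
    apply: le_trans (bin_dec_avg_err R K1 _ _ _) _.
    by rewrite lerD2l -cardK ler_wpM2r ?invr_ge0.
  apply: le_trans (bin_dec_avg_err R K1 _ _ _) _.
  by rewrite lerD2l -cardK ler_wpM2r ?invr_ge0.
have B2 : expect (F2 b2) <= dm * (expect (fun x y z u v => (v \notin SW u z)%:R) + N2 / (M2 * L2)%:R) +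
    4 * dm * expect (fun x y z u v => tau2 x u).
  apply: le_trans Hb2 _.
  under eq_bigr do rewrite -expectZ.
  rewrite -(expect_sum (fun b x y z u v => prodw (@unifw R ('I_M2 * 'I_L2)%type) b * F2 b x y z u v)).
  rewrite -(expect_cst (N2 / (M2 * L2)%:R)) -!expectD -!expectZ -expectD.
  apply: ler_expect => x y z u v; rewrite /F2.
  under eq_bigr do rewrite mulrDr mulrCA [X in _ + X]mulrCA.
  rewrite big_split /= -!mulr_sumr.
  apply: lerD; last by rewrite ler_wpM2l // mulr_ge0.
  rewrite ler_wpM2l //.
  apply: le_trans (bin_dec_avg_err R K2 _ _ _) _.
  by rewrite lerD2l -cardK ler_wpM2r ?invr_ge0.
apply: le_trans (lerD B1 B2) _.
by rewrite le_eqVlt; apply/orP; left; apply/eqP; ring.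
Qed.

End OneShot.

(** * Entropy and conditional mutual information *)

Section Information.
Variables (R : realType) (O : finType) (P : O -> R).
Hypothesis P_ge0 : forall o, 0 <= P o.

Lemma ln2_gt0 : 0 < ln 2 :> R.
Proof. by rewrite ln_gt0 // ltr1n. Qed.

Lemma ln_leB1 (x : R) : 0 < x -> ln x <= x - 1.
Proof.
move=> x0; have := @le_ln1Dx R (x - 1); rewrite addrCA subrr addr0; apply.
by rewrite ltrBrDl subrr.
Qed.

Lemma Pr_ge0 E : 0 <= Pr P E.
Proof. exact: sumr_ge0. Qed.

Lemma Pr_gt0 (E : pred O) o : 0 < P o -> E o -> 0 < Pr P E.
Proof.
by move=> Po Eo; rewrite /Pr (bigD1 o) //= ltr_pwDl // sumr_ge0.
Qed.

Lemma le_Pr (E F : pred O) : (forall o, E o -> F o) -> Pr P E <= Pr P F.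
Proof.
move=> EF; rewrite /Pr [leLHS]big_mkcond [leRHS]big_mkcond; apply: ler_sum => o _.
case: ifP => [/EF -> //|_]; by case: ifP.
Qed.

Lemma eq_Pr (E F : pred O) : E =1 F -> Pr P E = Pr P F.
Proof. exact: eq_bigl. Qed.

Lemma sum_Pr (T : finType) (A : O -> T) (G : T -> R) :
  \sum_o P o * G (A o) = \sum_t Pr P (fun o => A o == t) * G t.
Proof.
rewrite (partition_big A xpredT) //=; apply: eq_bigr => t _.
by rewrite /Pr mulr_suml; apply: eq_bigr => o /eqP ->.
Qed.

Lemma sum_Pr_fiber (T : finType) (A : O -> T) (E : pred O) :
  \sum_t Pr P (fun o => (A o == t) && E o) = Pr P E.
Proof.
rewrite /Pr [RHS](partition_big A xpredT) //=; apply: eq_bigr => t _.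
by apply: eq_bigl => o; rewrite andbC.
Qed.

Lemma ler_sum_pos (F G : O -> R) :
  (forall o, 0 < P o -> F o <= G o) -> \sum_o P o * F o <= \sum_o P o * G o.
Proof.
move=> FG; apply: ler_sum => o _; have := P_ge0 o.
rewrite le_eqVlt => /orP[/eqP <-|Po]; first by rewrite !mul0r.
by rewrite ler_pM2l // FG.
Qed.

Lemma eq_sum_pos (F G : O -> R) :
  (forall o, 0 < P o -> F o = G o) -> \sum_o P o * F o = \sum_o P o * G o.
Proof.
move=> FG; apply: eq_bigr => o _; have := P_ge0 o.
rewrite le_eqVlt => /orP[/eqP <-|Po]; first by rewrite !mul0r.
by rewrite FG.
Qed.

Section Cmi.
Variables (TA TB TC : finType) (A : O -> TA) (B : O -> TB) (C : O -> TC).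

Let pABC o := Pr P (fun o' => [&& A o' == A o, B o' == B o & C o' == C o]).
Let pAC o := Pr P (fun o' => (A o' == A o) && (C o' == C o)).
Let pBC o := Pr P (fun o' => (B o' == B o) && (C o' == C o)).
Let pC o := Pr P (fun o' => C o' == C o).

Lemma cmi_ln : cmi P A B C = (\sum_o P o * ln (pABC o * pC o / (pAC o * pBC o))) / ln 2.
Proof. by rewrite /cmi mulr_suml; apply: eq_bigr => o _; rewrite mulrA. Qed.

Let pABC_gt0 o : 0 < P o -> 0 < pABC o.
Proof. by move=> Po; apply: (Pr_gt0 Po); rewrite !eqxx. Qed.
Let pAC_gt0 o : 0 < P o -> 0 < pAC o.
Proof. by move=> Po; apply: (Pr_gt0 Po); rewrite !eqxx. Qed.
Let pBC_gt0 o : 0 < P o -> 0 < pBC o.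
Proof. by move=> Po; apply: (Pr_gt0 Po); rewrite !eqxx. Qed.
Let pC_gt0 o : 0 < P o -> 0 < pC o.
Proof. by move=> Po; apply: (Pr_gt0 Po); rewrite !eqxx. Qed.

Lemma cmi_lnB : cmi P A B C * ln 2 =
  \sum_o P o * (ln (pABC o) + ln (pC o) - ln (pAC o) - ln (pBC o)).
Proof.
rewrite cmi_ln divfK ?gt_eqF ?ln2_gt0 //; apply: eq_sum_pos => o Po.
have [a b c d] := And4 (pABC_gt0 Po) (pAC_gt0 Po) (pBC_gt0 Po) (pC_gt0 Po).
rewrite ln_div ?lnM ?posrE ?mulr_gt0 // opprD; ring.
Qed.

(* The inequality ln t >= 1 - 1/t turns nonnegativity into
   sum P(a,c) P(b,c) / P(c) <= 1. *)
Lemma cmi_ge0 : 0 <= cmi P A B C.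
Proof.
rewrite -(pmulr_lge0 _ ln2_gt0) cmi_ln divfK ?gt_eqF ?ln2_gt0 //.
pose t o := pABC o * pC o / (pAC o * pBC o).
apply: (@le_trans _ _ (\sum_o P o * (1 - (t o)^-1))); last first.
  apply: ler_sum_pos => o Po; rewrite -/(t o).
  have t0 : 0 < t o by rewrite divr_gt0 ?mulr_gt0 ?pABC_gt0 ?pAC_gt0 ?pBC_gt0 ?pC_gt0.
  rewrite -[leRHS]opprK -lnV ?posrE // lerNr opprB.
  by apply: ln_leB1; rewrite invr_gt0.
under eq_bigr do rewrite mulrBr mulr1.
rewrite sumrB subr_ge0.
pose qABC a b c := Pr P (fun o' => [&& A o' == a, B o' == b & C o' == c]).
pose qAC a c := Pr P (fun o' => (A o' == a) && (C o' == c)).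
pose qBC b c := Pr P (fun o' => (B o' == b) && (C o' == c)).
pose qC c := Pr P (fun o' => C o' == c).
pose G (s : TC * TA * TB) := (qAC s.1.2 s.1.1 * qBC s.2 s.1.1) / (qABC s.1.2 s.2 s.1.1 * qC s.1.1).
rewrite (eq_bigr (fun o => P o * G (C o, A o, B o))); last first.
  by move=> o _; rewrite /t invf_div.
rewrite (sum_Pr (fun o => (C o, A o, B o)) G).
rewrite -(pair_bigA _ (fun ca b => Pr P (fun o => (C o, A o, B o) == (ca, b)) * G (ca, b))) /=.
rewrite -(pair_bigA _ (fun c a => \sum_b Pr P (fun o => (C o, A o, B o) == (c, a, b)) * G (c, a, b))) /=.
apply: (@le_trans _ _ (\sum_c \sum_a \sum_b qAC a c * qBC b c / qC c)).
  apply: ler_sum => c _; apply: ler_sum => a _; apply: ler_sum => b _.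
  have -> : Pr P (fun o => (C o, A o, B o) == (c, a, b)) = qABC a b c.
    by apply: eq_Pr => o; rewrite !xpair_eqE; case: (C o == c); case: (A o == a); case: (B o == b).
  have [->|q0] := eqVneq (qABC a b c) 0.
    by rewrite mul0r divr_ge0 ?mulr_ge0 ?Pr_ge0.
  rewrite /G /=.
  have [->|qc0] := eqVneq (qC c) 0; first by rewrite mulr0 !invr0 !mulr0.
  by rewrite le_eqVlt; apply/orP; left; apply/eqP; field; rewrite ?q0 ?qc0.
have -> : \sum_o P o = \sum_c qC c.
  by rewrite (partition_big C xpredT).
apply: ler_sum => c _.
have -> : \sum_a \sum_b qAC a c * qBC b c / qC c = qC c * qC c / qC c.
  under eq_bigr do rewrite -mulr_suml -mulr_sumr sum_Pr_fiber.
  by rewrite -!mulr_suml sum_Pr_fiber.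
by have [->|qc0] := eqVneq (qC c) 0; rewrite ?mul0r // mulfK.
Qed.

End Cmi.

Lemma cmiC (TA TB TC : eqType) (A : O -> TA) (B : O -> TB) (C : O -> TC) :
  cmi P A B C = cmi P B A C.
Proof.
apply: eq_bigr => o _; congr (_ * log2 (_ * _ / _)); last by rewrite mulrC.
by apply: eq_Pr => o'; rewrite andbCA.
Qed.

(** Entropy in nats, summed over outcomes rather than values, in the format of [cmi]. *)
Definition ent (T : finType) (A : O -> T) : R :=
  - \sum_o P o * ln (Pr P (fun o' => A o' == A o)).

Lemma eq_ent (T T' : finType) (A : O -> T) (B : O -> T') :
  (forall o o', (A o == A o') = (B o == B o')) -> ent A = ent B.
Proof.
move=> AB; congr (- _); apply: eq_bigr => o _; congr (_ * ln _).
by apply: eq_Pr => o'; rewrite AB.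
Qed.

Lemma cmi_ent (TA TB TC : finType) (A : O -> TA) (B : O -> TB) (C : O -> TC) :
  cmi P A B C * ln 2 = ent (fun o => (A o, C o)) + ent (fun o => (B o, C o))
    - ent (fun o => (A o, B o, C o)) - ent C.
Proof.
rewrite cmi_lnB.
have -> : ent (fun o => (A o, B o, C o)) =
    - \sum_o P o * ln (Pr P (fun o' => [&& A o' == A o, B o' == B o & C o' == C o])).
  congr (- _); apply: eq_bigr => o _; congr (_ * ln _).
  by apply: eq_Pr => o'; rewrite !xpair_eqE andbA.
under eq_bigr do rewrite !mulrBr mulrDr.
rewrite !sumrB big_split /= /ent; ring.
Qed.

Lemma ent_mono (T T' : finType) (A : O -> T) (B : O -> T') :
  (forall o o', A o = A o' -> B o = B o') -> ent B <= ent A.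
Proof.
move=> AB; rewrite lerN2; apply: ler_sum_pos => o Po.
rewrite ler_ln ?posrE ?(Pr_gt0 Po) //.
by apply: le_Pr => o' /eqP /AB ->.
Qed.

Hypothesis P_sum1 : \sum_o P o = 1.

(** The inequality ln t >= 1 - 1/t is applied to the ratio [t] of the conditional law of [A] given
    [C] to the uniform law on [T]. *)
Lemma ent_cond_le_card (T S : finType) (A : O -> T) (C : O -> S) :
  ent (fun o => (A o, C o)) - ent C <= ln #|T|%:R.
Proof.
have [t0 Pt0] : exists o, 0 < P o.
  apply: contrapT => /forallNP H0.
  suff : \sum_o P o = 0 by rewrite P_sum1 => /eqP; rewrite oner_eq0.
  apply: big1 => o _; apply/eqP; rewrite eq_le P_ge0 andbT leNgt.
  by apply/negP/H0.
have T0 : 0 < #|T|%:R :> R by rewrite ltr0n; apply/card_gt0P; exists (A t0).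
pose qAC a c := Pr P (fun o' => (A o', C o') == (a, c)).
pose qC c := Pr P (fun o' => C o' == c).
rewrite -subr_ge0.
have -> : ln #|T|%:R - (ent (fun o => (A o, C o)) - ent C) =
  \sum_o P o * ln (#|T|%:R * qAC (A o) (C o) / qC (C o)).
  rewrite (@eq_sum_pos _ (fun o => ln #|T|%:R + ln (qAC (A o) (C o)) - ln (qC (C o)))).
    under eq_bigr do rewrite mulrBr mulrDr.
    rewrite sumrB big_split /= (sum_weights _ P_sum1) /ent /qAC /qC; ring.
  move=> o Po; rewrite ln_div ?lnM ?posrE ?mulr_gt0 // (Pr_gt0 Po) //.
pose t o := #|T|%:R * qAC (A o) (C o) / qC (C o).
apply: (@le_trans _ _ (\sum_o P o * (1 - (t o)^-1))); last first.
  apply: ler_sum_pos => o Po; rewrite -/(t o).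
  have to_gt0 : 0 < t o by rewrite divr_gt0 ?mulr_gt0 // (Pr_gt0 Po).
  rewrite -[leRHS]opprK -lnV ?posrE // lerNr opprB.
  by apply: ln_leB1; rewrite invr_gt0.
under eq_bigr do rewrite mulrBr mulr1.
rewrite sumrB subr_ge0.
pose G (s : S * T) := qC s.1 / (#|T|%:R * qAC s.2 s.1).
rewrite (eq_bigr (fun o => P o * G (C o, A o))); last first.
  by move=> o _; rewrite /t invf_div.
rewrite (sum_Pr (fun o => (C o, A o)) G).
rewrite -(pair_bigA _ (fun c a => Pr P (fun o => (C o, A o) == (c, a)) * G (c, a))) /=.
have -> : \sum_o P o = \sum_c qC c.
  by rewrite (partition_big C xpredT).
apply: ler_sum => c _.
apply: (@le_trans _ _ (\sum_(a : T) qC c / #|T|%:R)); last first.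
  by rewrite sumr_cst mulrCA divff ?mulr1 // gt_eqF.
apply: ler_sum => a _.
have -> : Pr P (fun o => (C o, A o) == (c, a)) = qAC a c.
  by apply: eq_Pr => o; rewrite !xpair_eqE andbC.
have [->|q0] := eqVneq (qAC a c) 0.
  by rewrite mul0r divr_ge0 ?Pr_ge0.
by rewrite /G /= le_eqVlt; apply/orP; left; apply/eqP; field; rewrite q0 gt_eqF.
Qed.

End Information.

(** Every marginal inside the logarithm is a fibre sum of the triple law. This carries informations
    from the space of blocks to that of a single letter. *)
Lemma cmi_law (R : realType) (O O' : finType) (P : O -> R) (P' : O' -> R)
  (TA TB TC : finType) (A : O -> TA) (B : O -> TB) (C : O -> TC)
  (A' : O' -> TA) (B' : O' -> TB) (C' : O' -> TC) :
  (forall a b c, Pr P (fun o => [&& A o == a, B o == b & C o == c]) =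
                 Pr P' (fun o => [&& A' o == a, B' o == b & C' o == c])) ->
  cmi P A B C = cmi P' A' B' C'.
Proof.
move=> eqABC.
have eqBC b c : Pr P (fun o => (B o == b) && (C o == c)) = Pr P' (fun o => (B' o == b) && (C' o == c)).
  rewrite -(sum_Pr_fiber P A) -(sum_Pr_fiber P' A'); apply: eq_bigr => a _.
  exact: eqABC.
have eqC c : Pr P (fun o => C o == c) = Pr P' (fun o => C' o == c).
  by rewrite -(sum_Pr_fiber P B) -(sum_Pr_fiber P' B'); apply: eq_bigr => b _.
have eqAC a c : Pr P (fun o => (A o == a) && (C o == c)) = Pr P' (fun o => (A' o == a) && (C' o == c)).
  rewrite -(sum_Pr_fiber P B) -(sum_Pr_fiber P' B'); apply: eq_bigr => b _.
  transitivity (Pr P (fun o => [&& A o == a, B o == b & C o == c])).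
    by apply: eq_Pr => o; rewrite andbCA.
  by rewrite eqABC; apply: eq_Pr => o; rewrite andbCA.
pose G (s : TA * TB * TC) := log2 ((Pr P (fun o => [&& A o == s.1.1, B o == s.1.2 & C o == s.2])
  * Pr P (fun o => C o == s.2)) / (Pr P (fun o => (A o == s.1.1) && (C o == s.2)) *
    Pr P (fun o => (B o == s.1.2) && (C o == s.2)))).
transitivity (\sum_o P o * G (A o, B o, C o)); first by [].
transitivity (\sum_o P' o * G (A' o, B' o, C' o)); last first.
  by apply: eq_bigr => o _; rewrite /G /= eqABC eqC eqAC eqBC.
rewrite (sum_Pr P (fun o => (A o, B o, C o)) G) (sum_Pr P' (fun o => (A' o, B' o, C' o)) G).
apply: eq_bigr => -[[a b] c] _; congr (_ * _).
transitivity (Pr P (fun o => [&& A o == a, B o == b & C o == c])).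
  by apply: eq_Pr => o; rewrite !xpair_eqE andbA.
by rewrite eqABC; apply: eq_Pr => o; rewrite !xpair_eqE andbA.
Qed.

(** * Marginals of the joint law *)

Section Joint.
Variables (R : realType) (X Y Z U W : finType).
Variables (p : X -> Y -> R) (pz : X -> Z -> R) (q : Y -> U -> R) (w : X -> U -> W -> R).
Hypothesis p_ge0 : forall x y, 0 <= p x y.
Hypothesis pz_ge0 : forall x z, 0 <= pz x z.
Hypothesis q_ge0 : forall y u, 0 <= q y u.
Hypothesis w_ge0 : forall x u v, 0 <= w x u v.
Hypothesis p_sum1 : \sum_x \sum_y p x y = 1.
Hypothesis pz_sum1 : forall x, \sum_z pz x z = 1.
Hypothesis q_sum1 : forall y, \sum_u q y u = 1.
Hypothesis w_sum1 : forall x u, \sum_v w x u v = 1.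

Definition joint : X * Y * Z * U * W -> R :=
  fun o => let: (x, y, z, u, w') := o in p x y * pz x z * q y u * w x u w'.

Lemma joint_ge0 o : 0 <= joint o.
Proof. by move: o => [[[[x y] z] u] v]; rewrite !mulr_ge0. Qed.

Lemma sum_joint (F : X * Y * Z * U * W -> R) : \sum_o joint o * F o =
  \sum_x \sum_y \sum_z \sum_u \sum_v p x y * pz x z * q y u * w x u v * F (x, y, z, u, v).
Proof.
by rewrite !pair_bigA /=; apply: eq_bigr => -[[[[x y] z] u] v].
Qed.

Lemma joint_sum1 : \sum_o joint o = 1.
Proof.
transitivity (\sum_o joint o * 1); first by apply: eq_bigr => o _; rewrite mulr1.
rewrite sum_joint -[RHS]p_sum1; apply: eq_bigr => x _; apply: eq_bigr => y _.
rewrite -[RHS]mulr1 -[X in _ = _ * X](pz_sum1 x) mulr_sumr; apply: eq_bigr => z _.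
rewrite -[RHS]mulr1 -[X in _ = _ * X](q_sum1 y) mulr_sumr; apply: eq_bigr => u _.
rewrite -[RHS]mulr1 -[X in _ = _ * X](w_sum1 x u) mulr_sumr; apply: eq_bigr => v _.
by rewrite mulr1.
Qed.

Lemma Pr_joint (E : pred (X * Y * Z * U * W)) : Pr joint E =
  \sum_x \sum_y \sum_z \sum_u \sum_v
    p x y * pz x z * q y u * w x u v * (E (x, y, z, u, v))%:R.
Proof.
rewrite -(sum_joint (fun o => (E o)%:R)) /Pr big_mkcond; apply: eq_bigr => o _.
by case: (E o); rewrite ?mulr1 ?mulr0.
Qed.

Lemma Pr_jointU (E : X -> Y -> Z -> U -> bool) :
  Pr joint (fun o => E o.1.1.1.1 o.1.1.1.2 o.1.1.2 o.1.2) =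
  \sum_x \sum_y \sum_z \sum_u p x y * pz x z * q y u * (E x y z u)%:R.
Proof.
rewrite Pr_joint; apply: eq_bigr => x _; apply: eq_bigr => y _.
apply: eq_bigr => z _; apply: eq_bigr => u _ /=.
rewrite -[RHS]mulr1 -[X in _ = _ * X](w_sum1 x u) mulr_sumr.
by apply: eq_bigr => v _; rewrite mulrAC.
Qed.

Lemma Pr_jointZ (E : X -> Y -> Z -> bool) :
  Pr joint (fun o => E o.1.1.1.1 o.1.1.1.2 o.1.1.2) =
  \sum_x \sum_y \sum_z p x y * pz x z * (E x y z)%:R.
Proof.
rewrite (Pr_jointU (fun x y z u => E x y z)); apply: eq_bigr => x _; apply: eq_bigr => y _.
apply: eq_bigr => z _ /=.
rewrite -[RHS]mulr1 -[X in _ = _ * X](q_sum1 y) mulr_sumr.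
by apply: eq_bigr => v _; rewrite mulrAC.
Qed.

Definition pyz y z := \sum_x p x y * pz x z.
Definition pxu x u := \sum_y p x y * q y u.

Lemma Pr_YZ y z : Pr joint (fun o => (o.1.1.1.2 == y) && (o.1.1.2 == z)) = pyz y z.
Proof.
rewrite (Pr_jointZ (fun _ y' z' => (y' == y) && (z' == z))).
apply: eq_bigr => x _.
rewrite (bigD1 y) //= [X in _ + X]big1 => [|y' /negbTE ->].
  rewrite addr0 (bigD1 z) //= !eqxx mulr1 big1 ?addr0 // => z' /negbTE ->.
  by rewrite mulr0.
by apply: big1 => z' _; rewrite mulr0.
Qed.

Lemma Pr_UYZ u y z : Pr joint (fun o => [&& o.1.2 == u, o.1.1.1.2 == y & o.1.1.2 == z]) =
  pyz y z * q y u.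
Proof.
rewrite (Pr_jointU (fun _ y' z' u' => [&& u' == u, y' == y & z' == z])) mulr_suml.
apply: eq_bigr => x _.
rewrite (bigD1 y) //= [X in _ + X]big1 => [|y' /negbTE ->].
  rewrite addr0 (bigD1 z) //= [X in _ + X]big1 ?addr0 => [|z' /negbTE ->].
    rewrite (bigD1 u) //= !eqxx mulr1 big1 ?addr0 // => u' /negbTE ->.
    by rewrite mulr0.
  by apply: big1 => u' _; rewrite !andbF mulr0.
by apply: big1 => z' _; apply: big1 => u' _; rewrite !andbF mulr0.
Qed.

Lemma Pr_XUZ x u z : Pr joint (fun o => [&& o.1.1.1.1 == x, o.1.2 == u & o.1.1.2 == z]) =
  pz x z * pxu x u.
Proof.
rewrite (Pr_jointU (fun x' _ z' u' => [&& x' == x, u' == u & z' == z])).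
rewrite (bigD1 x) //= [X in _ + X]big1 => [|x' /negbTE ->].
  rewrite addr0 mulr_sumr; apply: eq_bigr => y _.
  rewrite (bigD1 z) //= [X in _ + X]big1 ?addr0 => [|z' /negbTE ->].
    rewrite (bigD1 u) //= !eqxx mulr1 big1 ?addr0 => [|u' /negbTE ->].
      by ring.
    by rewrite !andbF mulr0.
  by apply: big1 => u' _; rewrite !andbF mulr0.
by apply: big1 => y' _; apply: big1 => z' _; apply: big1 => u' _; rewrite mulr0.
Qed.

Lemma Pr_XWUZ x v u z : Pr joint (fun o => [&& o.1.1.1.1 == x, o.2 == v & (o.1.2, o.1.1.2) == (u, z)]) =
  pz x z * pxu x u * w x u v.
Proof.
rewrite Pr_joint /=.
rewrite (bigD1 x) //= [X in _ + X]big1 => [|x' /negbTE ->]; last first.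
  by apply: big1 => y' _; apply: big1 => z' _; apply: big1 => u' _; apply: big1 => v' _; rewrite mulr0.
rewrite addr0 mulr_sumr mulr_suml; apply: eq_bigr => y _.
rewrite (bigD1 z) //= [X in _ + X]big1 ?addr0 => [|z' /negbTE zz]; last first.
  by apply: big1 => u' _; apply: big1 => v' _; rewrite xpair_eqE zz !andbF mulr0.
rewrite (bigD1 u) //= [X in _ + X]big1 ?addr0 => [|u' /negbTE uu]; last first.
  by apply: big1 => v' _; rewrite xpair_eqE uu !andbF mulr0.
rewrite (bigD1 v) //= !eqxx mulr1 big1 ?addr0 => [|v' /negbTE ->]; last first.
  by rewrite !andbF mulr0.
by ring.
Qed.

Local Notation jX := (fun o : X * Y * Z * U * W => o.1.1.1.1).
Local Notation jY := (fun o : X * Y * Z * U * W => o.1.1.1.2).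
Local Notation jZ := (fun o : X * Y * Z * U * W => o.1.1.2).
Local Notation jU := (fun o : X * Y * Z * U * W => o.1.2).
Local Notation jW := (fun o : X * Y * Z * U * W => o.2).

Definition cU_Z (z : Z) (u : U) : R :=
  Pr joint (fun o => (jU o == u) && (jZ o == z)) / Pr joint (fun o => jZ o == z).
Definition cU_X (x : X) (u : U) : R :=
  Pr joint (fun o => (jU o == u) && (jX o == x)) / Pr joint (fun o => jX o == x).
Definition cW_UZ (u : U) (z : Z) (v : W) : R :=
  Pr joint (fun o => (jW o == v) && ((jU o, jZ o) == (u, z))) /
  Pr joint (fun o => (jU o, jZ o) == (u, z)).

Definition hU_Y := - \sum_o joint o * ln (q (jY o) (jU o)).
Definition hU_Z := - \sum_o joint o * ln (cU_Z (jZ o) (jU o)).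
Definition hU_X := - \sum_o joint o * ln (cU_X (jX o) (jU o)).
Definition hW_XU := - \sum_o joint o * ln (w (jX o) (jU o) (jW o)).
Definition hW_UZ := - \sum_o joint o * ln (cW_UZ (jU o) (jZ o) (jW o)).

Lemma joint_gt0 o : 0 < joint o -> 0 < q (jY o) (jU o) /\ 0 < w (jX o) (jU o) (jW o).
Proof.
move: o => [[[[x y] z] u] v] /= H.
rewrite !lt0r q_ge0 w_ge0 !andbT; split; apply/eqP => E; move: H;
  by rewrite E ?mulr0 ?mul0r ltxx.
Qed.

Lemma cU_Z_gt0 o : 0 < joint o -> 0 < cU_Z (jZ o) (jU o).
Proof. by move=> H; rewrite divr_gt0 // (Pr_gt0 joint_ge0 H) // !eqxx. Qed.

Lemma cU_X_gt0 o : 0 < joint o -> 0 < cU_X (jX o) (jU o).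
Proof. by move=> H; rewrite divr_gt0 // (Pr_gt0 joint_ge0 H) // !eqxx. Qed.

Lemma cW_UZ_gt0 o : 0 < joint o -> 0 < cW_UZ (jU o) (jZ o) (jW o).
Proof. by move=> H; rewrite divr_gt0 // (Pr_gt0 joint_ge0 H) // !eqxx. Qed.

Lemma cond_ge0 (O : finType) (P : O -> R) E F : (forall o, 0 <= P o) -> 0 <= Pr P E / Pr P F.
Proof. by move=> P0; rewrite divr_ge0 // Pr_ge0. Qed.

(** Only an inequality, since all quotients are 0 when the conditioning event is null;
    subprobabilities are enough to count lists. *)
Lemma cond_sum_le1 (O T : finType) (P : O -> R) (A : O -> T) (E : pred O) :
  \sum_t Pr P (fun o => (A o == t) && E o) / Pr P E <= 1.
Proof.
rewrite -mulr_suml sum_Pr_fiber; have [->|H] := eqVneq (Pr P E) 0.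
  by rewrite mul0r.
by rewrite divff.
Qed.

Lemma cU_Z_sum z : \sum_u cU_Z z u <= 1.
Proof. exact: cond_sum_le1. Qed.
Lemma cU_X_sum x : \sum_u cU_X x u <= 1.
Proof. exact: cond_sum_le1. Qed.
Lemma cW_UZ_sum u z : \sum_v cW_UZ u z v <= 1.
Proof. exact: cond_sum_le1. Qed.

(** [k] is the conditional probability of [A] given ([B], [C]), so the information becomes H(A|C) -
    H(A|B,C). In each use the Markov structure removes Z from [k]. *)
Lemma cmi_cond_entropy (TA TB TC : finType) A B C (k : X * Y * Z * U * W -> R) :
  (forall o, 0 < joint o -> 0 < k o) ->
  (forall o, 0 < joint o ->
     Pr joint (fun o' => [&& (A o' : TA) == A o, (B o' : TB) == B o & (C o' : TC) == C o]) =
     k o * Pr joint (fun o' => (B o' == B o) && (C o' == C o))) ->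
  cmi joint A B C * ln 2 = \sum_o joint o * ln (k o) -
    \sum_o joint o * ln (Pr joint (fun o' => (A o' == A o) && (C o' == C o))
                          / Pr joint (fun o' => C o' == C o)).
Proof.
move=> k0 kE; rewrite cmi_lnB; last exact: joint_ge0.
rewrite -sumrB.
under [RHS]eq_bigr do rewrite -mulrBr.
apply: (eq_sum_pos joint_ge0) => o jo; rewrite kE //.
have [a b c] : [/\ 0 < Pr joint (fun o' => (B o' == B o) && (C o' == C o)),
   0 < Pr joint (fun o' => (A o' == A o) && (C o' == C o)) & 0 < Pr joint (fun o' => C o' == C o)].
  by split; apply: (Pr_gt0 joint_ge0 jo); rewrite ?eqxx.
by rewrite ln_div ?lnM ?posrE ?k0 //; ring.
Qed.

Lemma cmi_UYZ : cmi joint jU jY jZ * ln 2 = hU_Z - hU_Y.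
Proof.
rewrite (@cmi_cond_entropy _ _ _ _ _ _ (fun o => q (jY o) (jU o))).
- by rewrite /hU_Z /hU_Y opprK addrC.
- by move=> o /joint_gt0[].
- by move=> o jo; rewrite Pr_UYZ Pr_YZ mulrC.
Qed.

Lemma cmi_XWUZ : cmi joint jX jW (fun o => (jU o, jZ o)) * ln 2 = hW_UZ - hW_XU.
Proof.
rewrite cmiC (@cmi_cond_entropy _ _ _ _ _ _ (fun o => w (jX o) (jU o) (jW o))).
- by rewrite /hW_UZ /hW_XU opprK addrC.
- by move=> o /joint_gt0[].
- move=> o jo.
  have -> : Pr joint (fun o' => [&& jW o' == jW o, jX o' == jX o & (jU o', jZ o') == (jU o, jZ o)])
     = pz (jX o) (jZ o) * pxu (jX o) (jU o) * w (jX o) (jU o) (jW o).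
    by rewrite -Pr_XWUZ; apply: eq_Pr => o'; rewrite andbCA.
  have -> : Pr joint (fun o' => (jX o' == jX o) && ((jU o', jZ o') == (jU o, jZ o)))
     = pz (jX o) (jZ o) * pxu (jX o) (jU o).
    by rewrite -Pr_XUZ; apply: eq_Pr => o'; rewrite xpair_eqE.
  by rewrite mulrC.
Qed.

(* Since U - Y - X - Z is a Markov chain, the difference is I(U;X|Z). *)
Lemma hU_X_le : hU_X <= hU_Z.
Proof.
rewrite -subr_ge0.
suff <- : cmi joint jU jX jZ * ln 2 = hU_Z - hU_X.
  by rewrite mulr_ge0 ?(ltW (ln2_gt0 R)) // cmi_ge0 //; exact: joint_ge0.
rewrite (@cmi_cond_entropy _ _ _ _ _ _ (fun o => cU_X (jX o) (jU o))).
- by rewrite /hU_Z /hU_X opprK addrC.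
- exact: cU_X_gt0.
move=> o jo.
have UXZ z : Pr joint (fun o' => [&& jU o' == jU o, jX o' == jX o & jZ o' == z]) =
    pz (jX o) z * pxu (jX o) (jU o).
  by rewrite -Pr_XUZ; apply: eq_Pr => o'; rewrite andbCA.
have UX : Pr joint (fun o' => (jU o' == jU o) && (jX o' == jX o)) = pxu (jX o) (jU o).
  rewrite -(sum_Pr_fiber joint jZ) -[RHS]mul1r -(pz_sum1 (jX o)) mulr_suml.
  apply: eq_bigr => z _; rewrite -UXZ; apply: eq_Pr => o'.
  by case: (jU o' == _); case: (jX o' == _); case: (jZ o' == _).
have XZ z : Pr joint (fun o' => (jX o' == jX o) && (jZ o' == z)) =
    pz (jX o) z * \sum_u pxu (jX o) u.
  rewrite -(sum_Pr_fiber joint jU) mulr_sumr; apply: eq_bigr => u _.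
  by rewrite -Pr_XUZ; apply: eq_Pr => o'; rewrite andbCA.
have PX : Pr joint (fun o' => jX o' == jX o) = \sum_u pxu (jX o) u.
  rewrite -(sum_Pr_fiber joint jZ) -[RHS]mul1r -(pz_sum1 (jX o)) mulr_suml.
  by apply: eq_bigr => z _; rewrite -XZ; apply: eq_Pr => o'; rewrite andbC.
have : 0 < Pr joint (fun o' => jX o' == jX o) by rewrite (Pr_gt0 joint_ge0 jo).
rewrite UXZ XZ /cU_X UX PX => s0.
by field; rewrite gt_eqF.
Qed.

End Joint.

(** * Asymptotics *)

Lemma sum_ffun_pair (R : realType) (I A B : finType) (G : {ffun I -> A * B} -> R) :
  \sum_f G f = \sum_(a : {ffun I -> A}) \sum_(b : {ffun I -> B}) G [ffun i => (a i, b i)].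
Proof.
rewrite pair_bigA /=.
rewrite (reindex (fun ab : {ffun I -> A} * {ffun I -> B} => [ffun i => (ab.1 i, ab.2 i)])) //=.
exists (fun f : {ffun I -> A * B} => ([ffun i => (f i).1], [ffun i => (f i).2])).
  by move=> [a b] _; congr (_, _); apply/ffunP => i; rewrite !ffunE.
by move=> f _; apply/ffunP => i; rewrite !ffunE /=; case: (f i).
Qed.

Section Asymptotics.
Variable R : realType.

(** Under [J] the exponent of [prodw k] is a sum of independent terms of mean [h], to which
    Chebyshev's inequality applies. *)
Lemma aep (A : finType) (J k : A -> R) (n : nat) (h eta : R)
  (E : pred {ffun 'I_n -> A}) :
  (forall a, 0 <= J a) -> \sum_a J a = 1 -> (forall a, 0 < J a -> 0 < k a) ->
  h = - \sum_a J a * ln (k a) -> (0 < n)%N -> 0 < eta ->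
  (forall f, E f -> prodw k f < expR (- (n%:R * (h + eta))) \/
     expR (- (n%:R * (h - eta))) < prodw k f) ->
  \sum_f prodw J f * (E f)%:R <=
  (\sum_a J a * (- ln (k a) - h) ^+ 2) / (n%:R * eta ^+ 2).
Proof.
move=> J0 J1 k0 hE n0 eta0 EP.
have := @prodw_chebyshev R 'I_n A J J0 J1 (fun a => - ln (k a)) h eta.
rewrite card_ord => /(_ _ eta0 n0) cheb.
apply: le_trans (cheb _); last first.
  by rewrite hE -sumrN; apply: eq_bigr => a _; rewrite mulrN.
rewrite [leRHS]big_mkcond; apply: ler_sum => f _.
case: (boolP (E f)) => Ef; last by rewrite mulr0; case: ifP => // _; exact: prodw_ge0.
rewrite mulr1; case: ifPn => // far.
(* In a sequence of positive probability every letter has positive [k], so [prodw k] is the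
   exponential of the sum; other sequences have weight 0. *)
rewrite le_eqVlt; apply/orP; left; apply/eqP; apply: contrapT => /eqP Jf.
have Jpos i : 0 < J (f i).
  rewrite lt0r J0 andbT; apply: contraNneq Jf => Ji.
  by rewrite /prodw (bigD1 i) //= Ji mul0r.
have kE : prodw k f = expR (- \sum_i - ln (k (f i))).
  rewrite sumrN opprK expR_sum; apply: eq_bigr => i _.
  by rewrite lnK // posrE k0.
move: far; rewrite -ltNge ltr_norml => /andP[far1 far2].
have := EP f Ef; rewrite kE !ltr_expR !ltrN2 => -[]; lra.
Qed.

(** The weights sum to at most 1 and each member of the set carries at least [c]. *)
Lemma card_threshold (A : finType) (n : nat) (k : 'I_n -> A -> R) (c : R) :
  (forall i a, 0 <= k i a) -> (forall i, \sum_a k i a <= 1) -> 0 < c ->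
  #|[set f : {ffun 'I_n -> A} | (c <= \prod_i k i (f i))%R]%SET|%:R <= c^-1.
Proof.
move=> k0 k1 c0; rewrite -(ler_pM2l c0) divff ?gt_eqF //.
rewrite -sum1_card natr_sum mulr_sumr.
apply: (@le_trans _ _ (\sum_(f : {ffun 'I_n -> A}) \prod_i k i (f i))).
  rewrite big_mkcond; apply: ler_sum => f _; rewrite inE.
  by case: ifP => [|_]; rewrite ?mulr1 // prodr_ge0.
rewrite -(bigA_distr_bigA k).
by apply: prodr_ile1 => i _; rewrite k1 sumr_ge0.
Qed.

Lemma nat_approx (x : R) : 1 <= x -> exists m : nat, [/\ (0 < m)%N, m%:R <= x & x <= 2 * m%:R].
Proof.
move=> x1; exists (Num.truncn x).
have x0 : 0 <= x by apply: le_trans x1.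
have /andP[mx xm] := truncn_itv x0.
have m0 : (0 < Num.truncn x)%N by rewrite truncn_gt0.
split => //; apply: (le_trans (ltW xm)).
have : 1 <= (Num.truncn x)%:R :> R by rewrite ler1n.
by rewrite -natr1; lra.
Qed.

(** [M] is given rate [rho + 8 * eta] and [L] rate [h2 - 2 * eta]. Together they exceed the list
    rate [h1 + eta] by at least [5 * eta], while [L] stays [eta] below the smoothness rate
    [h2 - eta]. Rounding each to an integer costs a factor 2, hence the 4. *)
Lemma bin_sizes (h1 h2 rho eta : R) (n : nat) : 0 < eta -> 0 <= rho -> h1 - h2 <= rho ->
  exists M L : nat, [/\ (0 < M)%N, (0 < L)%N, M%:R <= expR (n%:R * (rho + 8 * eta)),
   expR (n%:R * (h1 + eta)) / (M * L)%:R <= 4 * expR (- (n%:R * eta)) &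
   L = 1%N \/ expR (- (n%:R * (h2 - eta))) * L%:R <= expR (- (n%:R * eta))].
Proof.
move=> eta0 rho0 hrho.
have n0 : 0 <= n%:R :> R by [].
have [M [M0 Mle Mge]] : exists m : nat, [/\ (0 < m)%N, m%:R <= expR (n%:R * (rho + 8 * eta))
   & expR (n%:R * (rho + 8 * eta)) <= 2 * m%:R].
  by apply: nat_approx; rewrite -[leLHS]expR0 ler_expR mulr_ge0 //; lra.
have [L [L0 Lge LP]] : exists L : nat, [/\ (0 < L)%N, expR (n%:R * (h2 - 2 * eta)) <= 2 * L%:R &
   L = 1%N \/ expR (- (n%:R * (h2 - eta))) * L%:R <= expR (- (n%:R * eta))].
  (* With so little entropy nothing is shared: an index with a single value is trivially uniform. *)
  have [h20|h20] := leP (h2 - 2 * eta) 0.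
    exists 1%N; split; [by []| |by left].
    apply: (@le_trans _ _ 1); last by lra.
    by rewrite -[leRHS]expR0 ler_expR mulr_ge0_le0.
  have [L [L0 Lle Lge]] : exists m : nat, [/\ (0 < m)%N, m%:R <= expR (n%:R * (h2 - 2 * eta))
     & expR (n%:R * (h2 - 2 * eta)) <= 2 * m%:R].
    by apply: nat_approx; rewrite -[leLHS]expR0 ler_expR mulr_ge0 // ltW.
  exists L; split => //; right.
  apply: (@le_trans _ _ (expR (- (n%:R * (h2 - eta))) * expR (n%:R * (h2 - 2 * eta)))).
    by rewrite ler_wpM2l ?expR_ge0.
  by rewrite -expRD ler_expR; lra.
exists M, L; split => //.
rewrite ler_pdivrMr ?ltr0n ?muln_gt0 ?M0 // natrM.
apply: (@le_trans _ _ (expR (- (n%:R * eta)) *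
   (expR (n%:R * (rho + 8 * eta)) * expR (n%:R * (h2 - 2 * eta))))).
  rewrite -!expRD ler_expR -!mulrDr -mulrN -mulrDr ler_wpM2l //; lra.
have -> : forall a m l : R, 4 * a * (m * l) = a * ((2 * m) * (2 * l)) by move=> *; ring.
by rewrite ler_wpM2l ?expR_ge0 // ler_pM ?expR_ge0.
Qed.

Lemma nonunif_avg (A : finType) (q : A -> R) (M L : nat) (T : {set A}) (sigma e eps : R) :
  (0 < M)%N -> (0 < L)%N -> (forall a, 0 <= q a) -> \sum_a q a = 1 ->
  0 <= sigma -> 0 <= e -> 0 < eps ->
  (forall a, a \in T -> q a <= sigma) -> L = 1%N \/ sigma * L%:R <= e ->
  \sum_(b : {ffun A -> 'I_M * 'I_L}) prodw (@unifw R ('I_M * 'I_L)%type) b * nonunif b q <=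
  e / (2 * eps) + eps / 2 + 2 * \sum_(a | a \notin T) q a.
Proof.
move=> M0 L0 q0 q1 s0 e0 eps0 qT [L1|sL].
  subst L; rewrite big1.
    by rewrite !addr_ge0 ?mulr_ge0 ?invr_ge0 ?mulr_ge0 ?sumr_ge0 ?(ltW eps0).
  move=> b _; rewrite /nonunif big1 ?mulr0 // => f _.
  rewrite card_ord invr1 -[X in _ - X]q1.
  rewrite (eq_bigl xpredT) ?subrr ?normr0 // => a.
  by rewrite [f]ord1 [(b a).2]ord1 eqxx.
have K0 : (0 < #|{: 'I_M * 'I_L}|)%N by rewrite card_prod !card_ord muln_gt0 M0.
have hu f : \sum_k @unifw R ('I_M * 'I_L)%type k * (k.2 == f)%:R = #|'I_L|%:R^-1.
  rewrite -(pair_bigA _ (fun a b => #|{: 'I_M * 'I_L}|%:R^-1 * (b == f)%:R)) /=.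
  under eq_bigr do rewrite -mulr_sumr.
  rewrite sumr_cst card_prod natrM !card_ord.
  have -> : \sum_b (b == f)%:R = 1 :> R.
    by rewrite -[RHS](sum_indicator f (fun=> 1)); apply: eq_bigr => b _; rewrite mulr1.
  by field; rewrite !pnatr_eq0 -!lt0n M0 L0.
have L0' : (0 < #|'I_L|)%N by rewrite card_ord.
apply: le_trans (leftover_hash K0 hu L0' s0 q0 q1 qT eps0) _.
by rewrite card_ord !lerD2r ler_wpM2r // invr_ge0 mulr_ge0 // ltW.
Qed.

End Asymptotics.

(** * Coding for long blocks *)

Section Achievability.
Variables (R : realType) (X Y Z U W Xh : finType).
Variables (p : X -> Y -> R) (pz : X -> Z -> R) (q : Y -> U -> R) (w : X -> U -> W -> R).
Variables (d : X -> Xh -> R) (xhat : U -> W -> Z -> Xh).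
Hypothesis src : source_ok p pz d.
Hypothesis q_ge0 : forall y u, 0 <= q y u.
Hypothesis w_ge0 : forall x u v, 0 <= w x u v.
Hypothesis q_sum1 : forall y, \sum_u q y u = 1.
Hypothesis w_sum1 : forall x u, \sum_v w x u v = 1.

Let p_ge0 : forall x y, 0 <= p x y. Proof. by case: src. Qed.
Let p_sum1 : \sum_x \sum_y p x y = 1. Proof. by case: src => _ []. Qed.
Let pz_ge0 : forall x z, 0 <= pz x z. Proof. by case: src => _ [_ []]. Qed.
Let pz_sum1 : forall x, \sum_z pz x z = 1. Proof. by case: src => _ [_ [_ []]]. Qed.
Let d_ge0 : forall x xh, 0 <= d x xh. Proof. by case: src => _ [_ [_ []]]. Qed.

Local Notation J := (joint p pz q w).
Let J_ge0 := joint_ge0 p_ge0 pz_ge0 q_ge0 w_ge0.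
Let J_sum1 := joint_sum1 p_sum1 pz_sum1 q_sum1 w_sum1.

Section Block.
Variable n : nat.

Definition qn (ys : {ffun 'I_n -> Y}) (us : {ffun 'I_n -> U}) : R :=
  \prod_i q (ys i) (us i).
Definition wn (xs : {ffun 'I_n -> X}) (us : {ffun 'I_n -> U}) (vs : {ffun 'I_n -> W}) : R :=
  \prod_i w (xs i) (us i) (vs i).
Definition dn (xs : {ffun 'I_n -> X}) (xh : {ffun 'I_n -> Xh}) : R :=
  n%:R^-1 * \sum_(i < n) d (xs i) (xh i).

Lemma qn_sum1 ys : \sum_us qn ys us = 1.
Proof.
rewrite -(bigA_distr_bigA (fun i u => q (ys i) u)); apply: big1 => i _.
exact: q_sum1.
Qed.

Lemma wn_sum1 xs us : \sum_vs wn xs us vs = 1.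
Proof.
rewrite -(bigA_distr_bigA (fun i v => w (xs i) (us i) v)); apply: big1 => i _.
exact: w_sum1.
Qed.

(** Zips the five block sequences into one i.i.d. sequence of quintuples, the form to which the
    product-measure estimates apply. *)
Lemma expect_prodw F : expect (@iid_pmf R X Y Z p pz n) qn wn F =
  \sum_(f : {ffun 'I_n -> X * Y * Z * U * W}) prodw J f *
    F [ffun i => (f i).1.1.1.1] [ffun i => (f i).1.1.1.2] [ffun i => (f i).1.1.2]
      [ffun i => (f i).1.2] [ffun i => (f i).2].
Proof.
rewrite sum_ffun_pair (sum_ffun_pair (fun _ => \sum_b _)).
rewrite (sum_ffun_pair (fun _ => \sum_b \sum_c _)).
rewrite (sum_ffun_pair (fun _ => \sum_b \sum_c \sum_e _)).
apply: eq_bigr => xs _; apply: eq_bigr => ys _; apply: eq_bigr => zs _.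
rewrite mulr_sumr; apply: eq_bigr => us _.
rewrite mulrA mulr_sumr; apply: eq_bigr => vs _.
rewrite mulrA; congr (_ * _).
  rewrite /iid_pmf /qn /wn /prodw -!big_split; apply: eq_bigr => i _ /=.
  by rewrite !ffunE.
congr (F _ _ _ _ _); apply/ffunP => i; rewrite !ffunE //.
Qed.

Lemma iid_pmf_sum1 : \sum_xs \sum_ys \sum_zs @iid_pmf R X Y Z p pz n xs ys zs = 1.
Proof.
have := expect_prodw (fun _ _ _ _ _ => 1).
under [X in _ = X -> _]eq_bigr do rewrite mulr1.
rewrite (prodw_sum1 _ J_sum1) => <-.
rewrite /expect; apply: eq_bigr => xs _; apply: eq_bigr => ys _; apply: eq_bigr => zs _.
under eq_bigr do under eq_bigr do rewrite mulr1.
under eq_bigr do rewrite wn_sum1 mulr1.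
by rewrite qn_sum1 mulr1.
Qed.

Definition dmax : R := \sum_x \sum_xh d x xh.

Lemma d_le_dmax x xh : d x xh <= dmax.
Proof.
rewrite /dmax (bigD1 x) //= (bigD1 xh) //= -addrA lerDl addr_ge0 ?sumr_ge0 // => x' _.
exact: sumr_ge0.
Qed.

Lemma dmax_ge0 : 0 <= dmax.
Proof. by apply: sumr_ge0 => x _; apply: sumr_ge0. Qed.

Lemma dn_le_dmax xs xh : (0 < n)%N -> dn xs xh <= dmax.
Proof.
move=> n0; rewrite /dn mulrC ler_pdivrMr ?ltr0n //.
apply: (@le_trans _ _ (\sum_(i < n) dmax)); last by rewrite sumr_cst card_ord mulrC.
by apply: ler_sum => i _; exact: d_le_dmax.
Qed.

Lemma dn_ge0 xs xh : 0 <= dn xs xh.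
Proof. by rewrite mulr_ge0 ?invr_ge0 ?sumr_ge0. Qed.

Definition xhatn (us : {ffun 'I_n -> U}) (vs : {ffun 'I_n -> W}) (zs : {ffun 'I_n -> Z}) :
  {ffun 'I_n -> Xh} := [ffun i => xhat (us i) (vs i) (zs i)].

Lemma expect_dn : (0 < n)%N ->
  expect (@iid_pmf R X Y Z p pz n) qn wn (fun xs _ zs us vs => dn xs (xhatn us vs zs)) =
  \sum_o J o * (let: (x, y, z, u, w') := o in d x (xhat u w' z)).
Proof.
move=> n0; rewrite expect_prodw /dn.
pose G o : R := let: (x, y, z, u, w') := (o : X * Y * Z * U * W) in d x (xhat u w' z).
transitivity (\sum_(i < n) n%:R^-1 * \sum_(f : {ffun 'I_n -> X * Y * Z * U * W}) prodw J f * G (f i)).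
  under [RHS]eq_bigr do rewrite mulr_sumr.
  rewrite exchange_big; apply: eq_bigr => f _ /=.
  rewrite -mulr_sumr mulrCA; congr (_ * _); rewrite mulr_sumr.
  apply: eq_bigr => i _; congr (_ * _); rewrite !ffunE /G.
  by case: (f i) => [[[[x y] z] u] v].
under eq_bigr do rewrite (prodw_marg J_sum1 _ G).
by rewrite sumr_cst card_ord mulrA divff ?mul1r // pnatr_eq0 -lt0n.
Qed.

(** The exponent [h'] may exceed [h] because the list [SX] is cut at the threshold of H(U|Z), while
    the typical exponent there is H(U|X). *)
Lemma expect_indicator_aep (k : X * Y * Z * U * W -> R) (h h' eta : R)
  (E : {ffun 'I_n -> X} -> {ffun 'I_n -> Y} -> {ffun 'I_n -> Z} ->
       {ffun 'I_n -> U} -> {ffun 'I_n -> W} -> bool) :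
  (forall o, 0 < J o -> 0 < k o) -> h = - \sum_o J o * ln (k o) -> (0 < n)%N -> 0 < eta ->
  h <= h' ->
  (forall f : {ffun 'I_n -> X * Y * Z * U * W},
     E [ffun i => (f i).1.1.1.1] [ffun i => (f i).1.1.1.2] [ffun i => (f i).1.1.2]
      [ffun i => (f i).1.2] [ffun i => (f i).2] ->
     prodw k f < expR (- (n%:R * (h' + eta))) \/
     expR (- (n%:R * (h - eta))) < prodw k f) ->
  expect (@iid_pmf R X Y Z p pz n) qn wn (fun xs ys zs us vs => (E xs ys zs us vs)%:R) <=
  (\sum_o J o * (- ln (k o) - h) ^+ 2) / (n%:R * eta ^+ 2).
Proof.
move=> k0 hE n0 eta0 hh' EP; rewrite expect_prodw.
apply: (aep (E := fun f => E [ffun i => (f i).1.1.1.1] [ffun i => (f i).1.1.1.2]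
  [ffun i => (f i).1.1.2] [ffun i => (f i).1.2] [ffun i => (f i).2])
  J_ge0 J_sum1 k0 hE n0 eta0) => f /EP[lt|gt]; [left|by right].
apply: lt_le_trans lt _; rewrite ler_expR lerN2 ler_wpM2l //; lra.
Qed.

End Block.

Local Notation h1 := (hU_Z p pz q w).
Local Notation h2 := (hU_Y p pz q w).
Local Notation h3 := (hW_UZ p pz q w).
Local Notation h4 := (hW_XU p pz q w).

(** The variance of the information density [- ln k] when [h] is its mean. *)
Definition spread (k : X * Y * Z * U * W -> R) (h : R) : R := \sum_o J o * (- ln (k o) - h) ^+ 2.

Lemma spread_ge0 k h : 0 <= spread k h.
Proof. by apply: sumr_ge0 => o _; rewrite mulr_ge0 ?sqr_ge0 // J_ge0. Qed.

Definition total_spread : R :=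
  spread (fun o => q o.1.1.1.2 o.1.2) h2 +
  spread (fun o => cU_Z p pz q w o.1.1.2 o.1.2) h1 +
  spread (fun o => cU_X p pz q w o.1.1.1.1 o.1.2) (hU_X p pz q w) +
  spread (fun o => w o.1.1.1.1 o.1.2 o.2) h4 +
  spread (fun o => cW_UZ p pz q w o.1.2 o.1.1.2 o.2) h3.

Lemma block_code (n : nat) (rho1 rho2 eta eps : R) :
  (0 < n)%N -> 0 < eta -> 0 < eps -> 0 <= rho1 -> 0 <= rho2 ->
  h1 - h2 <= rho1 -> h3 - h4 <= rho2 ->
  exists (M1 M2 : nat) (fe : {ffun 'I_n -> Y} -> 'I_M1)
    (f : {ffun 'I_n -> X} -> 'I_M1 -> 'I_M2)
    (g : 'I_M2 -> 'I_M1 -> {ffun 'I_n -> Z} -> {ffun 'I_n -> Xh}),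
  [/\ M1%:R <= expR (n%:R * (rho1 + 8 * eta)), M2%:R <= expR (n%:R * (rho2 + 8 * eta)) &
   code_distortion p pz d fe fe f g <=
   \sum_o J o * (let: (x, y, z, u, w') := o in d x (xhat u w' z)) +
   dmax * (35 * (total_spread / (n%:R * eta ^+ 2)) + (12 + 8 / eps) * expR (- (n%:R * eta))
     + 8 * eps)].
Proof.
move=> n0 eta0 eps0 rho10 rho20 hrho1 hrho2.
have [M1 [L1 [M10 L10 M1le N1le L1P]]] := bin_sizes n eta0 rho10 hrho1.
have [M2 [L2 [M20 L20 M2le N2le L2P]]] := bin_sizes n eta0 rho20 hrho2.
set e := expR (- (n%:R * eta)) in N1le N2le L1P L2P *.
have [x0 _] : exists x : X, True.
  have [x _] := @exists_le_average R X (fun x => \sum_y p x y) (fun=> 0)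
    (fun x => sumr_ge0 _ (fun y _ => p_ge0 x y)) p_sum1.
  by exists x.
have [y0 _] : exists y : Y, True.
  move: p_sum1; rewrite exchange_big => p1.
  have [y _] := @exists_le_average R Y (fun y => \sum_x p x y) (fun=> 0)
    (fun y => sumr_ge0 _ (fun x _ => p_ge0 x y)) p1.
  by exists y.
have [u0 _] := exists_le_average (fun=> 0) (q_ge0 y0) (q_sum1 y0).
have [v0 _] := exists_le_average (fun=> 0) (w_ge0 x0 u0) (w_sum1 x0 u0).
pose SZ (zs : {ffun 'I_n -> Z}) := [set us : {ffun 'I_n -> U} |
  (expR (- (n%:R * (h1 + eta))) <= \prod_i cU_Z p pz q w (zs i) (us i))%R]%SET.
(* The threshold is that of [SZ], so both lists obey one size bound and one binning serves both
   decoders. *)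
pose SX (xs : {ffun 'I_n -> X}) := [set us : {ffun 'I_n -> U} |
  (expR (- (n%:R * (h1 + eta))) <= \prod_i cU_X p pz q w (xs i) (us i))%R]%SET.
pose SW (us : {ffun 'I_n -> U}) (zs : {ffun 'I_n -> Z}) := [set vs : {ffun 'I_n -> W} |
  (expR (- (n%:R * (h3 + eta))) <= \prod_i cW_UZ p pz q w (us i) (zs i) (vs i))%R]%SET.
(* [s1] and [s2] cap the probabilities of the smooth sequences, those of [TY] and [TW], which are
   the flat parts for the hashing bound. *)
pose s1 := expR (- (n%:R * (h2 - eta))).
pose s2 := expR (- (n%:R * (h4 - eta))).
pose TY (ys : {ffun 'I_n -> Y}) := [set us : {ffun 'I_n -> U} | (qn ys us <= s1)%R]%SET.
pose TW (xs : {ffun 'I_n -> X}) (us : {ffun 'I_n -> U}) :=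
  [set vs : {ffun 'I_n -> W} | (wn xs us vs <= s2)%R]%SET.
pose tau1 ys := e / (2 * eps) + eps / 2 + 2 * \sum_(us | us \notin TY ys) qn ys us.
pose tau2 xs us := e / (2 * eps) + eps / 2 + 2 * \sum_(vs | vs \notin TW xs us) wn xs us vs.
have qn0 (ys : {ffun 'I_n -> Y}) us : 0 <= qn ys us by apply: prodr_ge0.
have wn0 (xs : {ffun 'I_n -> X}) us vs : 0 <= wn xs us vs by apply: prodr_ge0.
have iid0 (xs : {ffun 'I_n -> X}) (ys : {ffun 'I_n -> Y}) zs : 0 <= iid_pmf p pz xs ys zs.
  by apply: prodr_ge0 => i _; rewrite mulr_ge0.
have e0 : 0 <= e by exact: expR_ge0.
have invE a : (expR (- a))^-1 = expR a :> R by rewrite expRN invrK.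
have TYP ys us : us \in TY ys -> qn ys us <= s1 by rewrite inE.
have TWP xs us vs : vs \in TW xs us -> wn xs us vs <= s2 by rewrite inE.
have tau1P ys := nonunif_avg M10 L10 (qn0 ys) (qn_sum1 ys) (expR_ge0 _) e0 eps0 (@TYP ys) L1P.
have tau2P xs us := nonunif_avg M20 L20 (wn0 xs us) (wn_sum1 xs us) (expR_ge0 _) e0 eps0
  (@TWP xs us) L2P.
have SZ_card zs : #|SZ zs|%:R <= expR (n%:R * (h1 + eta)) :> R.
  rewrite -invE; apply: (card_threshold (k := fun i => cU_Z p pz q w (zs i))) => [i u|i|].
  - by apply: cond_ge0; exact: J_ge0.
  - exact: cU_Z_sum.
  - exact: expR_gt0.
have SX_card xs : #|SX xs|%:R <= expR (n%:R * (h1 + eta)) :> R.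
  rewrite -invE; apply: (card_threshold (k := fun i => cU_X p pz q w (xs i))) => [i u|i|].
  - by apply: cond_ge0; exact: J_ge0.
  - exact: cU_X_sum.
  - exact: expR_gt0.
have SW_card us zs : #|SW us zs|%:R <= expR (n%:R * (h3 + eta)) :> R.
  rewrite -invE; apply: (card_threshold (k := fun i => cW_UZ p pz q w (us i) (zs i))) => [i u|i|].
  - by apply: cond_ge0; exact: J_ge0.
  - exact: cW_UZ_sum.
  - exact: expR_gt0.
have [fe [f [g H]]] := @one_shot_code R _ _ _ _ _ {ffun 'I_n -> Xh}
  (@iid_pmf R X Y Z p pz n) (@qn n) (@wn n) (@dn n) dmax (@xhatn n)
  iid0 (iid_pmf_sum1 n) qn0 (@qn_sum1 n) wn0 (@wn_sum1 n) (@dn_ge0 n)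
  (fun xs xh => dn_le_dmax xs xh n0) M1 L1 M2 L2 M10 L10 M20 L20 SZ SX SW
  [ffun=> u0] [ffun=> v0] tau1 tau2 _ _ tau1P tau2P SZ_card SX_card SW_card dmax_ge0.
exists M1, M2, fe, f, g; split => //.
apply: le_trans H _; rewrite expect_dn // -addrA -addrA lerD2l.
set V := total_spread / (n%:R * eta ^+ 2).
have Vle k h E : E <= spread k h / (n%:R * eta ^+ 2) -> spread k h <= total_spread -> E <= V.
  move=> E1 E2; apply: le_trans E1 _; rewrite ler_wpM2r // invr_ge0 mulr_ge0 ?sqr_ge0 //.
have [sp1 sp2 sp3 sp4 sp5] := And5 (spread_ge0 (fun o => q o.1.1.1.2 o.1.2) h2)
  (spread_ge0 (fun o => cU_Z p pz q w o.1.1.2 o.1.2) h1)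
  (spread_ge0 (fun o => cU_X p pz q w o.1.1.1.1 o.1.2) (hU_X p pz q w))
  (spread_ge0 (fun o => w o.1.1.1.1 o.1.2 o.2) h4)
  (spread_ge0 (fun o => cW_UZ p pz q w o.1.2 o.1.1.2 o.2) h3).
set eSX := expect _ _ _ _; set eSZ := expect _ _ _ _; set eSW := expect _ _ _ _.
set et1 := expect _ _ _ _; set et2 := expect _ _ _ _.
have prodE (k : X * Y * Z * U * W -> R) (k' : 'I_n -> R) (f' : {ffun 'I_n -> X * Y * Z * U * W}) :
   (forall i, k (f' i) = k' i) -> prodw k f' = \prod_i k' i.
  by move=> kk; apply: eq_bigr => i _; rewrite kk.
have hX : hU_X p pz q w <= h1 by apply: hU_X_le.
have HSX : eSX <= V.
  apply: (Vle (fun o => cU_X p pz q w o.1.1.1.1 o.1.2) (hU_X p pz q w)).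
    apply: (expect_indicator_aep (E := fun xs _ _ us _ => us \notin SX xs)
       (cU_X_gt0 p_ge0 pz_ge0 q_ge0 w_ge0) (erefl _) n0 eta0 hX) => //.
    move=> f'; rewrite inE -ltNge => H'; left; apply: le_lt_trans H'.
    by rewrite le_eqVlt (prodE _ _ _ (fun i => erefl)); apply/orP; left; apply/eqP;
      apply: eq_bigr => i _; rewrite !ffunE.
  rewrite /total_spread; lra.
have HSZ : eSZ <= V.
  apply: (Vle (fun o => cU_Z p pz q w o.1.1.2 o.1.2) h1).
    apply: (expect_indicator_aep (E := fun _ _ zs us _ => us \notin SZ zs)
       (cU_Z_gt0 p_ge0 pz_ge0 q_ge0 w_ge0) (erefl _) n0 eta0 (lexx _)) => //.
    move=> f'; rewrite inE -ltNge => H'; left; apply: le_lt_trans H'.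
    by rewrite le_eqVlt (prodE _ _ _ (fun i => erefl)); apply/orP; left; apply/eqP;
      apply: eq_bigr => i _; rewrite !ffunE.
  rewrite /total_spread; lra.
have HSW : eSW <= V.
  apply: (Vle (fun o => cW_UZ p pz q w o.1.2 o.1.1.2 o.2) h3).
    apply: (expect_indicator_aep (E := fun _ _ zs us vs => vs \notin SW us zs)
       (cW_UZ_gt0 p_ge0 pz_ge0 q_ge0 w_ge0) (erefl _) n0 eta0 (lexx _)) => //.
    move=> f'; rewrite inE -ltNge => H'; left; apply: le_lt_trans H'.
    by rewrite le_eqVlt (prodE _ _ _ (fun i => erefl)); apply/orP; left; apply/eqP;
      apply: eq_bigr => i _; rewrite !ffunE.
  rewrite /total_spread; lra.
have gt0 o (jo : 0 < J o) := joint_gt0 q_ge0 w_ge0 jo.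
have Ht1 : et1 <= e / (2 * eps) + eps / 2 + 2 * V.
  have -> : et1 = expect (@iid_pmf R X Y Z p pz n) (@qn n) (@wn n)
     (fun xs ys zs us vs => e / (2 * eps) + eps / 2 + 2 * (us \notin TY ys)%:R).
    rewrite /et1 /expect; apply: eq_bigr => xs _; apply: eq_bigr => ys _.
    apply: eq_bigr => zs _; congr (_ * _).
    under eq_bigr do rewrite (sum_weights _ (wn_sum1 _ _)).
    under [RHS]eq_bigr do rewrite (sum_weights _ (wn_sum1 _ _)).
    rewrite (sum_weights _ (qn_sum1 _)) /tau1.
    under [RHS]eq_bigr do rewrite mulrDr.
    rewrite big_split /= (sum_weights _ (qn_sum1 _)); congr (_ + _).
    under [RHS]eq_bigr do rewrite mulrCA.
    rewrite -mulr_sumr big_mkcond; congr (_ * _); apply: eq_bigr => us _.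
    by case: (us \notin TY ys); rewrite ?mulr1 ?mulr0.
  rewrite expectD expectZ (expect_cst (iid_pmf_sum1 n) (@qn_sum1 n) (@wn_sum1 n)) lerD2l ler_wpM2l //.
  apply: (Vle (fun o => q o.1.1.1.2 o.1.2) h2).
    apply: (expect_indicator_aep (E := fun _ ys _ us _ => us \notin TY ys)
       (fun o jo => (gt0 o jo).1) (erefl _) n0 eta0 (lexx _)) => //.
    move=> f'; rewrite inE -ltNge => H'; right; apply: lt_le_trans H' _.
    by rewrite le_eqVlt (prodE _ _ _ (fun i => erefl)); apply/orP; left; apply/eqP;
      apply: eq_bigr => i _; rewrite !ffunE.
  rewrite /total_spread; lra.
have Ht2 : et2 <= e / (2 * eps) + eps / 2 + 2 * V.
  have -> : et2 = expect (@iid_pmf R X Y Z p pz n) (@qn n) (@wn n)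
     (fun xs ys zs us vs => e / (2 * eps) + eps / 2 + 2 * (vs \notin TW xs us)%:R).
    rewrite /et2 /expect; apply: eq_bigr => xs _; apply: eq_bigr => ys _.
    apply: eq_bigr => zs _; congr (_ * _); apply: eq_bigr => us _; congr (_ * _).
    rewrite (sum_weights _ (wn_sum1 _ _)) /tau2.
    under [RHS]eq_bigr do rewrite mulrDr.
    rewrite big_split /= (sum_weights _ (wn_sum1 _ _)); congr (_ + _).
    under [RHS]eq_bigr do rewrite mulrCA.
    rewrite -mulr_sumr big_mkcond; congr (_ * _); apply: eq_bigr => vs _.
    by case: (vs \notin TW xs us); rewrite ?mulr1 ?mulr0.
  rewrite expectD expectZ (expect_cst (iid_pmf_sum1 n) (@qn_sum1 n) (@wn_sum1 n)) lerD2l ler_wpM2l //.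
  apply: (Vle (fun o => w o.1.1.1.1 o.1.2 o.2) h4).
    apply: (expect_indicator_aep (E := fun xs _ _ us vs => vs \notin TW xs us)
       (fun o jo => (gt0 o jo).2) (erefl _) n0 eta0 (lexx _)) => //.
    move=> f'; rewrite inE -ltNge => H'; right; apply: lt_le_trans H' _.
    by rewrite le_eqVlt (prodE _ _ _ (fun i => erefl)); apply/orP; left; apply/eqP;
      apply: eq_bigr => i _; rewrite !ffunE.
  rewrite /total_spread; lra.
have dm0 := dmax_ge0.
(* Three list failures give [3 * V] and collisions [12 * e]. The two uniformity terms have total
   weight 12 + 4 = 16, which adds [32 * V], [8 * e / eps] and [8 * eps]. *)
apply: (@le_trans _ _ (dmax * (V + V + 2 * (4 * e) + V + 4 * e) +
   (12 * dmax * (e / (2 * eps) + eps / 2 + 2 * V) + 4 * dmax * (e / (2 * eps) + eps / 2 + 2 * V)))).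
  rewrite lerD ?ler_wpM2l // ?lerD // ?ler_wpM2l ?mulr_ge0 //.
rewrite le_eqVlt; apply/orP; left; apply/eqP; field.
by rewrite gt_eqF.
Qed.

End Achievability.

Lemma expRN_le_inv (R : realType) (a : R) : 0 < a -> expR (- a) <= a^-1.
Proof.
move=> a0; rewrite expRN lef_pV2 ?posrE ?expR_gt0 //.
by apply: le_trans (expR_ge1Dx _); lra.
Qed.

Lemma two_powR (R : realType) (x : R) : 2 `^ x = expR (x * ln 2).
Proof. by rewrite /powR pnatr_eq0. Qed.

Theorem R_YXZ_achievable (R : realType) (X Y Z Xh : finType)
  (p : X -> Y -> R) (pz : X -> Z -> R) (d : X -> Xh -> R) (D r Re Rd : R) :
  source_ok p pz d -> 0 <= Rd -> Rd <= Re ->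
  R_YXZ p pz d D (r, Rd) -> achievable p pz d D (r, Re, Rd).
Proof.
move=> src Rd0 RdRe [U [W [q [w [xhat [q0 q1 w0 w1 /= [hD hR1 hR2]]]]]]] delta delta0.
have l2 : 0 < ln 2 :> R := ln2_gt0 R.
have [p0 [p1 [z0 [z1 d0]]]] := src.
set J := joint p pz q w.
have J0 := joint_ge0 p0 z0 q0 w0.
(* A message count of at least 1 requires a nonnegative rate; here it follows from the nonnegativity
   of information. *)
have r0 : 0 <= r by apply: le_trans hR2; apply: (cmi_ge0 J0).
pose dm := dmax d.
have dm0 : 0 <= dm by apply: (dmax_ge0 src).
(* Makes the rate excess [8 * eta] nats equal to [delta] bits. *)
pose eta := delta * ln 2 / 8.
have eta0 : 0 < eta by rewrite divr_gt0 ?mulr_gt0.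
(* Makes [dm * (8 * eps)] at most [delta / 2]; the added 1 covers [dm = 0]. *)
pose eps := delta / (16 * (dm + 1)).
have eps0 : 0 < eps by rewrite divr_gt0 // mulr_gt0 // ltr_wpDl.
pose S := total_spread p pz q w.
have S0 : 0 <= S by rewrite /S /total_spread !addr_ge0 // (spread_ge0 src).
(* [K / n] bounds the decaying part of the excess, using exp(-a) <= 1/a; the choice of block length
   brings it below [delta / 2]. *)
pose K := dm * (35 * (S / eta ^+ 2) + (12 + 8 / eps) / eta).
exists (Num.truncn (2 * K / delta)).+1 => n Nn n0.
have rho1 : hU_Z p pz q w - hU_Y p pz q w <= Rd * ln 2.
  by rewrite -(cmi_UYZ p0 z0 q0 w0 q1 w1) ler_pM2r.
have rho2 : hW_UZ p pz q w - hW_XU p pz q w <= r * ln 2.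
  by rewrite -(cmi_XWUZ p0 z0 q0 w0 w1) ler_pM2r.
have [M1 [M2 [fe [f [g [M1le M2le Hd]]]]]] := block_code
  xhat src q0 w0 q1 w1 n0 eta0 eps0 (mulr_ge0 Rd0 (ltW l2)) (mulr_ge0 r0 (ltW l2))
  rho1 rho2.
have E8 x : n%:R * (x * ln 2 + 8 * eta) = n%:R * (x + delta) * ln 2 by rewrite /eta; field.
exists M2, M1, M1, fe, fe, f, g; split.
- by rewrite two_powR -E8.
- apply: le_trans M1le _; rewrite E8 -two_powR !two_powR ler_expR ler_pM2r // ler_wpM2l //; lra.
- by rewrite two_powR -E8.
apply: le_trans Hd _; apply: lerD => //; rewrite -/dm -/S.
have nR : 0 < n%:R :> R by rewrite ltr0n.
have en : expR (- (n%:R * eta)) <= (n%:R * eta)^-1 by apply: expRN_le_inv; rewrite mulr_gt0.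
have c0 : 0 <= 12 + 8 / eps by rewrite addr_ge0 // divr_ge0 // ltW.
apply: (@le_trans _ _ (K / n%:R + dm * (8 * eps))).
  have -> : K / n%:R = dm * ((35 * (S / eta ^+ 2) + (12 + 8 / eps) / eta) / n%:R).
    by rewrite mulrA.
  rewrite -mulrDr ler_wpM2l // lerD2r [leRHS]mulrDl.
  apply: lerD; first by rewrite le_eqVlt; apply/orP; left; apply/eqP; field; rewrite !gt_eqF.
  have -> : (12 + 8 / eps) / eta / n%:R = (12 + 8 / eps) * (n%:R * eta)^-1.
    by rewrite -[RHS]mulr1; field; rewrite !gt_eqF.
  by rewrite ler_wpM2l.
have H1 : K / n%:R <= delta / 2.
  rewrite ler_pdivrMr // mulrC -ler_pdivrMr ?divr_gt0 //.
  have -> : K / (delta / 2) = 2 * K / delta by field; rewrite gt_eqF.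
  apply: (le_trans (ltW (truncnS_gt _))); by rewrite ler_nat.
have H2 : dm * (8 * eps) <= delta / 2.
  rewrite /eps (_ : _ * _ = delta / 2 * (dm / (dm + 1))); last by field; rewrite gt_eqF // ltr_wpDl.
  apply: ler_piMr; first by rewrite ltW // divr_gt0.
  by rewrite ler_pdivrMr ?mul1r ?lerDl // ltr_wpDl.
lra.
Qed.

(** * Chain rule for a block code *)

Section EntropyTools.
Variables (R : realType) (O : finType) (P : O -> R).
Hypothesis P_ge0 : forall o, 0 <= P o.

Lemma eq_ent_iff (T T' : finType) (A : O -> T) (B : O -> T') :
  (forall o o', A o = A o' <-> B o = B o') -> ent P A = ent P B.
Proof.
move=> AB; apply: eq_ent => o o'; apply/eqP/eqP => [/AB//|/AB//].
Qed.

(** By the chain rule the two sides differ by I(A;B|A',C). *)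
Lemma cmi_dpi_l (TA TA' TB TC : finType) (A : O -> TA) (A' : O -> TA') (B : O -> TB) (C : O -> TC) :
  (forall o o', A o = A o' -> C o = C o' -> A' o = A' o') ->
  cmi P A' B C <= cmi P A B C.
Proof.
move=> AA'; rewrite -(ler_pM2r (ln2_gt0 R)) -subr_ge0.
have -> : cmi P A B C * ln 2 - cmi P A' B C * ln 2 = cmi P A B (fun o => (A' o, C o)) * ln 2.
  rewrite !cmi_ent //.
  have -> : ent P (fun o => (A o, (A' o, C o))) = ent P (fun o => (A o, C o)).
    by apply: eq_ent_iff => o o'; split => [[-> _ ->]|[a c]] //; rewrite a c (AA' o o').
  have -> : ent P (fun o => (A o, B o, (A' o, C o))) = ent P (fun o => (A o, B o, C o)).
    by apply: eq_ent_iff => o o'; split => [[-> -> _ ->]|[a b c]] //; rewrite a b c (AA' o o').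
  have -> : ent P (fun o => (B o, (A' o, C o))) = ent P (fun o => (A' o, B o, C o)).
    by apply: eq_ent_iff => o o'; split => [[-> -> ->]|[-> -> ->]].
  ring.
by rewrite mulr_ge0 ?(ltW (ln2_gt0 R)) // cmi_ge0.
Qed.

Lemma cmi_dpi_r (TA TB TB' TC : finType) (A : O -> TA) (B : O -> TB) (B' : O -> TB') (C : O -> TC) :
  (forall o o', B o = B o' -> C o = C o' -> B' o = B' o') ->
  cmi P A B' C <= cmi P A B C.
Proof. by move=> BB'; rewrite cmiC [leRHS]cmiC; apply: cmi_dpi_l. Qed.

End EntropyTools.

Section IidEntropy.
Variables (R : realType) (A : finType) (P : A -> R) (n : nat).
Hypothesis P_ge0 : forall a, 0 <= P a.
Hypothesis P_sum1 : \sum_a P a = 1.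
Local Notation Pn := (@prodw R 'I_n A P).

Lemma Pr_sum_indicator (O : finType) (Q : O -> R) (E : pred O) :
  Pr Q E = \sum_o Q o * (E o)%:R.
Proof.
rewrite /Pr big_mkcond; apply: eq_bigr => o _.
by case: (E o); rewrite ?mulr1 ?mulr0.
Qed.

Lemma Pr_coord i (E : pred A) : Pr Pn (fun f => E (f i)) = Pr P E.
Proof. by rewrite !Pr_sum_indicator (prodw_marg P_sum1 i (fun a => (E a)%:R)). Qed.

Lemma ent_coord (B : finType) (phi : A -> B) i : ent Pn (fun f => phi (f i)) = ent P phi.
Proof.
congr (- _).
rewrite -(prodw_marg P_sum1 i (fun a => ln (Pr P (fun a' => phi a' == phi a)))).
apply: eq_bigr => f _; congr (_ * ln _).
exact: (Pr_coord i (fun a => phi a == phi (f i))).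
Qed.

Lemma ent_iid (B : finType) (phi : A -> B) :
  ent Pn (fun f => [ffun i => phi (f i)]) = n%:R * ent P phi.
Proof.
have -> : n%:R * ent P phi = \sum_(i < n) ent Pn (fun f => phi (f i)).
  by under eq_bigr do rewrite ent_coord; rewrite sumr_cst card_ord.
rewrite /ent.
transitivity (- \sum_(i < n) \sum_f Pn f * ln (Pr Pn (fun f' => phi (f' i) == phi (f i)))); last first.
  by rewrite -sumrN.
rewrite exchange_big /=; congr (- _).
under [RHS]eq_bigr do rewrite -mulr_sumr.
apply: (eq_sum_pos (prodw_ge0 P_ge0)) => f Pf.
have -> : Pr Pn (fun f' => [ffun i => phi (f' i)] == [ffun i => phi (f i)]) =
   \prod_i Pr P (fun a => phi a == phi (f i)).
  rewrite Pr_sum_indicator.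
  under [RHS]eq_bigr do rewrite Pr_sum_indicator.
  rewrite -(prodw_expect P (fun i a => (phi a == phi (f i))%:R)).
  apply: eq_bigr => f' _; congr (_ * _).
  case: eqP => [/ffunP E|NE].
    by rewrite big1 // => i _; have := E i; rewrite !ffunE => ->; rewrite eqxx.
  have [i Ei] : exists i, phi (f' i) != phi (f i).
    apply: contrapT => /forallNP H; apply: NE; apply/ffunP => i; rewrite !ffunE.
    by apply/eqP; apply: contrapT => /negP/H.
  by rewrite (bigD1 i) //= (negbTE Ei) mul0r.
under [RHS]eq_bigr do rewrite (Pr_coord _ (fun a => phi a == _)).
have Pi i : 0 < Pr P (fun a => phi a == phi (f i)).
  apply: (Pr_gt0 P_ge0 (o := f i)); last by [].
  rewrite lt0r P_ge0 andbT; apply: contraTneq Pf => Ei.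
  by rewrite /prodw (bigD1 i) //= Ei mul0r ltxx.
apply: expR_inj; rewrite lnK ?posrE ?prodr_gt0 // expR_sum.
by apply: eq_bigr => i _; rewrite lnK ?posrE.
Qed.

Definition upd (T : Type) (f : {ffun 'I_n -> T}) i a : {ffun 'I_n -> T} :=
  [ffun j => if j == i then a else f j].

Lemma upd_same (T : Type) (f : {ffun 'I_n -> T}) i a : upd f i a i = a.
Proof. by rewrite ffunE eqxx. Qed.

(** Exchanging coordinate [i] with an independent letter of the same law preserves the measure. This
    isolates how a function of the block depends on its [i]-th letter. *)
Lemma resample_coord i (F : {ffun 'I_n -> A} -> R) :
  \sum_f Pn f * F f = \sum_a P a * \sum_f Pn f * F (upd f i a).
Proof.
under [RHS]eq_bigr do rewrite mulr_sumr.
rewrite pair_bigA /=.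
pose h (s : A * {ffun 'I_n -> A}) := (s.2 i, upd s.2 i s.1).
have hK : involutive h.
  move=> [a f]; rewrite /h /= upd_same; congr (_, _); apply/ffunP => j.
  by rewrite !ffunE; case: eqP => [->|].
rewrite (reindex_inj (inv_inj hK)) /=.
transitivity (\sum_(s : A * {ffun 'I_n -> A}) P s.1 * (Pn s.2 * F s.2)).
  rewrite -(pair_bigA _ (fun a f => P a * (Pn f * F f))) /=.
  by under [RHS]eq_bigr do rewrite -mulr_sumr; rewrite (sum_weights _ P_sum1).
apply: eq_bigr => -[a f] _ /=.
have -> : upd (upd f i a) i (f i) = f.
  by apply/ffunP => j; rewrite !ffunE; case: eqP => [->|].
rewrite !mulrA; congr (_ * _).
rewrite /prodw (bigD1 i) //= [in RHS](bigD1 i) //= upd_same mulrCA; congr (_ * (_ * _)).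
by apply: eq_bigr => j /negbTE ji; rewrite ffunE ji.
Qed.

End IidEntropy.

Section BlockConverse.
Variables (R : realType) (X Y Z : finType) (p : X -> Y -> R) (pz : X -> Z -> R).
Hypothesis p_ge0 : forall x y, 0 <= p x y.
Hypothesis pz_ge0 : forall x z, 0 <= pz x z.
Hypothesis p_sum1 : \sum_x \sum_y p x y = 1.
Hypothesis pz_sum1 : forall x, \sum_z pz x z = 1.

Definition src (a : X * Y * Z) : R := p a.1.1 a.1.2 * pz a.1.1 a.2.

Lemma src_ge0 a : 0 <= src a.
Proof. by rewrite mulr_ge0. Qed.

Lemma src_sum1 : \sum_a src a = 1.
Proof.
rewrite -(pair_bigA _ (fun xy z => p xy.1 xy.2 * pz xy.1 z)) /=.
under eq_bigr do rewrite -mulr_sumr pz_sum1 mulr1.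
by rewrite -(pair_bigA _ (fun x y => p x y)).
Qed.

Variables (n m md : nat).
Local Notation O := {ffun 'I_n -> X * Y * Z}.
Local Notation Pn := (@prodw R 'I_n _ src).
Variables (T1 : O -> 'I_md) (T : O -> 'I_m).

(** Later entries are masked rather than cut off, so that prefixes of all lengths have one type and
    entropies can telescope over [k]. *)
Definition past (k : nat) (o : O) : {ffun 'I_n -> option (X * Y)} :=
  [ffun j : 'I_n => if (j < k)%N then Some (o j).1 else None].
Definition sideZ (o : O) : {ffun 'I_n -> Z} := [ffun j => (o j).2].
Definition otherZ (i : 'I_n) (o : O) : {ffun 'I_n -> option Z} :=
  [ffun j => if j == i then None else Some (o j).2].
Definition aux (i : 'I_n) (o : O) := (T1 o, past i o, otherZ i o).

Lemma sideZ_split i o o' :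
  sideZ o = sideZ o' <-> otherZ i o = otherZ i o' /\ (o i).2 = (o' i).2.
Proof.
split=> [/ffunP H|[/ffunP H E]].
  split; last by have := H i; rewrite !ffunE.
  by apply/ffunP => j; have := H j; rewrite !ffunE => ->.
apply/ffunP => j; rewrite !ffunE; have := H j; rewrite !ffunE.
by case: eqP => [->|_ []].
Qed.

Lemma past_split (i : 'I_n) o o' :
  past i.+1 o = past i.+1 o' <-> past i o = past i o' /\ (o i).1 = (o' i).1.
Proof.
split=> [/ffunP H|[/ffunP H E]].
  split; last by have := H i; rewrite !ffunE ltnSn => -[].
  apply/ffunP => j; have := H j; rewrite !ffunE.
  by case: (ltnP j i) => // ji; rewrite ltnS (ltnW ji).
apply/ffunP => j; rewrite !ffunE ltnS; have := H j; rewrite !ffunE.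
by case: (ltngtP j i) => // /val_inj -> _; rewrite E.
Qed.

(** Joining Z_i to [aux i] restores all of Z^n, so each entropy in the chain rule that involves
    [aux i] is a [G] or a [GT] at [i] or [i.+1]. *)
Let G k := ent Pn (fun o => (T1 o, past k o, sideZ o)).
Let GT k := ent Pn (fun o => (T o, (T1 o, past k o, sideZ o))).

Let Pn_ge0 : forall o, 0 <= Pn o := prodw_ge0 src_ge0.
Let Pn_sum1 : \sum_o Pn o = 1 := prodw_sum1 'I_n src_sum1.

Let ent_aux i : ent Pn (fun o => (aux i o, (o i).2)) = G i.
Proof.
apply: eq_ent_iff => o o'; rewrite /aux; split.
  by move=> [-> -> a b]; congr (_, _, _); apply/(sideZ_split i).
by move=> [-> -> /(sideZ_split i)[-> ->]].
Qed.

Let ent_aux_next i : ent Pn (fun o => ((o i).1, (aux i o, (o i).2))) = G i.+1.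
Proof.
apply: eq_ent_iff => o o'; rewrite /aux; split.
  move=> [e1 -> a b c]; congr (_, _, _); last exact/(sideZ_split i).
  by apply/past_split.
by move=> [-> /past_split[-> ->] /(sideZ_split i)[-> ->]].
Qed.

Let ent_auxT i : ent Pn (fun o => (T o, (aux i o, (o i).2))) = GT i.
Proof.
apply: eq_ent_iff => o o'; rewrite /aux; split.
  by move=> [-> -> -> a b]; congr (_, (_, _, _)); apply/(sideZ_split i).
by move=> [-> -> -> /(sideZ_split i)[-> ->]].
Qed.

Let ent_auxT_next i : ent Pn (fun o => ((o i).1, T o, (aux i o, (o i).2))) = GT i.+1.
Proof.
apply: eq_ent_iff => o o'; rewrite /aux; split.
  move=> [e1 -> -> a b c]; congr (_, (_, _, _)); last exact/(sideZ_split i).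
  by apply/past_split.
by move=> [-> -> /past_split[-> ->] /(sideZ_split i)[-> ->]].
Qed.

Lemma sum_telescope (F : nat -> R) : \sum_(i < n) (F i.+1 - F i) = F n - F 0%N.
Proof. by rewrite -(big_mkord xpredT (fun i => F i.+1 - F i)) telescope_sumr. Qed.

(** Data processing enlarges X_i to (X_i,Y_i) and [f i] to [T]. The sum then telescopes to
    I((X,Y)^n;T|T1,Z^n), which is at most H(T|T1,Z^n). *)
Lemma sum_cmi_T (S : finType) (f : 'I_n -> O -> S) :
  (forall i o o', T o = T o' -> aux i o = aux i o' -> f i o = f i o') ->
  \sum_(i < n) cmi Pn (fun o => (o i).1.1) (f i) (fun o => (aux i o, (o i).2)) * ln 2 <= ln m%:R.
Proof.
move=> fP.
apply: (@le_trans _ _ (\sum_(i < n) cmi Pn (fun o => (o i).1) T (fun o => (aux i o, (o i).2)) * ln 2)).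
  apply: ler_sum => i _; rewrite ler_pM2r ?ln2_gt0 //.
  apply: (@le_trans _ _ (cmi Pn (fun o => (o i).1) (f i) (fun o => (aux i o, (o i).2)))).
    by apply: cmi_dpi_l => // o o' ->.
  by apply: cmi_dpi_r => // o o' e1 [a b c _]; apply: fP => //; rewrite /aux a b c.
have -> : \sum_(i < n) cmi Pn (fun o => (o i).1) T (fun o => (aux i o, (o i).2)) * ln 2 =
   \sum_(i < n) (G i.+1 - G i) - \sum_(i < n) (GT i.+1 - GT i).
  rewrite -sumrB; apply: eq_bigr => i _.
  rewrite cmi_ent // ent_aux ent_aux_next ent_auxT ent_auxT_next; ring.
rewrite !sum_telescope.
have H0 : GT 0%N - G 0%N <= ln m%:R.
  have := ent_cond_le_card Pn_ge0 Pn_sum1 T (fun o => (T1 o, past 0 o, sideZ o)).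
  by rewrite card_ord.
have Hn : G n <= GT n by apply: ent_mono => // o o' [_ -> -> ->].
lra.
Qed.

(** Y_i is enlarged to (X_i,Y_i) to match the past. The terms H(X_i,Y_i|Z_i) add up by
    memorylessness to H((X,Y)^n|Z^n), the conditional ones telescope, and what remains is at most
    H(T1|Z^n). *)
Lemma sum_cmi_T1 :
  \sum_(i < n) cmi Pn (aux i) (fun o => (o i).1.2) (fun o => (o i).2) * ln 2 <= ln md%:R.
Proof.
apply: (@le_trans _ _ (\sum_(i < n) cmi Pn (aux i) (fun o => (o i).1) (fun o => (o i).2) * ln 2)).
  apply: ler_sum => i _; rewrite ler_pM2r ?ln2_gt0 //.
  by apply: cmi_dpi_r => // o o' ->.
have -> : \sum_(i < n) cmi Pn (aux i) (fun o => (o i).1) (fun o => (o i).2) * ln 2 =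
   n%:R * ent src id - n%:R * ent src snd - \sum_(i < n) (G i.+1 - G i).
  have c (x : R) : n%:R * x = \sum_(i < n) x by rewrite sumr_cst card_ord.
  rewrite !c -!sumrB; apply: eq_bigr => i _.
  rewrite cmi_ent // ent_aux (ent_coord src_sum1 snd i).
  have -> : ent Pn (fun o => ((o i).1, (o i).2)) = ent src id.
    rewrite -(ent_coord src_sum1 id i).
    by apply: eq_ent_iff => o o'; case: (o i) (o' i) => [? ?] [? ?]; split => [[-> ->]|[-> ->]].
  have -> : ent Pn (fun o => (aux i o, (o i).1, (o i).2)) = G i.+1.
    by rewrite -ent_aux_next; apply: eq_ent_iff => o o'; rewrite /aux; split => [[-> -> -> -> ->]|[-> -> -> -> ->]].
  ring.
rewrite sum_telescope -!(ent_iid n src_ge0 src_sum1).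
have H0 : G 0%N - ent Pn (fun o => [ffun i => snd (o i)]) <= ln md%:R.
  have := ent_cond_le_card Pn_ge0 Pn_sum1 T1 sideZ.
  rewrite card_ord; congr (_ - _ <= _); apply: eq_ent_iff => o o'; split.
    by move=> [-> ->]; congr (_, _, _); apply/ffunP => j; rewrite !ffunE.
  by move=> /(congr1 (fun t => (t.1.1, t.2))).
have Hn : ent Pn (fun o => [ffun i => id (o i)]) <= G n.
  apply: ent_mono => // o o' [_ /ffunP a /ffunP b]; apply/ffunP => j.
  have := a j; have := b j; rewrite !ffunE ltn_ord => e2 [e1].
  by move: e1 e2; case: (o j) (o' j) => [? ?] [? ?] /= -> ->.
lra.
Qed.

End BlockConverse.

(** * Decomposition over the letters of U *)

Section Atoms.
Variables (R : realType) (X Y Z S : finType) (p : X -> Y -> R) (pz : X -> Z -> R).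

Definition rx (a : Y -> R) x : R := \sum_y p x y * a y.

(* Contributions of one letter u of the auxiliary variable, with a = q(u|.)
   and k = w(.|.,u), to the two rates (in nats) and to the distortion.  They
   are homogeneous of degree one in a, which is what allows time sharing and
   the reduction of the alphabet of U. *)
Definition rate1 (a : Y -> R) : R := \sum_y \sum_z pyz p pz y z * a y *
  ln (pyz p pz y z * a y * (\sum_y' pyz p pz y' z) /
      ((\sum_y' pyz p pz y' z * a y') * pyz p pz y z)).
Definition rate2 (a : Y -> R) (k : X -> S -> R) : R :=
  \sum_x \sum_s \sum_z pz x z * rx a x * k x s *
    ln (pz x z * rx a x * k x s * (\sum_x' pz x' z * rx a x') /
        ((pz x z * rx a x) * (\sum_x' pz x' z * rx a x' * k x' s))).
Definition cost (e : X -> S -> Z -> R) (a : Y -> R) (k : X -> S -> R) : R :=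
  \sum_x \sum_s \sum_z pz x z * rx a x * k x s * e x s z.

Lemma rxZ c a x : rx (fun y => c * a y) x = c * rx a x.
Proof. by rewrite /rx mulr_sumr; apply: eq_bigr => y _; rewrite mulrCA. Qed.

(** Numerator and denominator in the logarithm have the same degree in [a]; [c = 0] is treated apart
    because [c] is cancelled. *)
Lemma rate1Z c a : rate1 (fun y => c * a y) = c * rate1 a.
Proof.
have [->|c0] := eqVneq c 0.
  by rewrite mul0r; apply: big1 => y _; apply: big1 => z _; rewrite mul0r mulr0 mul0r.
rewrite /rate1 mulr_sumr; apply: eq_bigr => y _; rewrite mulr_sumr; apply: eq_bigr => z _.
have -> : \sum_y' pyz p pz y' z * (c * a y') = c * \sum_y' pyz p pz y' z * a y'.
  by rewrite mulr_sumr; apply: eq_bigr => y' _; rewrite mulrCA.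
have -> : pyz p pz y z * (c * a y) = c * (pyz p pz y z * a y) by ring.
rewrite -[LHS]mulrA; congr (_ * (_ * ln _)).
have scale (u v s t : R) : c * u * v / (c * s * t) = u * v / (s * t).
  by rewrite -(mulrA c u) -(mulrA c s) -mulf_div divff // mul1r.
exact: scale.
Qed.

Lemma rate2Z c a k : rate2 (fun y => c * a y) k = c * rate2 a k.
Proof.
have [->|c0] := eqVneq c 0.
  rewrite mul0r; apply: big1 => x _; apply: big1 => s _; apply: big1 => z _.
  by rewrite rxZ !(mul0r, mulr0).
rewrite /rate2 mulr_sumr; apply: eq_bigr => x _; rewrite mulr_sumr; apply: eq_bigr => s _.
rewrite mulr_sumr; apply: eq_bigr => z _; rewrite rxZ.
have -> : \sum_x' pz x' z * rx (fun y => c * a y) x' = c * \sum_x' pz x' z * rx a x'.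
  by rewrite mulr_sumr; apply: eq_bigr => x' _; rewrite rxZ mulrCA.
have -> : \sum_x' pz x' z * rx (fun y => c * a y) x' * k x' s = c * \sum_x' pz x' z * rx a x' * k x' s.
  by rewrite mulr_sumr; apply: eq_bigr => x' _; rewrite rxZ; ring.
have -> : pz x z * (c * rx a x) * k x s = c * (pz x z * rx a x * k x s) by ring.
rewrite -[LHS]mulrA; congr (_ * (_ * ln _)).
set u := pz x z * rx a x * k x s; set v := \sum_x' _; set t := \sum_x' _.
have -> : c * u * (c * v) = (c * c) * (u * v) by ring.
have -> : pz x z * (c * rx a x) * (c * t) = (c * c) * (pz x z * rx a x * t) by ring.
by rewrite -mulf_div divff ?mul1r // mulf_neq0.
Qed.

Lemma costZ e c a k : cost e (fun y => c * a y) k = c * cost e a k.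
Proof.
rewrite /cost mulr_sumr; apply: eq_bigr => x _; rewrite mulr_sumr; apply: eq_bigr => s _.
by rewrite mulr_sumr; apply: eq_bigr => z _; rewrite rxZ; ring.
Qed.

Variables (U : finType) (q : Y -> U -> R) (w : X -> U -> S -> R).
Hypothesis q_sum1 : forall y, \sum_u q y u = 1.
Hypothesis w_sum1 : forall x u, \sum_v w x u v = 1.

Local Notation J := (joint p pz q w).

Lemma cmi1_atoms : cmi J (fun o => o.1.2) (fun o => o.1.1.1.2) (fun o => o.1.1.2) * ln 2 =
  \sum_u rate1 (q^~ u).
Proof.
rewrite cmi_ln divfK ?gt_eqF ?ln2_gt0 //.
have PZ z : Pr J (fun o => o.1.1.2 == z) = \sum_y pyz p pz y z.
  rewrite -(sum_Pr_fiber J (fun o => o.1.1.1.2)); apply: eq_bigr => y _.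
  exact: Pr_YZ.
have PUZ u z : Pr J (fun o => (o.1.2 == u) && (o.1.1.2 == z)) = \sum_y pyz p pz y z * q y u.
  rewrite -(sum_Pr_fiber J (fun o => o.1.1.1.2)); apply: eq_bigr => y _.
  by rewrite -(Pr_UYZ p pz q w_sum1); apply: eq_Pr => o; rewrite andbCA.
pose G (t : U * Y * Z) := ln (pyz p pz t.1.2 t.2 * q t.1.2 t.1.1 * (\sum_y' pyz p pz y' t.2) /
      ((\sum_y' pyz p pz y' t.2 * q y' t.1.1) * pyz p pz t.1.2 t.2)).
transitivity (\sum_o J o * G (o.1.2, o.1.1.1.2, o.1.1.2)).
  apply: eq_bigr => o _; congr (_ * _).
  by rewrite (Pr_UYZ _ _ _ w_sum1) PZ PUZ (Pr_YZ _ _ q_sum1 w_sum1).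
rewrite (sum_Pr J (fun o => (o.1.2, o.1.1.1.2, o.1.1.2)) G).
rewrite -(pair_bigA _ (fun uy z => Pr J (fun o => (o.1.2, o.1.1.1.2, o.1.1.2) == (uy, z)) * G (uy, z))) /=.
rewrite -(pair_bigA _ (fun u y => \sum_z Pr J (fun o => (o.1.2, o.1.1.1.2, o.1.1.2) == (u, y, z)) * G (u, y, z))) /=.
apply: eq_bigr => u _; apply: eq_bigr => y _; apply: eq_bigr => z _.
rewrite /G /=; congr (_ * _).
by rewrite -(Pr_UYZ p pz q w_sum1); apply: eq_Pr => o; rewrite !xpair_eqE andbA.
Qed.

Lemma cmi2_atoms : cmi J (fun o => o.1.1.1.1) (fun o => o.2) (fun o => (o.1.2, o.1.1.2)) * ln 2 =
  \sum_u rate2 (q^~ u) (fun x => w x u).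
Proof.
rewrite cmi_ln divfK ?gt_eqF ?ln2_gt0 //.
have PXUZ x u z : Pr J (fun o => (o.1.1.1.1 == x) && ((o.1.2, o.1.1.2) == (u, z))) =
   pz x z * rx (q^~ u) x.
  by rewrite -(Pr_XUZ p pz q w_sum1); apply: eq_Pr => o; rewrite xpair_eqE.
have PUZ u z : Pr J (fun o => (o.1.2, o.1.1.2) == (u, z)) = \sum_x pz x z * rx (q^~ u) x.
  by rewrite -(sum_Pr_fiber J (fun o => o.1.1.1.1)); apply: eq_bigr => x _.
have PWUZ v u z : Pr J (fun o => (o.2 == v) && ((o.1.2, o.1.1.2) == (u, z))) =
    \sum_x pz x z * rx (q^~ u) x * w x u v.
  rewrite -(sum_Pr_fiber J (fun o => o.1.1.1.1)); apply: eq_bigr => x _.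
  exact: Pr_XWUZ.
pose G (t : U * X * S * Z) := ln (pz t.1.1.2 t.2 * rx (q^~ t.1.1.1) t.1.1.2 * w t.1.1.2 t.1.1.1 t.1.2 *
    (\sum_x' pz x' t.2 * rx (q^~ t.1.1.1) x') /
        ((pz t.1.1.2 t.2 * rx (q^~ t.1.1.1) t.1.1.2) *
        (\sum_x' pz x' t.2 * rx (q^~ t.1.1.1) x' * w x' t.1.1.1 t.1.2))).
transitivity (\sum_o J o * G (o.1.2, o.1.1.1.1, o.2, o.1.1.2)).
  apply: eq_bigr => o _; congr (_ * _).
  by rewrite (Pr_XWUZ p pz q w) PUZ PXUZ PWUZ.
rewrite (sum_Pr J (fun o => (o.1.2, o.1.1.1.1, o.2, o.1.1.2)) G).
rewrite -(pair_bigA _ (fun t z => Pr J (fun o => (o.1.2, o.1.1.1.1, o.2, o.1.1.2) == (t, z)) * G (t, z))) /=.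
rewrite -(pair_bigA _ (fun t v => \sum_z Pr J (fun o => (o.1.2, o.1.1.1.1, o.2, o.1.1.2) == (t, v, z)) * G (t, v, z))) /=.
rewrite -(pair_bigA _ (fun u x => \sum_v \sum_z Pr J (fun o => (o.1.2, o.1.1.1.1, o.2, o.1.1.2) == (u, x, v, z)) * G (u, x, v, z))) /=.
apply: eq_bigr => u _; apply: eq_bigr => x _; apply: eq_bigr => v _; apply: eq_bigr => z _.
rewrite /G /=; congr (_ * _).
rewrite -[_ * _ * _](Pr_XWUZ p pz q w); apply: eq_Pr => o; rewrite !xpair_eqE.
by case: (_ == u); case: (_ == x); case: (_ == v); case: (_ == z).
Qed.

Lemma cost_atoms (e : X -> S -> Z -> R) :
  \sum_(o : X * Y * Z * U * S) J o * e o.1.1.1.1 o.2 o.1.1.2 =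
  \sum_u cost e (q^~ u) (fun x => w x u).
Proof.
pose G (t : U * X * S * Z) := e t.1.1.2 t.1.2 t.2.
transitivity (\sum_o J o * G (o.1.2, o.1.1.1.1, o.2, o.1.1.2)) => //.
rewrite (sum_Pr J (fun o => (o.1.2, o.1.1.1.1, o.2, o.1.1.2)) G).
rewrite -(pair_bigA _ (fun t z => Pr J (fun o => (o.1.2, o.1.1.1.1, o.2, o.1.1.2) == (t, z)) * G (t, z))) /=.
rewrite -(pair_bigA _ (fun t v => \sum_z Pr J (fun o => (o.1.2, o.1.1.1.1, o.2, o.1.1.2) == (t, v, z)) * G (t, v, z))) /=.
rewrite -(pair_bigA _ (fun u x => \sum_v \sum_z Pr J (fun o => (o.1.2, o.1.1.1.1, o.2, o.1.1.2) == (u, x, v, z)) * G (u, x, v, z))) /=.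
apply: eq_bigr => u _; apply: eq_bigr => x _; apply: eq_bigr => v _; apply: eq_bigr => z _.
rewrite /G /=; congr (_ * _).
rewrite -[_ * _ * _](Pr_XWUZ p pz q w); apply: eq_Pr => o; rewrite !xpair_eqE.
by case: (_ == u); case: (_ == x); case: (_ == v); case: (_ == z).
Qed.

End Atoms.

(* W need not be conditionally independent of Y given (X, U); only the laws
   of (U, Y, Z) and of (X, W, U, Z) enter the rates and the distortion. *)
Lemma joint_of_law (R : realType) (X Y Z U S O : finType) (p : X -> Y -> R) (pz : X -> Z -> R)
  (P : O -> R) (vX : O -> X) (vY : O -> Y) (vZ : O -> Z) (vU : O -> U) (vS : O -> S)
  (q : Y -> U -> R) (e : X -> S -> Z -> R) :
  (forall x y, 0 <= p x y) -> (forall x z, 0 <= pz x z) -> (forall x, \sum_z pz x z = 1) ->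
  (forall o, 0 <= P o) -> \sum_o P o = 1 ->
  (forall y u, 0 <= q y u) -> (forall y, \sum_u q y u = 1) ->
  (forall x y z u, Pr P (fun o => [&& vX o == x, vY o == y, vZ o == z & vU o == u]) =
     p x y * pz x z * q y u) ->
  (forall x z u s, Pr P (fun o => [&& vX o == x, vZ o == z, vU o == u & vS o == s]) =
     pz x z * Pr P (fun o => [&& vX o == x, vU o == u & vS o == s])) ->
  exists w : X -> U -> S -> R,
  [/\ forall x u s, 0 <= w x u s, forall x u, \sum_s w x u s = 1,
    cmi (joint p pz q w) (fun o => o.1.2) (fun o => o.1.1.1.2) (fun o => o.1.1.2) = cmi P vU vY vZ,
    cmi (joint p pz q w) (fun o => o.1.1.1.1) (fun o => o.2) (fun o => (o.1.2, o.1.1.2)) =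
      cmi P vX vS (fun o => (vU o, vZ o)) &
    \sum_(o : X * Y * Z * U * S) joint p pz q w o * e o.1.1.1.1 o.2 o.1.1.2 =
      \sum_o P o * e (vX o) (vS o) (vZ o)].
Proof.
move=> p0 pz0 pz1 P0 P1 q0 q1 lawU lawS.
have [t0 _] := exists_le_average (fun=> 0) P0 P1.
pose m x u := Pr P (fun o => (vX o == x) && (vU o == u)).
pose ms x u s := Pr P (fun o => [&& vX o == x, vU o == u & vS o == s]).
have msum x u : \sum_s ms x u s = m x u.
  rewrite /m -(sum_Pr_fiber P vS); apply: eq_bigr => s _; apply: eq_Pr => o.
  by case: (vX o == x); case: (vU o == u); case: (vS o == s).
have m0 x u : 0 <= m x u by exact: Pr_ge0.
have ms0 x u s : 0 <= ms x u s by exact: Pr_ge0.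
have mE x u : m x u = \sum_y p x y * q y u.
  rewrite /m -(sum_Pr_fiber P vY); apply: eq_bigr => y _.
  rewrite -(sum_Pr_fiber P vZ) -[RHS]mul1r -(pz1 x) mulr_suml; apply: eq_bigr => z _.
  have -> : pz x z * (p x y * q y u) = p x y * pz x z * q y u by ring.
  rewrite -lawU; apply: eq_Pr => o.
  by case: (vX o == x); case: (vU o == u); case: (vY o == y); case: (vZ o == z).
(* The conditional law of [vS] given ([vX], [vU]), completed by a point mass where that pair is
   null. *)
pose w x u s := if m x u == 0 then (s == vS t0)%:R else ms x u s / m x u.
have mw x u s : m x u * w x u s = ms x u s.
  rewrite /w; case: ifPn => [/eqP mxu|mxu]; last by rewrite mulrCA divff ?mulr1.
  rewrite mxu mul0r; apply/esym/eqP; rewrite eq_le ms0 andbT -mxu -(msum x u).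
  by rewrite (bigD1 s) //= lerDl sumr_ge0.
have w0 x u s : 0 <= w x u s by rewrite /w; case: ifP => _ //; rewrite divr_ge0.
have w1 x u : \sum_s w x u s = 1.
  rewrite /w; have [_|mxu] := eqVneq (m x u) 0.
    by rewrite -[RHS](sum_indicator (vS t0) (fun=> 1)); apply: eq_bigr => s _; rewrite mulr1.
  by rewrite -mulr_suml msum divff.
(* [lawS] makes Z independent of (U,S) given X, so a channel from (X,U) alone reproduces the law
   with Z included. *)
have law4 x s u z : Pr (joint p pz q w) (fun o => [&& o.1.1.1.1 == x, o.2 == s & (o.1.2, o.1.1.2) == (u, z)]) =
    Pr P (fun o => [&& vX o == x, vS o == s & (vU o, vZ o) == (u, z)]).
  rewrite Pr_XWUZ /pxu -mE -mulrA mw -lawS; apply: eq_Pr => o; rewrite xpair_eqE.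
  by case: (vX o == x); case: (vU o == u); case: (vS o == s); case: (vZ o == z).
exists w; split => //.
- apply: cmi_law => u y z; rewrite (Pr_UYZ _ _ _ w1) /pyz mulr_suml -(sum_Pr_fiber P vX).
  apply: eq_bigr => x _; rewrite -lawU; apply: eq_Pr => o.
  by case: (vX o == x); case: (vU o == u); case: (vY o == y); case: (vZ o == z).
- by apply: cmi_law => x s [u z]; exact: law4.
pose G (t : X * S * (U * Z)) := e t.1.1 t.1.2 t.2.2.
transitivity (\sum_o joint p pz q w o * G (o.1.1.1.1, o.2, (o.1.2, o.1.1.2))) => //.
transitivity (\sum_o P o * G (vX o, vS o, (vU o, vZ o))) => //.
rewrite (sum_Pr _ (fun o => (o.1.1.1.1, o.2, (o.1.2, o.1.1.2))) G).
rewrite (sum_Pr _ (fun o => (vX o, vS o, (vU o, vZ o))) G).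
apply: eq_bigr => -[[x s] [u z]] _; congr (_ * _).
have := law4 x s u z; congr (_ = _); apply: eq_Pr => o; rewrite !xpair_eqE //; by rewrite andbA.
Qed.

(** * Single-letterization *)

Section SingleLetter.
Variables (R : realType) (X Y Z Xh : finType).
Variables (p : X -> Y -> R) (pz : X -> Z -> R) (d : X -> Xh -> R).
Hypothesis p_ge0 : forall x y, 0 <= p x y.
Hypothesis pz_ge0 : forall x z, 0 <= pz x z.
Hypothesis p_sum1 : \sum_x \sum_y p x y = 1.
Hypothesis pz_sum1 : forall x, \sum_z pz x z = 1.

(* It suffices to let W range over maps z |-> xhat (Shannon strategies). *)
Definition strategies := {ffun Z -> Xh}.
Definition strat_cost (x : X) (s : strategies) (z : Z) : R := d x (s z).

(** Rates are in nats and the helper's comes first, unlike in [R_YXZ]. Sums over the letters of U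
    prepare the reduction of its alphabet. *)
Definition admissible (U : finType) (q : Y -> U -> R) (w : X -> U -> strategies -> R)
  (r1 r2 D : R) : Prop :=
  [/\ forall y u, 0 <= q y u, forall y, \sum_u q y u = 1,
      forall x u s, 0 <= w x u s, forall x u, \sum_s w x u s = 1 &
  [/\ \sum_u rate1 p pz (q^~ u) <= r1, \sum_u rate2 p pz (q^~ u) (fun x => w x u) <= r2 &
      \sum_u cost p pz strat_cost (q^~ u) (fun x => w x u) <= D]].

Variables (n m me md : nat).
Variables (fe : {ffun 'I_n -> Y} -> 'I_me) (fd : {ffun 'I_n -> Y} -> 'I_md).
Variables (f : {ffun 'I_n -> X} -> 'I_me -> 'I_m).
Variables (g : 'I_m -> 'I_md -> {ffun 'I_n -> Z} -> {ffun 'I_n -> Xh}).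
Hypothesis n_gt0 : (0 < n)%N.

Local Notation O := {ffun 'I_n -> X * Y * Z}.
Local Notation Pn := (@prodw R 'I_n _ (src p pz)).

Let T1 (o : O) := fd [ffun j => (o j).1.2].
Let T (o : O) := f [ffun j => (o j).1.1] (fe [ffun j => (o j).1.2]).
Let strat i (o : O) : strategies := [ffun z => g (T o) (T1 o) (upd (sideZ o) i z) i].

(** [T1] reads only Y^n, the past stops before [i], and [otherZ] hides entry [i]. So U_i depends on
    the [i]-th letter through Y_i alone: the Markov chain U - Y - (X,Z). *)
Let aux_upd i o x y z x' z' : aux T1 i (upd o i (x, y, z)) = aux T1 i (upd o i (x', y, z')).
Proof.
rewrite /aux /T1 /past /otherZ; congr (fd _, _, _); apply/ffunP => j; rewrite !ffunE.
- by case: eqP.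
- by case: eqP => [->|//]; rewrite ltnn.
- by case: eqP.
Qed.

(** The messages never see Z, and the strategy overwrites Z_i by its own argument. *)
Let strat_upd i o x y z z' : strat i (upd o i (x, y, z)) = strat i (upd o i (x, y, z')).
Proof.
apply/ffunP => s; rewrite !ffunE.
have -> : T (upd o i (x, y, z)) = T (upd o i (x, y, z')).
  by rewrite /T; congr (f _ (fe _)); apply/ffunP => j; rewrite !ffunE; case: eqP.
have -> : T1 (upd o i (x, y, z)) = T1 (upd o i (x, y, z')).
  by rewrite /T1; congr (fd _); apply/ffunP => j; rewrite !ffunE; case: eqP.
by congr (g _ _ _ _); apply/ffunP => j; rewrite !ffunE; case: eqP.
Qed.

Let strat_det i o o' : T o = T o' -> aux T1 i o = aux T1 i o' -> strat i o = strat i o'.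
Proof.
move=> eT [eT1 _ /ffunP eZ]; apply/ffunP => s; rewrite !ffunE eT eT1.
congr (g _ _ _ _); apply/ffunP => j; rewrite !ffunE; have := eZ j; rewrite !ffunE.
by case: eqP => // _ [].
Qed.

Let s1 := src_sum1 p_sum1 pz_sum1.
Let s0 := src_ge0 p_ge0 pz_ge0.

Lemma sum_src (F : X * Y * Z -> R) :
  \sum_a src p pz a * F a = \sum_x \sum_y \sum_z p x y * pz x z * F (x, y, z).
Proof. by rewrite !pair_bigA /=; apply: eq_bigr => -[[x y] z] _. Qed.

Lemma code_single_letter : exists (U : finType) (q : Y -> U -> R) (w : X -> U -> strategies -> R),
  admissible q w (ln md%:R / n%:R) (ln m%:R / n%:R) (code_distortion p pz d fe fd f g).
Proof.
have [[[x0 y0] z0] _] := exists_le_average (fun=> 0) s0 s1.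
(* By [aux_upd] the letters [x0] and [z0] filled in at position [i] are immaterial. *)
pose q i y u := \sum_o Pn o * (aux T1 i (upd o i (x0, y, z0)) == u)%:R.
have Pn0 o : 0 <= Pn o by exact: prodw_ge0.
have Pn1 : \sum_o Pn o = 1 by exact: prodw_sum1.
have q0 i y u : 0 <= q i y u by apply: sumr_ge0 => o _; rewrite mulr_ge0.
have q1 i y : \sum_u q i y u = 1.
  rewrite exchange_big /= -[RHS]Pn1; apply: eq_bigr => o _.
  rewrite -mulr_sumr -[RHS]mulr1; congr (_ * _).
  rewrite -[RHS](sum_indicator (aux T1 i (upd o i (x0, y, z0))) (fun=> 1)).
  by apply: eq_bigr => u _; rewrite mulr1 eq_sym.
have lawU i x y z u : Pr Pn (fun o => [&& (o i).1.1 == x, (o i).1.2 == y, (o i).2 == z & aux T1 i o == u])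
    = p x y * pz x z * q i y u.
  rewrite Pr_sum_indicator (resample_coord s1 i) sum_src.
  rewrite (bigD1 x) //= [X in _ + X]big1 ?addr0; last first.
    move=> x' /negbTE xx; apply: big1 => y' _; apply: big1 => z' _.
    by rewrite big1 ?mulr0 // => o _; rewrite upd_same /= xx mulr0.
  rewrite (bigD1 y) //= [X in _ + X]big1 ?addr0; last first.
    move=> y' /negbTE yy; apply: big1 => z' _.
    by rewrite big1 ?mulr0 // => o _; rewrite upd_same /= yy andbF mulr0.
  rewrite (bigD1 z) //= [X in _ + X]big1 ?addr0; last first.
    move=> z' /negbTE zz.
    by rewrite big1 ?mulr0 // => o _; rewrite upd_same /= zz !andbF mulr0.
  congr (_ * _); apply: eq_bigr => o _.
  by rewrite upd_same /= !eqxx /= (aux_upd _ _ _ _ _ x0 z0).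
have lawS i x z u s : Pr Pn (fun o => [&& (o i).1.1 == x, (o i).2 == z, aux T1 i o == u & strat i o == s])
    = pz x z * Pr Pn (fun o => [&& (o i).1.1 == x, aux T1 i o == u & strat i o == s]).
  pose K y := \sum_o Pn o * ((aux T1 i (upd o i (x, y, z0)) == u) && (strat i (upd o i (x, y, z0)) == s))%:R.
  transitivity (pz x z * \sum_y p x y * K y).
    rewrite Pr_sum_indicator (resample_coord s1 i) sum_src.
    rewrite (bigD1 x) //= [X in _ + X]big1 ?addr0; last first.
      move=> x' /negbTE xx; apply: big1 => y' _; apply: big1 => z' _.
      by rewrite big1 ?mulr0 // => o _; rewrite upd_same /= xx mulr0.
    rewrite mulr_sumr; apply: eq_bigr => y _.
    rewrite (bigD1 z) //= [X in _ + X]big1 ?addr0; last first.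
      move=> z' /negbTE zz.
      by rewrite big1 ?mulr0 // => o _; rewrite upd_same /= zz !andbF mulr0.
    rewrite mulrAC mulrC; congr (_ * (_ * _)); apply: eq_bigr => o _.
    by rewrite upd_same /= !eqxx /= (aux_upd _ _ _ _ _ x z0) (strat_upd _ _ _ _ _ z0).
  congr (_ * _); rewrite Pr_sum_indicator (resample_coord s1 i) sum_src.
  rewrite [RHS](bigD1 x) //= [X in _ = _ + X]big1 ?addr0; last first.
    move=> x' /negbTE xx; apply: big1 => y' _; apply: big1 => z' _.
    by rewrite big1 ?mulr0 // => o _; rewrite upd_same /= xx mulr0.
  apply: eq_bigr => y _; rewrite -[LHS](sum_weights _ (pz_sum1 x)); apply: eq_bigr => z' _.
  rewrite mulrA [pz x z' * _]mulrC; congr (_ * _); apply: eq_bigr => o _.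
  by rewrite upd_same /= eqxx /= (aux_upd _ _ _ _ z' x z0) (strat_upd _ _ _ _ z' z0).
have /choice[w wP] := fun i => joint_of_law strat_cost p_ge0 pz_ge0 pz_sum1 Pn0 Pn1 (q0 i) (q1 i)
  (lawU i) (lawS i).
(* Time sharing: a uniform time index, independent of the source, joins U, and homogeneity turns the
   weights 1/n into averages over time. *)
pose U := ('I_n * ('I_md * {ffun 'I_n -> option (X * Y)} * {ffun 'I_n -> option Z}))%type.
have nR : 0 < n%:R :> R by rewrite ltr0n.
exists U, (fun y (u : U) => n%:R^-1 * q u.1 y u.2), (fun x (u : U) => w u.1 x u.2).
have sumU (F : 'I_n -> _ -> R) : \sum_(u : U) n%:R^-1 * F u.1 u.2 = (\sum_i \sum_u F i u) / n%:R.
  by rewrite -mulr_sumr -(pair_bigA _ F) mulrC.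
split.
- by move=> y u; rewrite mulr_ge0 ?invr_ge0.
- move=> y; rewrite (sumU (fun i u => q i y u)).
  by under eq_bigr do rewrite q1; rewrite sumr_cst card_ord mulr1 divff ?gt_eqF.
- by move=> x u s; case: (wP u.1) => H *; exact: H.
- by move=> x u; case: (wP u.1) => _ H *; exact: H.
split.
- under eq_bigr do rewrite rate1Z.
  rewrite (sumU (fun i u => rate1 p pz ((q i)^~ u))) ler_pM2r ?invr_gt0 //.
  apply: le_trans (sum_cmi_T1 p_ge0 pz_ge0 p_sum1 pz_sum1 T1).
  apply: ler_sum => i _; case: (wP i) => w0 w1 <- _ _.
  by rewrite (cmi1_atoms _ _ (q1 i) w1).
- under eq_bigr do rewrite rate2Z.
  rewrite (sumU (fun i u => rate2 p pz ((q i)^~ u) (fun x => w i x u))) ler_pM2r ?invr_gt0 //.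
  apply: le_trans (sum_cmi_T p_ge0 pz_ge0 p_sum1 pz_sum1 strat_det).
  apply: ler_sum => i _; case: (wP i) => w0 w1 _ <- _.
  by rewrite (cmi2_atoms _ _ _ w1).
under eq_bigr do rewrite costZ.
rewrite (sumU (fun i u => cost p pz strat_cost ((q i)^~ u) (fun x => w i x u))).
rewrite le_eqVlt; apply/orP; left; apply/eqP.
transitivity ((\sum_i \sum_o Pn o * strat_cost (o i).1.1 (strat i o) (o i).2) / n%:R).
  congr (_ / _); apply: eq_bigr => i _; case: (wP i) => w0 w1 _ _ <-.
  by rewrite (cost_atoms p pz (q i) (w i) strat_cost).
rewrite exchange_big /= mulr_suml /code_distortion.
rewrite (sum_ffun_pair (fun o => _ / _)) (sum_ffun_pair (fun _ => \sum_zs _)).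
apply: eq_bigr => xs _; apply: eq_bigr => ys _; apply: eq_bigr => zs _.
rewrite -mulr_sumr -mulrA; congr (_ * _).
  by rewrite /prodw /iid_pmf; apply: eq_bigr => i _; rewrite !ffunE.
rewrite mulrC; congr (_ * _); apply: eq_bigr => i _.
rewrite /strat_cost !ffunE /= /strat /T /T1 /sideZ; congr (d _ (g (f _ (fe _)) (fd _) _ _));
  apply/ffunP => j; rewrite !ffunE //; by case: eqP => [->|_]; rewrite ?ffunE.
Qed.

End SingleLetter.

(** * Closedness of the single-letter region *)

Section Caratheodory.
Variable R : realType.

Lemma caratheodory_pad (N k : nat) (U : Type) (u0 : U) (v : U -> 'rV[R]_N)
  (e : 'I_k -> U) (c : 'I_k -> R) : (k <= N)%N -> (forall i, 0 <= c i) ->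
  exists (e' : 'I_N -> U) (c' : 'I_N -> R), (forall i, 0 <= c' i) /\
    \sum_i c' i *: v (e' i) = \sum_i c i *: v (e i).
Proof.
move=> kN c0.
pose F (i : nat) := oapp (fun j => c j *: v (e j)) 0 (insub i : option 'I_k).
exists (fun i => oapp e u0 (insub (val i))), (fun i => oapp c 0 (insub (val i))); split.
  by move=> i; case: insub => //=.
transitivity (\sum_(i < N) F i).
  by apply: eq_bigr => i _; rewrite /F; case: insub => //=; rewrite scale0r.
transitivity (\sum_(i < k) F i); last by apply: eq_bigr => i _; rewrite /F valK.
rewrite (big_ord_widen N F kN) [RHS]big_mkcond; apply: eq_bigr => i _.
by rewrite /F; case: ifPn => // ik; rewrite insubN.
Qed.

(** Conic form: more than [N] vectors are linearly dependent, and moving the weights along a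
    dependence until one vanishes removes a vector. Total weight is not fixed here; normalisation is
    recovered as one of the coordinates. *)
Lemma caratheodory (N k : nat) (U : Type) (u0 : U) (v : U -> 'rV[R]_N)
  (e : 'I_k -> U) (c : 'I_k -> R) : (forall i, 0 <= c i) ->
  exists (e' : 'I_N -> U) (c' : 'I_N -> R), (forall i, 0 <= c' i) /\
    \sum_i c' i *: v (e' i) = \sum_i c i *: v (e i).
Proof.
elim: k e c => [|k IH] e c c0; first exact: caratheodory_pad.
have [kN|Nk] := leqP k.+1 N; first exact: caratheodory_pad.
pose M : 'M[R]_(k.+1, N) := \matrix_i v (e i).
have : kermx M != 0.
  rewrite kermx_eq0 /row_free neq_ltn; apply/orP; left.
  exact: leq_ltn_trans (rank_leq_col M) Nk.
case/rowV0Pn => a /sub_kermxP aM a0.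
have dep : \sum_i a 0 i *: v (e i) = 0.
  by apply: etrans aM; rewrite mulmx_sum_row; apply: eq_bigr => i _; rewrite rowK.
have [mu [mudep [j0 muj0]]] : exists mu : 'I_k.+1 -> R,
    \sum_i mu i *: v (e i) = 0 /\ exists j, 0 < mu j.
  have [j aj] : exists j, a 0 j != 0.
    apply: contrapT => /forallNP H; move/eqP: a0; apply; apply/rowP => j; rewrite mxE.
    by apply/eqP/negPn/negP/H.
  have [ajp|ajn] := ltP 0 (a 0 j).
    by exists (fun i => a 0 i); split => //; exists j.
  exists (fun i => - a 0 i); split.
    by under eq_bigr do rewrite scaleNr; rewrite sumrN dep oppr0.
  by exists j; rewrite oppr_gt0 lt_neqAle aj.
(* The least ratio [c i / mu i] is the largest step that keeps all weights nonnegative; it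
   annihilates the weight at [j]. *)
case: (arg_minP (P := fun i => 0 < mu i) (fun i => c i / mu i) muj0) => j muj jmin.
pose c1 i := c i - c j / mu j * mu i.
have c10 i : 0 <= c1 i.
  rewrite subr_ge0; have [mui|mui] := ltP 0 (mu i).
    by rewrite -ler_pdivlMr // jmin.
  by apply: le_trans (c0 i); rewrite mulr_ge0_le0 // divr_ge0 // ltW.
have c1j : c1 j = 0 by rewrite /c1 divfK ?subrr // gt_eqF.
have [e' [c' [c'0 E]]] := IH (fun i => e (lift j i)) (fun i => c1 (lift j i)) (fun i => c10 _).
exists e', c'; split => //; rewrite E.
transitivity (\sum_i c1 i *: v (e i)).
  by rewrite [RHS](bigD1_ord j) //= c1j scale0r add0r.
under eq_bigr do rewrite scalerBl -scalerA.
by rewrite sumrB -scaler_sumr mudep scaler0 subr0.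
Qed.

Lemma caratheodory_fun (U K : finType) (u0 : U) (phi : U -> K -> R) :
  exists (e : 'I_#|K| -> U) (c : 'I_#|K| -> R), (forall i, 0 <= c i) /\
    forall k, \sum_i c i * phi (e i) k = \sum_u phi u k.
Proof.
have [e [c [c0 E]]] := @caratheodory #|K| #|U| U u0
  (fun u => \row_j phi u (enum_val j)) enum_val (fun=> 1) (fun=> ler01).
exists e, c; split => // k.
have /rowP/(_ (enum_rank k)) := E; rewrite !summxE.
under eq_bigr do rewrite !mxE enum_rankK.
move=> ->; rewrite [RHS](reindex (@enum_val U predT)) /=; last first.
  by apply: onW_bij; exact: enum_val_bij.
by apply: eq_bigr => i _; rewrite !mxE enum_rankK mul1r.
Qed.

End Caratheodory.

(** * Compactness of the set of test channels *)

Section Closedness.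
Variables (R : realType) (X Y Z Xh : finType).
Variables (p : X -> Y -> R) (pz : X -> Z -> R) (d : X -> Xh -> R).
Hypothesis p_ge0 : forall x y, 0 <= p x y.
Hypothesis pz_ge0 : forall x z, 0 <= pz x z.

(** The preserved coordinates are the |Y| normalisations of [q], the two rates and the distortion,
    whence three layers of [option]. Each kept letter retains its channel [w] and only has its [q]
    rescaled, as homogeneity permits. *)
Lemma admissible_reduce (U : finType) (q : Y -> U -> R) w r1 r2 D (y0 : Y) :
  admissible p pz d q w r1 r2 D ->
  exists (q' : Y -> 'I_#|{: option (option (option Y))}| -> R) w',
    admissible p pz d q' w' r1 r2 D.
Proof.
move=> [q0 q1 w0 w1 [h1 h2 h3]].
have [u0 _] := exists_le_average (fun=> 0) (q0 y0) (q1 y0).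
pose phi u (k : option (option (option Y))) : R :=
  match k with
  | Some (Some (Some y)) => q y u
  | Some (Some None) => rate1 p pz (q^~ u)
  | Some None => rate2 p pz (q^~ u) (fun x => w x u)
  | None => cost p pz (strat_cost d) (q^~ u) (fun x => w x u)
  end.
have [e [c [c0 E]]] := caratheodory_fun u0 phi.
exists (fun y i => c i * q y (e i)), (fun x i => w x (e i)).
split => //.
- by move=> y i; rewrite mulr_ge0.
- by move=> y; rewrite (E (Some (Some (Some y)))) /= q1.
split.
- by under eq_bigr do rewrite rate1Z; rewrite (E (Some (Some None))).
- by under eq_bigr do rewrite rate2Z; rewrite (E (Some None)).
- by under eq_bigr do rewrite costZ; rewrite (E None).
Qed.

Definition xlnx (x : R) : R := x * ln x.

Lemma xlnx_continuous : continuous xlnx.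
Proof.
move=> x; have [x0|x0|->] := ltgtP x 0.
- apply/cvgrPdist_lt => eps eps0; near=> y.
  have y0 : y < 0 by near: y; exact: lt_nbhsl.
  by rewrite /xlnx !ln0 ?mulr0 ?subrr ?normr0 // ltW.
- by apply: cvgM; [exact: cvg_id|exact: continuous_ln].
apply/cvgrPdist_lt => eps eps0; near=> y.
rewrite /xlnx mul0r sub0r normrN.
have [y0|y0] := leP y 0; first by rewrite ln0 // mulr0 normr0.
have y1 : y < 1 by near: y; apply: lt_nbhsl.
have ye : y < (eps / 2) ^+ 2 by near: y; apply: lt_nbhsl; rewrite exprn_gt0 // divr_gt0.
(* With [s] the root of [y], -ln y = -2 ln s <= 2/s, so |y ln y| is at most [2 * s]. *)
pose s := Num.sqrt y.
have s0 : 0 < s by rewrite sqrtr_gt0.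
have sE : y = s ^+ 2 by rewrite sqr_sqrtr // ltW.
have se : s < eps / 2.
  by rewrite -(ltr_pXn2r (n := 2)) ?nnegrE ?(ltW s0) ?divr_ge0 ?(ltW eps0) // -sE.
have lny : ln y <= 0 by rewrite ln_le0 // ltW.
rewrite ler0_norm; last by rewrite mulr_ge0_le0 // ltW.
have : - ln s <= s^-1 - 1 by rewrite -lnV ?posrE //; apply: ln_leB1; rewrite invr_gt0.
rewrite -mulrN {2}sE lnXn // mulr2n opprD => H.
have : y * (- ln s - ln s) <= y * (2 * s^-1).
  by rewrite ler_pM2l //; lra.
move=> /le_lt_trans; apply; rewrite sE.
have -> : s ^+ 2 * (2 * s^-1) = 2 * s by field; rewrite gt_eqF.
lra.
Unshelve. all: by end_near.
Qed.

Section ContinuousEntropy.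
Variables (T : topologicalType) (O : finType) (P : T -> O -> R).
Hypothesis P_cont : forall o, continuous (fun t => P t o).

Lemma sum_continuous (I : finType) (Q : pred I) (F : I -> T -> R) :
  (forall i, continuous (F i)) -> continuous (fun t => \sum_(i | Q i) F i t).
Proof.
by move=> Fc; apply: (continuous_big (op := +%R)) => //; exact: add_continuous.
Qed.

(** Grouping outcomes by value turns the entropy into a sum of x ln x, which is continuous at 0
    while the logarithm is not. *)
Lemma ent_continuous (V : finType) (A : O -> V) : continuous (fun t => ent (P t) A).
Proof.
have -> : (fun t => ent (P t) A) =
    (fun t => - \sum_v xlnx (Pr (P t) (fun o => A o == v))).
  apply: funext => t; rewrite /ent; congr (- _).
  by rewrite (sum_Pr (P t) A (fun v => ln (Pr (P t) (fun o => A o == v)))).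
move=> t; apply: cvgN.
apply: (@sum_continuous _ _ (fun v t => xlnx (Pr (P t) (fun o => A o == v)))) => v s.
apply: (@continuous_comp _ _ _ (fun t => Pr (P t) (fun o => A o == v)) xlnx).
  exact: sum_continuous.
exact: xlnx_continuous.
Qed.

End ContinuousEntropy.

(** Tychonoff's theorem; the space is returned abstractly, so only the evaluation maps and
    compactness are visible afterwards. *)
Lemma compact_cube (K : eqType) : exists (T : topologicalType) (ev : T -> K -> R),
  [/\ forall k, continuous (ev^~ k), forall f, exists t, ev t = f &
      compact [set t | forall k, `[0, 1]%classic (ev t k)]].
Proof.
exists (ArrowAsProduct.prod__canonical__topology_structure_Topological (fun _ : K => R)).
exists (fun t k => t k); split.
- by move=> k; exact: (@proj_continuous K (fun=> R) k).
- by move=> f; exists f.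
- by apply: (@tychonoff K (fun=> R) (fun=> `[0, 1]%classic)) => k; exact: segment_compact.
Qed.

(** With U fixed, pairs of channels form a compact set, on which the total excess over the three
    constraints attains its minimum; approximate solutions force this minimum to be 0. *)
Lemma admissible_closed (U : finType) (r1 r2 D : R) :
  (forall eps : R, 0 < eps -> exists (q : Y -> U -> R) (w : X -> U -> strategies Z Xh -> R),
     admissible p pz d q w (r1 + eps) (r2 + eps) (D + eps)) ->
  exists (q : Y -> U -> R) (w : X -> U -> strategies Z Xh -> R), admissible p pz d q w r1 r2 D.
Proof.
move=> H.
pose K := ((Y * U) + (X * U * strategies Z Xh))%type.
have [TT [ev [ev_cont ev_surj boxc]]] := compact_cube K.
pose Q (t : TT) y u : R := ev t (inl (y, u)).
pose W (t : TT) x u s : R := ev t (inr (x, u, s)).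
set box := (X in compact X) in boxc.
(* Normalisation becomes the zero set of one continuous function, hence a closed condition. *)
pose dev (t : TT) : R := \sum_y `|\sum_u Q t y u - 1| + \sum_x \sum_u `|\sum_s W t x u s - 1|.
have devc : continuous dev.
  move=> t; apply: cvgD.
    apply: (sum_continuous (F := fun y t => `|\sum_u Q t y u - 1|)) => y s.
    apply: cvg_norm; apply: cvgB; last exact: cvg_cst.
    by apply: (sum_continuous (F := fun u t => Q t y u)) => u; exact: ev_cont.
  apply: (sum_continuous (F := fun x t => \sum_u `|\sum_s W t x u s - 1|)) => x.
  apply: (sum_continuous (F := fun u t => `|\sum_s W t x u s - 1|)) => u s.
  apply: cvg_norm; apply: cvgB; last exact: cvg_cst.
  by apply: (sum_continuous (F := fun v t => W t x u v)) => v; exact: ev_cont.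
have dev0 t : dev t = 0 <-> (forall y, \sum_u Q t y u = 1) /\ (forall x u, \sum_s W t x u s = 1).
  split=> [/eqP|[HQ HW]].
    rewrite paddr_eq0 ?sumr_ge0 // => [/andP[]|x _]; last exact: sumr_ge0.
    rewrite !psumr_eq0 // => [/allP HQ /allP HW|x _]; last exact: sumr_ge0.
    split=> [y|x u].
      have := HQ y; rewrite mem_index_enum => /(_ isT); rewrite normr_eq0 subr_eq0.
      by move/eqP.
    have := HW x; rewrite mem_index_enum => /(_ isT); rewrite psumr_eq0 // => /allP/(_ u).
    by rewrite mem_index_enum => /(_ isT); rewrite normr_eq0 subr_eq0 => /eqP.
  rewrite /dev big1 ?add0r => [|y _]; last by rewrite HQ subrr normr0.
  by apply: big1 => x _; apply: big1 => u _; rewrite HW subrr normr0.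
pose A : set TT := box `&` (dev @^-1` [set 0]).
have Ac : compact A.
  apply: compact_closedI => //; apply: preimage_closed; last exact: closed_eq.
  by move=> t _; exact: devc.
have AP t : A t -> [/\ forall y u, 0 <= Q t y u, forall y, \sum_u Q t y u = 1,
    forall x u s, 0 <= W t x u s & forall x u, \sum_s W t x u s = 1].
  move=> [bt /dev0[Q1 W1]]; split => // [y u|x u s].
    by have := bt (inl (y, u)); rewrite /= in_itv /= => /andP[].
  by have := bt (inr (x, u, s)); rewrite /= in_itv /= => /andP[].
pose J (t : TT) := joint p pz (Q t) (W t).
have Jc o : continuous (fun t => J t o).
  case: o => [[[[x y] z] u] s] t; rewrite /J /=.
  apply: cvgM; last exact: ev_cont; apply: cvgM; last exact: ev_cont; exact: cvg_cst.
(* Informations are written through entropies because the quotients inside [cmi] are not continuous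
   where probabilities vanish. *)
pose Icmi (VA VB VC : finType) (a : _ -> VA) (b : _ -> VB) (c : _ -> VC) t : R :=
  ent (J t) (fun o => (a o, c o)) + ent (J t) (fun o => (b o, c o))
    - ent (J t) (fun o => (a o, b o, c o)) - ent (J t) c.
pose f1 := @Icmi U Y Z (fun o => o.1.2) (fun o => o.1.1.1.2) (fun o => o.1.1.2).
pose f2 := @Icmi X (strategies Z Xh) (U * Z)%type
  (fun o => o.1.1.1.1) (fun o => o.2) (fun o => (o.1.2, o.1.1.2)).
pose f3 t : R := \sum_(o : X * Y * Z * U * strategies Z Xh) J t o * strat_cost d o.1.1.1.1 o.2 o.1.1.2.
have Ic (VA VB VC : finType) a b c : continuous (@Icmi VA VB VC a b c).
  by move=> t; apply: cvgB; [apply: cvgB; [apply: cvgD|]|]; exact: ent_continuous.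
have f3c : continuous f3.
  apply: (sum_continuous (F := fun o t => J t o * strat_cost d o.1.1.1.1 o.2 o.1.1.2)) => o t.
  by apply: cvgM; [exact: Jc|exact: cvg_cst].
have fE t : A t -> [/\ f1 t = \sum_u rate1 p pz ((Q t)^~ u),
   f2 t = \sum_u rate2 p pz ((Q t)^~ u) (fun x => W t x u) &
   f3 t = \sum_u cost p pz (strat_cost d) ((Q t)^~ u) (fun x => W t x u)].
  move=> /AP[Q0 Q1 W0 W1]; have J0 := joint_ge0 p_ge0 pz_ge0 Q0 W0.
  split; last exact: cost_atoms.
    by rewrite -(cmi1_atoms p pz Q1 W1) cmi_ent.
  by rewrite -(cmi2_atoms p pz (Q t) W1) cmi_ent.
(* Twice the positive part, so three excesses of at most [e] give [6 * e] below. *)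
pose pos (x : R) : R := `|x| + x.
pose Phi t : R := pos (f1 t - r1) + pos (f2 t - r2) + pos (f3 t - D).
have posc (f : TT -> R) c : continuous f -> continuous (fun t => pos (f t - c)).
  move=> fc t; have fct : (f t - c) @[t --> t] --> f t - c by apply: cvgB; [exact: fc|exact: cvg_cst].
  by apply: cvgD => //; apply: cvg_norm.
have Phic : continuous Phi.
  by move=> t; apply: cvgD; [apply: cvgD|]; apply: posc => //; exact: Ic.
have pos_le (x e : R) : 0 <= e -> x <= e -> pos x <= 2 * e.
  by move=> e0 xe; rewrite /pos; case: (ger0P x) => x0; lra.
have pos_ge0 (x : R) : 0 <= pos x.
  by rewrite /pos; case: (ger0P x) => x0; lra.
have pos0 (x : R) : pos x <= 0 -> x <= 0.
  by rewrite /pos; case: (ger0P x) => x0; lra.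
have near0 (e : R) : 0 < e -> exists2 t, A t & Phi t <= 6 * e.
  move=> e0; have [q [w [q0 q1 w0 w1 [h1 h2 h3]]]] := H e e0.
  have [t tE] := ev_surj (fun k => match k with inl (y, u) => q y u | inr (x, u, s) => w x u s end).
  have QE : Q t = q by apply: funext => y; apply: funext => u; rewrite /Q tE.
  have WE : W t = w by apply: funext => x; apply: funext => u; apply: funext => s; rewrite /W tE.
  have At : A t.
    split; last by apply/dev0; rewrite QE WE.
    move=> [[y u]|[[x u] s]] /=; rewrite tE in_itv /=.
      by rewrite q0 -(q1 y) (bigD1 u) //= lerDl sumr_ge0.
    by rewrite w0 -(w1 x u) (bigD1 s) //= lerDl sumr_ge0.
  exists t => //; have [E1 E2 E3] := fE t At.
  have -> : 6 * e = 2 * e + 2 * e + 2 * e by ring.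
  by rewrite !lerD // pos_le ?(ltW e0) // lerBlDl ?E1 ?E2 ?E3 QE ?WE.
have A0 : A !=set0 by have [t At _] := near0 1 ltr01; exists t.
have [t tA tmin] := compact_EVT_min A0 Ac (continuous_subspaceT Phic).
have {}tA : A t by rewrite -in_setE.
have Phi0 : Phi t <= 0.
  rewrite leNgt; apply/negP => Pt.
  have [t' At' Pt'] := near0 (Phi t / 12) (divr_gt0 Pt (ltr0Sn _ _)).
  have := tmin t' (mem_set At'); lra.
have [Q0 Q1 W0 W1] := AP t tA; have [E1 E2 E3] := fE t tA.
have [p1 p2 p3] := And3 (pos_ge0 (f1 t - r1)) (pos_ge0 (f2 t - r2)) (pos_ge0 (f3 t - D)).
exists (Q t), (W t); split => //; rewrite -E1 -E2 -E3; rewrite /Phi in Phi0.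
by split; rewrite -subr_le0; apply: pos0; lra.
Qed.

End Closedness.

(** * Conclusion of the converse *)

Section Converse.
Variables (R : realType) (X Y Z Xh : finType).
Variables (p : X -> Y -> R) (pz : X -> Z -> R) (d : X -> Xh -> R).
Hypothesis source : source_ok p pz d.

Let p_ge0 : forall x y, 0 <= p x y. Proof. by case: source. Qed.
Let p_sum1 : \sum_x \sum_y p x y = 1. Proof. by case: source => _ []. Qed.
Let pz_ge0 : forall x z, 0 <= pz x z. Proof. by case: source => _ [_ []]. Qed.
Let pz_sum1 : forall x, \sum_z pz x z = 1. Proof. by case: source => _ [_ [_ []]]. Qed.

Lemma admissible_R_YXZ (U : finType) (q : Y -> U -> R) (w : X -> U -> strategies Z Xh -> R)
  (r1 r2 D : R) :
  admissible p pz d q w (r1 * ln 2) (r2 * ln 2) D -> R_YXZ p pz d D (r2, r1).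
Proof.
move=> [q0 q1 w0 w1 [h1 h2 h3]].
exists U, (strategies Z Xh), q, w, (fun u (s : strategies Z Xh) z => s z); split => //.
split => /=.
- apply: le_trans h3; rewrite -cost_atoms le_eqVlt; apply/orP; left; apply/eqP.
  by apply: eq_bigr => -[[[[x y] z] u] s].
- rewrite -(ler_pM2r (ln2_gt0 R)); apply: le_trans h1.
  by rewrite -(cmi1_atoms p pz q1 w1).
- rewrite -(ler_pM2r (ln2_gt0 R)); apply: le_trans h2.
  by rewrite -(cmi2_atoms p pz q w1).
Qed.

Lemma admissible_le (U : finType) (q : Y -> U -> R) w (r1 r2 D r1' r2' D' : R) :
  r1 <= r1' -> r2 <= r2' -> D <= D' ->
  admissible p pz d q w r1 r2 D -> admissible p pz d q w r1' r2' D'.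
Proof.
move=> h1 h2 h3 [q0 q1 w0 w1 [k1 k2 k3]]; split => //.
by split; [exact: le_trans h1|exact: le_trans h2|exact: le_trans h3].
Qed.

Lemma ln_rate_le (m n : nat) (r : R) : (0 < m)%N -> (0 < n)%N ->
  m%:R <= 2 `^ (n%:R * r) -> ln m%:R / n%:R <= r * ln 2.
Proof.
move=> m0 n0 mle; rewrite ler_pdivrMr ?ltr0n //.
have : ln m%:R <= ln (2 `^ (n%:R * r)) by rewrite ler_ln ?posrE ?ltr0n // powR_gt0.
by rewrite two_powR expRK (_ : n%:R * r * ln 2 = r * ln 2 * n%:R) //; ring.
Qed.

Theorem RgO_sec_sub (D Re Rd : R) : RgO_sec p pz d Re Rd D `<=` R_sec p pz d Rd D.
Proof.
move=> r clr; rewrite /R_sec /=.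
have [x0 _] := exists_le_average (fun=> 0) (fun x => sumr_ge0 _ (fun y _ => p_ge0 x y)) p_sum1.
have [[x1 y0] _] : exists xy : X * Y, True.
  have := p_sum1; rewrite pair_bigA /= => p1.
  by have [xy _] := exists_le_average (fun=> 0) (fun xy : X * Y => p_ge0 xy.1 xy.2) p1; exists xy.
suff [q [w adm]] : exists (q : Y -> 'I_#|{: option (option (option Y))}| -> R) w,
    admissible p pz d q w (Rd * ln 2) (r * ln 2) D by exact: admissible_R_YXZ adm.
apply: admissible_closed => // eps eps0.
(* Half of the slack approximates the point of the closure by an achievable triple, the other half
   is the [delta] of its code; as ln 2 <= 1, [eps] bits are at most [eps] nats. *)
have e20 : 0 < eps / 2 by rewrite divr_gt0.
have [[[r' re'] rd'] [ach [[br _] bd]]] := clr _ (nbhsx_ballx _ _ e20).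
have [N HN] := ach _ e20.
have [m [me [md [fe [fd [f [g [mle _ mdle dle]]]]]]]] := HN N.+1 (leqnSn N) (ltn0Sn N).
have [U [q [w adm]]] := code_single_letter d p_ge0 pz_ge0 p_sum1 pz_sum1 fe fd f g (ltn0Sn N).
(* The alphabet is reduced for each [eps] separately, so that it is the same for all of them when
   the limit is taken. *)
apply: (admissible_reduce y0 (q := q) (w := w)).
(* The message sets contain the image of a block, so they are nonempty and their logarithms can be
   compared. *)
have md0 : (0 < md)%N by apply: leq_ltn_trans (ltn_ord (fd [ffun=> y0])).
have m0 : (0 < m)%N by apply: leq_ltn_trans (ltn_ord (f [ffun=> x0] (fe [ffun=> y0]))).
have l2 := ln2_gt0 R.
have l21 : ln 2 <= 1 :> R by apply: le_trans (ln_leB1 _) _ => //; lra.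
apply: admissible_le adm.
- apply: le_trans (ln_rate_le md0 (ltn0Sn N) mdle) _.
  move: bd; rewrite /ball /= ltr_norml => /andP[b1 b2]; nra.
- apply: le_trans (ln_rate_le m0 (ltn0Sn N) mle) _.
  move: br; rewrite /ball /= ltr_norml => /andP[b1 b2]; nra.
- apply: le_trans dle _; lra.
Qed.

End Converse.

Theorem theorem5 (R : realType) (X Y Z Xh : finType)
  (p : X -> Y -> R) (pz : X -> Z -> R) (d : X -> Xh -> R) (D Re Rd : R) :
  source_ok p pz d -> 0 <= Rd -> Rd <= Re ->
  RgO_sec p pz d Re Rd D = R_sec p pz d Rd D.
Proof.
move=> source Rd0 RdRe; apply/seteqP; split; first exact: RgO_sec_sub.
by move=> r Hr; apply: subset_closure; exact: R_YXZ_achievable.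
Qed.
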